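(* Let $U$ be a reflexive separable Banach space, let $\xi\sim\mathcal N(0,\Sigma)$ be a centered $m$-dimensional Gaussian random vector on a probability space $(\Omega,\mathcal F,\mathbb P)$, and let $g\colon U\times\mathbb R^m\to\mathbb R$ be locally Lipschitzian and jointly convex in both variables $(u,z)$. Let $\bar u\in U$ satisfy $g(\bar u,0)<0$ and assume the set $M:=\{z\in\mathbb R^m\mid g(\bar u,z)\le 0\}$ is bounded. Then, with $\varphi(u):=\mathbb P(\omega\mid g(u,\xi(\omega))\le 0)$, \[ \partial^C\varphi(\bar u)=\int_{\mathbb S^{m-1}}\partial^C_u e(\bar u,v)\,d\mu_\zeta(v). \]
   Context: $\Sigma^{1/2}$ denotes a root of the covariance matrix $\Sigma$. The radial probability function is $e(u,v):=\mu_\eta\{r\ge 0\mid g(u,r\Sigma^{1/2}v)\le 0\}$ for $u\in U$, $v\in\mathbb S^{m-1}$, where $\mu_\eta$ is the chi distribution with $m$ degrees of freedom. $\mu_\zeta$ is the uniform distribution on the unit sphere $\mathbb S^{m-1}$. $\partial^C$ denotes the Clarke subdifferential and $\partial^C_u$ the partial Clarke subdifferential with respect to $u$. The integral is an Aumann integral: it is the set of all $x^*\in U^*$ for which there is a measurable selection $v\mapsto \hat x^*_v\in\partial^C_u e(\bar u,v)$ ($\mu_\zeta$-a.e.) with $x^*(h)=\int_{\mathbb S^{m-1}}\hat x^*_v(h)\,d\mu_\zeta(v)$ for all $h\in U$. *)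

(* Defs.v *)
From HB Require Import structures.
From mathcomp Require Import all_boot all_order all_algebra.
From mathcomp Require Import all_classical all_reals all_analysis.
Set Implicit Arguments. Unset Strict Implicit. Unset Printing Implicit Defensive.
Import Order.TTheory GRing.Theory Num.Theory.
Import numFieldNormedType.Exports.
Local Open Scope classical_set_scope.
Local Open Scope ring_scope.

Section Defs.
Variable R : realType.

Section Banach.
Variable U : normedModType R.

Definition is_dual (x : U -> R) : Prop :=
  (forall (a : R) (u v : U), x (a *: u + v) = a * x u + x v) /\
  (exists C : R, forall u : U, `|x u| <= C * `|u|).

Definition dual_norm (x : U -> R) : R :=
  sup [set `|x u| | u in [set u : U | `|u| <= 1]].

Definition separable_space : Prop :=
  exists D : set U, countable D /\ dense D.

Definition reflexive_space : Prop :=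
  forall Phi : (U -> R) -> R,
    (forall (a : R) (x y : U -> R), is_dual x -> is_dual y ->
        Phi (fun u => a * x u + y u) = a * Phi x + Phi y) ->
    (exists C : R, forall x, is_dual x -> `|Phi x| <= C * dual_norm x) ->
    exists u : U, forall x, is_dual x -> Phi x = x u.

Definition clarke_dd (f : U -> R) (u h : U) : \bar R :=
  ereal_inf [set ereal_sup
     [set q : \bar R | exists (y : U) (t : R),
        `|y - u| < delta /\ 0 < t < delta /\ q = ((f (y + t *: h) - f y) / t)%:E]
   | delta in [set delta : R | 0 < delta]].

Definition clarke_subdiff (f : U -> R) (u : U) : set (U -> R) :=
  [set x | is_dual x /\ forall h : U, ((x h)%:E <= clarke_dd f u h)%E].
End Banach.

Definition Rm (m : nat) := g_sigma_algebraType (@open 'cV[R]_m).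

Definition dotv (m : nat) (a b : 'cV[R]_m) : R := (a^T *m b) 0 0.

Definition sphere (m : nat) : set (Rm m) := [set v | dotv v v = 1].

Definition uniform_sphere (m : nat) (mu : probability (Rm m) R) : Prop :=
  mu (@sphere m) = 1%E /\
  forall Q : 'M[R]_m, Q^T *m Q = 1%:M ->
    forall A : set (Rm m), measurable A ->
      mu ((fun v : Rm m => (Q *m v : Rm m)) @^-1` A) = mu A.

Definition chi_density (m : nat) (r : R) : R := r ^+ m.-1 * expR (- (r ^+ 2) / 2).
Definition chi_prob (m : nat) (A : set R) : R :=
  fine (\int[@lebesgue_measure R]_(r in A `&` `[0, +oo[) (chi_density m r)%:E)
  / fine (\int[@lebesgue_measure R]_(r in `[0, +oo[) (chi_density m r)%:E).

Section Prob.
Context {d : measure_display} {Omega : measurableType d}.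

(* xi ~ N(0, Sigma), via its characteristic function
   E[exp(i <a, xi>)] = exp(- a^T Sigma a / 2) *)
Definition gaussian (m : nat) (P : probability Omega R) (xi : Omega -> Rm m)
    (Sigma : 'M[R]_m) : Prop :=
  measurable_fun setT xi /\
  forall a : 'cV[R]_m,
    (\int[P]_w (cos (dotv a (xi w)))%:E = (expR (- dotv a (Sigma *m a) / 2))%:E)%E /\
    (\int[P]_w (sin (dotv a (xi w)))%:E = 0)%E.

Definition prob_fun (U : Type) (m : nat) (P : probability Omega R) (xi : Omega -> Rm m)
    (g : U -> 'cV[R]_m -> R) (u : U) : R :=
  fine (P [set w | g u (xi w) <= 0]).
End Prob.

Definition radial_prob (U : Type) (m : nat) (L : 'M[R]_m) (g : U -> 'cV[R]_m -> R)
    (u : U) (v : 'cV[R]_m) : R :=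
  chi_prob m [set r | 0 <= r /\ g u (r *: (L *m v)) <= 0].

Definition locally_lipschitz (U : normedModType R) (m : nat) (g : U -> 'cV[R]_m -> R) : Prop :=
  forall (u : U) (z : 'cV[R]_m), exists r : R, exists K : R, 0 < r /\
    forall (u1 u2 : U) (z1 z2 : 'cV[R]_m),
      `|u1 - u| < r -> `|u2 - u| < r -> `|z1 - z| < r -> `|z2 - z| < r ->
      `|g u1 z1 - g u2 z2| <= K * (`|u1 - u2| + `|z1 - z2|).

Definition jointly_convex (U : normedModType R) (m : nat) (g : U -> 'cV[R]_m -> R) : Prop :=
  forall (t : R) (u1 u2 : U) (z1 z2 : 'cV[R]_m), 0 <= t <= 1 ->
    g (t *: u1 + (1 - t) *: u2) (t *: z1 + (1 - t) *: z2)
      <= t * g u1 z1 + (1 - t) * g u2 z2.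

(* Aumann integral of a set-valued map F : S^{m-1} => U^* w.r.t. mu:
   all x in U^* admitting a (weak-* ) measurable selection s of F (mu-a.e.)
   with x(h) = int s_v(h) dmu(v) for all h. *)
Definition aumann_integral (U : normedModType R) (m : nat) (mu : probability (Rm m) R)
    (F : Rm m -> set (U -> R)) : set (U -> R) :=
  [set x | is_dual x /\
    exists s : Rm m -> U -> R,
      (forall h : U, measurable_fun setT (fun v => s v h)) /\
      {ae mu, forall v, F v (s v)} /\
      (forall h : U, mu.-integrable setT (fun v => (s v h)%:E) /\
                     (x h)%:E = (\int[mu]_v (s v h)%:E)%E)].
End Defs.

(* Main.v *)
(* In polar coordinates the Gaussian law is the image of [mu_zeta \x chi] under (v, r) |-> r L v: both laws have the same characteristic function, because rotation invariance determines the moments of <b, v> on the sphere recursively, and the recursion for the moments of the chi law compensates it exactly. Hence phi(u) is the expectation of e(u, v).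

For u near ubar the sublevel set along each ray is an interval [0, rho_v(u)], where rho_v is either identically infinite or finite and, by joint convexity, concave; moreover g(ubar, 0) < 0 bounds the relative variation of rho_v by a constant times |u1 - u2|. As e(u, v) = F(rho_v(u)) with r F'(r) bounded, all e(., v) share a Lipschitz constant near ubar, and -e(., v) is Clarke regular. The Clarke directional derivative is then a limit of backward difference quotients, so dominated convergence shows that the derivative of phi is the expectation of the derivatives p_v of the e(., v).

It remains to write every functional x dominated by the sublinear functional E p_v as the expectation of a selection x_v <= p_v (Strassen's disintegration theorem). By the Hahn-Banach theorem x extends from constant to bounded fields, below the upper integral of p; the values on fields 1_A h define, for each h, a signed measure of A which is absolutely continuous, and its Radon-Nikodym density in h, computed for h in a countable dense rational subspace, is almost surely linear and extends continuously to x_v. *)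
Require Import Defs.
From HB Require Import structures.
From mathcomp Require Import all_boot all_order all_algebra.
From mathcomp Require Import all_classical all_reals all_analysis.
From mathcomp Require Import measurable_realfun ring lra.
Set Implicit Arguments. Unset Strict Implicit. Unset Printing Implicit Defensive.
Import Order.TTheory GRing.Theory Num.Theory.
Import numFieldNormedType.Exports.
Local Open Scope classical_set_scope.
Local Open Scope ring_scope.

(** * Bounded measurable functions *)

(** Two obstacles shape the proof. First, the Clarke derivative is a limsup over moving base points,
    and exchanging such a limsup with an expectation gives in general only one inequality. Concavity
    supplies the other one: a forward slope of [rho_v] at [y] is at most its backward slope at [y]
    over any fixed step, and the latter varies continuously with [y]. Hence the backward quotients
    at the single point [ubar] already converge to the Clarke derivative; being a sequence, they
    also make it measurable in [v]. Second, [rho_v(ubar)] may be unbounded in [v] when [L] is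
    singular, so the functions [rho_v] share no Lipschitz constant. Only their relative variation is
    uniform, and this is exactly what a bound on [r F'(r)] can use. In the disintegration step the
    Hahn-Banach theorem is applied in the form that every sublinear functional dominates a linear
    one. The values on constant fields are forced by the dominating functional itself: by linearity,
    being below [x] on all constants means being equal to [x] there. *)

Section MeasurableSets.
Context d (T : measurableType d) (R : realType).
Implicit Types f g : T -> R.

Lemma measurable_set_lt f g : measurable_fun setT f -> measurable_fun setT g ->
  measurable [set t | f t < g t].
Proof.
move=> mf mg; have := measurable_fun_ltr mf mg measurableT (Y := [set true]) I.
by rewrite setTI.
Qed.

Lemma measurable_set_le f g : measurable_fun setT f -> measurable_fun setT g ->
  measurable [set t | f t <= g t].
Proof.
move=> mf mg; have := measurable_fun_ler mf mg measurableT (Y := [set true]) I.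
by rewrite setTI.
Qed.

End MeasurableSets.

Section RealIntegrable.
Context d (T : measurableType d) (R : realType) (mu : {measure set T -> \bar R}).
Variables (D : set T) (mD : measurable D).
Implicit Types f g : T -> R.

Lemma real_integrableZ a f : mu.-integrable D (EFin \o f) ->
  mu.-integrable D (EFin \o (fun x => a * f x)).
Proof. by move=> fi; have := integrableZl mD a fi; exact. Qed.

Lemma real_integrableD f g : mu.-integrable D (EFin \o f) ->
  mu.-integrable D (EFin \o g) -> mu.-integrable D (EFin \o (fun x => f x + g x)).
Proof. by move=> fi gi; have := integrableD mD fi gi; exact. Qed.

Lemma real_integrableB f g : mu.-integrable D (EFin \o f) ->
  mu.-integrable D (EFin \o g) -> mu.-integrable D (EFin \o (fun x => f x - g x)).
Proof. by move=> fi gi; have := integrableB mD fi gi; exact. Qed.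

Lemma real_integrable_norm f : mu.-integrable D (EFin \o f) ->
  mu.-integrable D (EFin \o (fun x => `|f x|)).
Proof. by move=> fi; have := integrable_norm fi; exact. Qed.

Lemma real_integrable_boundedM (C : R) f g : measurable_fun D f ->
  (forall x, D x -> `|f x| <= C) -> mu.-integrable D (EFin \o g) ->
  mu.-integrable D (EFin \o (fun x => f x * g x)).
Proof.
move=> mf fC gi; apply: (le_integrable mD _ _ (real_integrableZ C gi)).
  apply/measurable_EFinP; apply: measurable_funM => //.
  by apply/measurable_EFinP; exact: measurable_int gi.
move=> x Dx; rewrite /= lee_fin !normrM ler_wpM2r //.
by rewrite (le_trans (fC x Dx)) // ler_norm.
Qed.

End RealIntegrable.
Arguments real_integrable_boundedM {d T R mu D} mD C [f g].

Section BoundedIntegral.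
Context d (T : measurableType d) (R : realType) (mu : probability T R).
Implicit Types f g : T -> R.

(** Boundedness everywhere, not almost everywhere, gives integrability for every probability at
    once, so that integrals in this class are real numbers with plain algebra. *)
Definition bounded_mfun f :=
  measurable_fun setT f /\ exists C : R, forall x, `|f x| <= C.

Lemma bounded_mfun_integrable f : bounded_mfun f ->
  mu.-integrable setT (EFin \o f).
Proof.
move=> [mf [C fC]].
apply: (@le_integrable _ _ _ mu setT _ _ (EFin \o cst C)) => //.
- exact/measurable_EFinP.
- by move=> x _ /=; rewrite lee_fin (le_trans (fC x)) // ler_norm.
- exact: finite_measure_integrable_cst.
Qed.

Lemma bounded_mfun_cst (c : R) : bounded_mfun (fun=> c).
Proof. by split => //; exists `|c|. Qed.

Lemma bounded_mfunD f g : bounded_mfun f -> bounded_mfun g ->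
  bounded_mfun (fun x => f x + g x).
Proof.
move=> [mf [C fC]] [mg [D gD]]; split; first exact: measurable_funD.
by exists (C + D) => x; rewrite (le_trans (ler_normD _ _)) // lerD.
Qed.

Lemma bounded_mfunM f g : bounded_mfun f -> bounded_mfun g ->
  bounded_mfun (fun x => f x * g x).
Proof.
move=> [mf [C fC]] [mg [D gD]]; split; first exact: measurable_funM.
by exists (C * D) => x; rewrite normrM ler_pM.
Qed.

Lemma bounded_mfunZ (c : R) f : bounded_mfun f -> bounded_mfun (fun x => c * f x).
Proof. by move=> bf; apply: bounded_mfunM => //; exact: bounded_mfun_cst. Qed.

Lemma bounded_mfunN f : bounded_mfun f -> bounded_mfun (fun x => - f x).
Proof.
by move=> /(bounded_mfunZ (-1)); under [in X in bounded_mfun X -> _]eq_fun do rewrite mulN1r.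
Qed.

Lemma bounded_mfunB f g : bounded_mfun f -> bounded_mfun g ->
  bounded_mfun (fun x => f x - g x).
Proof. by move=> bf bg; apply: bounded_mfunD => //; exact: bounded_mfunN. Qed.

Lemma bounded_mfun_max f g : bounded_mfun f -> bounded_mfun g ->
  bounded_mfun (fun x => Num.max (f x) (g x)).
Proof.
move=> [mf [C fC]] [mg [D gD]]; split; first exact: measurable_maxr.
exists (C + D) => x.
have C0 := le_trans (normr_ge0 _) (fC x); have D0 := le_trans (normr_ge0 _) (gD x).
by case: (leP (f x) (g x)) => _; [rewrite (le_trans (gD x)) // lerDr
  |rewrite (le_trans (fC x)) // lerDl].
Qed.

Lemma bounded_mfun_indic (A : set T) : measurable A ->
  bounded_mfun (\1_A : T -> R).
Proof.
move=> mA; split; first exact: measurable_indic.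
by exists 1 => x; rewrite indicE; case: (_ \in _); rewrite ?normr0 ?normr1.
Qed.

Lemma expect_cst (c : R) : \int[mu]_x c = c.
Proof.
by rewrite Rintegral_cst // [X in fine X](_ : _ = 1%E) ?mulr1 //; exact: probability_setT.
Qed.

Lemma expectD f g : bounded_mfun f -> bounded_mfun g ->
  \int[mu]_x (f x + g x) = \int[mu]_x f x + \int[mu]_x g x.
Proof. by move=> /bounded_mfun_integrable ? /bounded_mfun_integrable ?; exact: RintegralD. Qed.

Lemma expectB f g : bounded_mfun f -> bounded_mfun g ->
  \int[mu]_x (f x - g x) = \int[mu]_x f x - \int[mu]_x g x.
Proof. by move=> /bounded_mfun_integrable ? /bounded_mfun_integrable ?; exact: RintegralB. Qed.

Lemma expectZ c f : bounded_mfun f ->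
  \int[mu]_x (c * f x) = c * \int[mu]_x f x.
Proof. by move=> /bounded_mfun_integrable ?; exact: RintegralZl. Qed.

Lemma le_expect f g : bounded_mfun f -> bounded_mfun g ->
  (forall x, f x <= g x) -> \int[mu]_x f x <= \int[mu]_x g x.
Proof.
by move=> /bounded_mfun_integrable ? /bounded_mfun_integrable ? fg; apply: le_Rintegral.
Qed.

Lemma le_norm_expect f (C : R) : bounded_mfun f -> (forall x, `|f x| <= C) ->
  `|\int[mu]_x f x| <= C.
Proof.
move=> bf fC; rewrite ler_norml -{1}(expect_cst (- C)) -{2}(expect_cst C).
apply/andP; split; apply: le_expect => //; try exact: bounded_mfun_cst.
  by move=> x; have := fC x; rewrite ler_norml => /andP[].
by move=> x; have := fC x; rewrite ler_norml => /andP[].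
Qed.

Lemma EFin_expect f : bounded_mfun f ->
  (\int[mu]_x (f x)%:E)%E = (\int[mu]_x f x)%:E.
Proof.
move=> /bounded_mfun_integrable bf; rewrite /Rintegral fineK //.
exact: integrable_fin_num.
Qed.

Lemma expect_sum (I : Type) (r : seq I) (F : I -> T -> R) :
  (forall i, bounded_mfun (F i)) ->
  \int[mu]_x (\sum_(i <- r) F i x) = \sum_(i <- r) \int[mu]_x F i x.
Proof.
move=> bF; elim: r => [|i r ih].
  by rewrite big_nil; under eq_Rintegral do rewrite big_nil; rewrite expect_cst.
rewrite big_cons; under eq_Rintegral do rewrite big_cons.
rewrite expectD ?ih //.
elim: r {ih} => [|j r ih].
  by under eq_fun do rewrite big_nil; exact: bounded_mfun_cst.
by under eq_fun do rewrite big_cons; exact: bounded_mfunD.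
Qed.

Lemma expect_indic (A : set T) : measurable A ->
  \int[mu]_x (\1_A x : R) = fine (mu A).
Proof. by move=> mA; rewrite /Rintegral integral_indic // setIT. Qed.

(** Dominated convergence with a constant majorant. It also returns measurability of the limit,
    which is the way functions known only as limits enter the class. *)
Lemma expect_cvg (f_ : nat -> T -> R) f (C : R) :
  (forall n, measurable_fun setT (f_ n)) -> (forall n x, `|f_ n x| <= C) ->
  (forall x, f_ ^~ x @ \oo --> f x) ->
  bounded_mfun f /\ (fun n => \int[mu]_x f_ n x) @ \oo --> \int[mu]_x f x.
Proof.
move=> mf_ fC ff.
have mf : measurable_fun setT f.
  apply: (measurable_fun_cvg mf_) => x _; exact: ff.
have bf : bounded_mfun f.
  split => //; exists C => x.
  have h : (fun n => `|f_ n x|) @ \oo --> `|f x| by apply: cvg_norm; exact: ff.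
  apply: (cvgr_to_le h).
  by apply: nearW => n; exact: fC.
split => //.
have [|||||_ _] := @dominated_convergence _ _ _ mu setT measurableT
  (fun n x => (f_ n x)%:E) (fun x => (f x)%:E) (EFin \o fun=> C).
- by move=> n; exact/measurable_EFinP.
- exact/measurable_EFinP.
- by apply: aeW => x _; apply: cvg_EFin; [exact: nearW|exact: ff].
- exact/bounded_mfun_integrable/bounded_mfun_cst.
- by apply: aeW => x n _; rewrite lee_fin.
rewrite EFin_expect // => /fine_cvg; apply: cvg_trans.
by apply: near_eq_cvg; apply: nearW.
Qed.

End BoundedIntegral.

(** * Borel measurability in R^m through coordinates *)

Section BorelRm.
Context (R : realType) (m : nat).

(** Second countability, with an explicit basis: it reduces the sigma-algebra generated by all open
    sets to countably many balls. *)
Lemma open_countable_bigcup (O : set 'cV[R]_m) : open O ->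
  O = \bigcup_(p in [set p : 'cV[rat]_m * nat |
                     ball (map_mx ratr p.1 : 'cV[R]_m) p.2.+1%:R^-1 `<=` O])
      ball (map_mx ratr p.1 : 'cV[R]_m) p.2.+1%:R^-1.
Proof.
move=> oO; rewrite eqEsubset; split; last by move=> x [p /= pO px]; exact: pO.
move=> x Ox; have /nbhs_ballP[e /= e0 xeO] := open_nbhs_nbhs (conj oO Ox).
(* With radius below [e / 2], a ball that contains [x] lies inside the [e]-ball around [x]. *)
pose n := Num.truncn (2 / e); have ne : n.+1%:R^-1 < e / 2.
  rewrite -[ltRHS]invrK ltf_pV2 ?posrE ?invr_gt0 ?divr_gt0 // invf_div.
  by rewrite truncnS_gt // divr_ge0 // ltW.
have n0 : 0 < n.+1%:R^-1 :> R by rewrite invr_gt0.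
have qP i : {q : rat | ball (x i 0) n.+1%:R^-1 (ratr q : R)}.
  have h : x i 0 - n.+1%:R^-1 < x i 0 + n.+1%:R^-1 by rewrite ltrD2l gtrN.
  apply: cid; have [q] := rat_in_itvoo h; rewrite in_itv /= => /andP[q1 q2].
  by exists q; rewrite /ball /= ltr_distlC q1 q2.
pose c : 'cV[rat]_m := \col_i sval (qP i).
exists (c, n) => /=; last first.
  split => // i j; rewrite !mxE (ord1 j); apply: ball_sym; exact: (svalP (qP i)).
move=> y [_ cy]; apply: xeO; split => // i j; rewrite (ord1 j).
have := cy i 0; rewrite !mxE => h.
apply: (@le_ball _ _ _ (n.+1%:R^-1 + n.+1%:R^-1)); first by rewrite [leRHS](splitr e) lerD // ltW.
by apply: ball_triangle h; exact: (svalP (qP i)).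
Qed.

(** Balls of the max norm are products of intervals, so the preimage of a rational ball is a finite
    intersection of conditions on single coordinates. *)
Lemma measurable_fun_Rm d (T : measurableType d) (f : T -> Rm R m) :
  (forall i, measurable_fun setT (fun t => f t i 0)) ->
  measurable_fun setT f.
Proof.
move=> mf; apply: (@measurability _ _ T (Rm R m) setT f (@open 'cV[R]_m) erefl).
move=> _ [V oV <-]; rewrite setTI (open_countable_bigcup oV) preimage_bigcup.
rewrite bigcup_mkcond; apply: countable_bigcupT_measurable => // -[c n].
case: ifPn => // _ /=.
rewrite [X in measurable X](_ : _ = \bigcap_(i in [set: 'I_m])
  [set t | `|ratr (c i 0) - f t i 0| < n.+1%:R^-1]); last first.
  rewrite eqEsubset; split => [t [_ h] i _ /=|t h].
    by have := h i 0; rewrite mxE.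
  split; first by rewrite invr_gt0.
  by move=> i j; rewrite (ord1 j) mxE; exact: h.
apply: fin_bigcap_measurable => // i _.
apply: measurable_set_lt => //.
by apply: measurableT_comp => //; exact: measurable_funB.
Qed.

Lemma continuous_measurable_Rm (f : 'cV[R]_m -> R) : continuous f ->
  measurable_fun setT (f : Rm R m -> R).
Proof.
move=> /continuousP cf; apply: (measurability _ (RGenOpens.measurableE R)).
move=> _ [_ [a [b ->] <-]]; rewrite setTI; apply: sub_sigma_algebra.
exact/cf/interval_open.
Qed.

Lemma measurable_coord (i : 'I_m) :
  measurable_fun setT (fun y : Rm R m => (y : 'cV[R]_m) i 0).
Proof. by apply: continuous_measurable_Rm; exact: coord_continuous. Qed.

Lemma dotvE (a b : 'cV[R]_m) : dotv a b = \sum_i a i 0 * b i 0.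
Proof. by rewrite /dotv mxE; apply: eq_bigr => i _; rewrite !mxE. Qed.

Lemma measurable_dotv d (T : measurableType d) (f g : T -> Rm R m) :
  measurable_fun setT f -> measurable_fun setT g ->
  measurable_fun setT (fun t => dotv (f t) (g t)).
Proof.
move=> mf mg; under eq_fun do rewrite dotvE.
apply: measurable_sum => i; apply: measurable_funM.
  exact: (measurableT_comp (measurable_coord i)).
exact: (measurableT_comp (measurable_coord i)).
Qed.

Lemma measurable_mulmx d (T : measurableType d) (L : 'M[R]_m) (f : T -> Rm R m) :
  measurable_fun setT f -> measurable_fun setT (fun t => L *m f t : Rm R m).
Proof.
move=> mf; apply: measurable_fun_Rm => i.
under eq_fun do rewrite mxE.
apply: measurable_sum => j; apply: measurable_funM => //.
exact: (measurableT_comp (measurable_coord j)).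
Qed.

Lemma measurable_scale d (T : measurableType d) (r : T -> R) (f : T -> Rm R m) :
  measurable_fun setT r -> measurable_fun setT f ->
  measurable_fun setT (fun t => r t *: f t : Rm R m).
Proof.
move=> mr mf; apply: measurable_fun_Rm => i.
under eq_fun do rewrite mxE.
by apply: measurable_funM => //; exact: (measurableT_comp (measurable_coord i)).
Qed.

End BorelRm.

(** * Uniqueness of characteristic functions *)

Section SignApproximation.
Context (R : realType).
Implicit Types t x : R.

(* Iterating this map on [-1, 1] approximates the sign function by polynomials. *)
Definition sign_step t := (3 * t - t ^+ 3) / 2.

(** For an iterate [y], the gap [1 - sign_step y] is [1 - y] times [(1 - y) (2 + y) / 2], a factor
    at most [1 - y / 2]. As the iterates increase from [t], this is at most the fixed rate
    [1 - t / 2]. *)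
Lemma sign_step_iter_bounds t n : 0 < t <= 1 ->
  t <= iter n sign_step t <= 1 /\ 1 - iter n sign_step t <= (1 - t / 2) ^+ n.
Proof.
move=> /andP[t0 t1]; elim: n => [|n [/andP[ih1 ih2] ih3]] /=.
  by rewrite lexx t1 expr0; split => //; rewrite gerBl ltW.
set y := iter n sign_step t in ih1 ih2 ih3 *.
have y0 : 0 < y by apply: lt_le_trans ih1.
have e1 : 1 - sign_step y = (1 - y) * ((1 - y) * (2 + y) / 2) by rewrite /sign_step; field.
have e2 : sign_step y - y = y * (1 - y) * (1 + y) / 2 by rewrite /sign_step; field.
have h1 : 0 <= 1 - sign_step y by rewrite e1 !(mulr_ge0, divr_ge0) // ?subr_ge0 // addr_ge0 // ltW.
have h2 : 0 <= sign_step y - y.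
  by rewrite e2 !(mulr_ge0, divr_ge0) // ?subr_ge0 ?addr_ge0 // ltW.
split; first by apply/andP; split; lra.
rewrite e1 exprSr ler_pM // ?subr_ge0 //.
  by rewrite !(mulr_ge0, divr_ge0) // ?subr_ge0 // addr_ge0 // ltW.
have -> : (1 - y) * (2 + y) / 2 = 1 - y / 2 - y ^+ 2 / 2 by field.
have : 0 <= y ^+ 2 / 2 by rewrite divr_ge0 // sqr_ge0.
lra.
Qed.

Lemma sign_stepN t : sign_step (- t) = - sign_step t.
Proof. by rewrite /sign_step; field. Qed.

Lemma iter_sign_stepN t n : iter n sign_step (- t) = - iter n sign_step t.
Proof. by elim: n => //= n ->; rewrite sign_stepN. Qed.

Lemma iter_sign_step0 n : iter n sign_step 0 = 0.
Proof. by elim: n => //= n ->; rewrite /sign_step; field. Qed.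

Lemma norm_iter_sign_step t n : `|t| <= 1 -> `|iter n sign_step t| <= 1.
Proof.
have pos x : 0 < x <= 1 -> `|iter n sign_step x| <= 1.
  move=> /[dup] /andP[x0 _] /(sign_step_iter_bounds n)[/andP[h1 h2] _].
  by rewrite ger0_norm // (le_trans _ h1) // ltW.
have [t0|t0|->] := ltgtP t 0; last by rewrite iter_sign_step0 normr0.
  move=> t1; rewrite -(opprK t) iter_sign_stepN normrN pos //.
  by rewrite oppr_gt0 t0 -(ltr0_norm t0).
by move=> t1; rewrite pos // t0 -(gtr0_norm t0).
Qed.

Lemma cvg_iter_sign_step t : `|t| <= 1 ->
  (fun n => iter n sign_step t) @ \oo --> Num.sg t.
Proof.
have pos x : 0 < x <= 1 -> (fun n => iter n sign_step x) @ \oo --> (1 : R).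
  move=> xx; apply/cvgrPdist_le => e e0.
  have : geometric 1 (1 - x / 2) @ \oo --> 0.
    apply: cvg_geometric; rewrite ltr_norml; case/andP: xx => x0 x1.
    by apply/andP; split; lra.
  move=> /cvgrPdist_le/(_ _ e0); apply: filterS => n.
  rewrite sub0r normrN /= mul1r => h.
  have [/andP[h1 h2] h3] := sign_step_iter_bounds n xx.
  by rewrite ger0_norm ?subr_ge0 // (le_trans h3) // (le_trans (ler_norm _)).
have [t0 t1|t0 t1|-> _] := ltgtP t 0.
- rewrite ltr0_sg // (_ : (fun n => _) = (fun n => - iter n sign_step (- t))); last first.
    by apply/funext => n; rewrite iter_sign_stepN opprK.
  by apply: cvgN; apply: pos; rewrite oppr_gt0 t0 -(ltr0_norm t0).
- by rewrite gtr0_sg //; apply: pos; rewrite t0 -(gtr0_norm t0).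
- rewrite sgr0 (_ : (fun n => _) = fun=> 0); first exact: cvg_cst.
  by apply/funext => n; rewrite iter_sign_step0.
Qed.

End SignApproximation.

(** * Measures agreeing on an algebra of bounded functions *)

Section MultiplicativeClass.
Context d (T : measurableType d) (R : realType) (mu1 mu2 : probability T R).
Variable A : set (T -> R).
Hypothesis A_bounded : forall f, A f -> bounded_mfun f.
Hypothesis A_lin : forall c f g, A f -> A g -> A (fun x => c * f x + g x).
Hypothesis A_mul : forall f g, A f -> A g -> A (fun x => f x * g x).
Hypothesis A_one : A (fun=> 1).
Hypothesis A_expect : forall f, A f -> \int[mu1]_x f x = \int[mu2]_x f x.

(** A single level of bounded limits suffices: it reaches the indicators of the sets [0 < f] and is
    stable under products, hence yields a pi-system. *)
Definition bounded_limit (h : T -> R) := exists (f_ : nat -> T -> R) (C : R),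
  [/\ forall n, A (f_ n), forall n x, `|f_ n x| <= C
    & forall x, f_ ^~ x @ \oo --> h x].

Lemma bounded_limit_expect h : bounded_limit h ->
  \int[mu1]_x h x = \int[mu2]_x h x.
Proof.
move=> [f_ [C [Af fC fh]]].
have [_ c1] := expect_cvg mu1 (fun n => (A_bounded (Af n)).1) fC fh.
have [_ c2] := expect_cvg mu2 (fun n => (A_bounded (Af n)).1) fC fh.
have e : (fun n => \int[mu1]_x f_ n x) = (fun n => \int[mu2]_x f_ n x).
  by apply/funext => n; exact: A_expect.
rewrite e in c1; exact: (cvg_unique _ c1 c2).
Qed.

Lemma bounded_limitM h k : bounded_limit h -> bounded_limit k ->
  bounded_limit (fun x => h x * k x).
Proof.
move=> [f_ [C [Af fC fh]]] [g_ [D [Ag gD gk]]].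
exists (fun n x => f_ n x * g_ n x), (C * D); split.
- by move=> n; exact: A_mul.
- by move=> n x; rewrite normrM ler_pM.
- by move=> x; apply: cvgM; [exact: fh|exact: gk].
Qed.

Let A_scale c f : A f -> A (fun x => c * f x).
Proof.
move=> Af; have := A_lin c Af (A_lin (- 1) Af Af).
by congr A; apply/funext => x; ring.
Qed.

(** After scaling [f] into [-1, 1], the iterates of [sign_step] are polynomials in [f] converging to
    its sign [s]. The polynomial [(s + s ^ 2) / 2] sends -1, 0, 1 to 0, 0, 1, so the limit is the
    exact indicator, also where [f] vanishes. *)
Lemma bounded_limit_pos f : A f -> bounded_limit (\1_[set x | 0 < f x] : T -> R).
Proof.
move=> Af; have [_ [C fC]] := A_bounded Af.
pose c := (`|C| + 1)^-1; have c0 : 0 < c by rewrite invr_gt0 ltr_wpDl.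
have cf1 x : `|c * f x| <= 1.
  rewrite normrM gtr0_norm // mulrC ler_pdivrMr ?ltr_wpDl // mul1r.
  by rewrite (le_trans (fC x)) // (le_trans (ler_norm _)) // lerDl.
pose g n x := iter n (@sign_step R) (c * f x).
have Ag n : A (g n).
  elim: n => [|n ih]; first exact: A_scale.
  rewrite (_ : g n.+1 = fun x => (3 / 2) * g n x + (- (1 / 2)) * (g n x * (g n x * g n x))).
    by apply: A_lin => //; apply: A_scale; do 2 apply: A_mul => //.
  by apply/funext => x; rewrite /g /= /sign_step; field.
exists (fun n x => (1 / 2) * g n x + (1 / 2) * (g n x * g n x)), 1; split.
- by move=> n; apply: A_lin => //; apply: A_scale; exact: A_mul.
- move=> n x; have := norm_iter_sign_step n (cf1 x); rewrite -/(g n x).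
  move: (g n x) => y; rewrite !ler_norml => /andP[y1 y2].
  have -> : 1 / 2 * y + 1 / 2 * (y * y) = (y + y ^+ 2) / 2 by field.
  have : y ^+ 2 <= 1 by rewrite -real_normK ?num_real // expr_le1 // ler_norml y1.
  have := sqr_ge0 y.
  by move=> *; apply/andP; split; lra.
- move=> x; have := cvg_iter_sign_step (cf1 x); rewrite sgrM gtr0_sg // mul1r => h.
  rewrite [X in _ --> X](_ : _ = (1 / 2) * Num.sg (f x) + (1 / 2) * (Num.sg (f x) * Num.sg (f x))).
    apply: cvgD; first by apply: cvgM => //; exact: cvg_cst.
    by apply: cvgM; [exact: cvg_cst|exact: cvgM].
  rewrite indicE; have [fx|fx|fx] := ltgtP (f x) 0.
  + rewrite ltr0_sg // memNset; first by rewrite /=; field.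
    by rewrite /= ltNge (ltW fx).
  + by rewrite gtr0_sg // mem_set //=; field.
  + rewrite fx sgr0 memNset; first by rewrite /=; ring.
    by rewrite /= fx ltxx.
Qed.

(** Measurable sets whose indicator is a bounded limit are stable under intersection and contain the
    generators; the two measures agree on them, and the pi-lambda theorem does the rest. *)
Lemma multiplicative_class_unique (S : set T) :
  <<s [set B | exists2 f, A f & B = [set x | 0 < f x]] >> S -> mu1 S = mu2 S.
Proof.
pose G := [set B : set T | measurable B /\ bounded_limit (\1_B : T -> R)].
have GP f : A f -> G [set x | 0 < f x].
  move=> Af; split; last exact: bounded_limit_pos.
  by apply: measurable_set_lt => //; exact: (A_bounded Af).1.
move=> sS; apply: (g_sigma_algebra_measure_unique G _ (fun=> setT)).
- by move=> B [].
- move=> _; have := GP _ A_one; congr G.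
  by rewrite eqEsubset; split => // x _ /=; exact: ltr01.
- by rewrite eqEsubset; split => // x _; exists 0%N.
- move=> B C [mB lB] [mC lC]; split; first exact: measurableI.
  by rewrite indicI; exact: bounded_limitM.
- move=> B [mB lB].
  have e (mu : probability T R) : mu B = (\int[mu]_x (\1_B x : R))%:E.
    by rewrite expect_indic // fineK // fin_num_measure.
  transitivity (\int[mu1]_x (\1_B x : R))%:E; first exact: e.
  by rewrite bounded_limit_expect //; exact/esym/e.
- by move=> k; rewrite (le_lt_trans (probability_le1 _ _)) ?ltry.
- move: S sS; apply: smallest_sub; first exact: smallest_sigma_algebra.
  by move=> _ [f Af ->]; apply: sub_sigma_algebra; exact: GP.
Qed.

End MultiplicativeClass.

(** * Taylor remainders of cosine and sine *)

Section TaylorCos.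
Context (R : realType).
Implicit Types x : R.

Definition exp_term (n : nat) x := x ^+ n / n`!%:R.
Definition cos_taylor (N : nat) x := \sum_(k < N) (-1) ^+ k * exp_term k.*2 x.
Definition sin_taylor (N : nat) x := \sum_(k < N) (-1) ^+ k * exp_term k.*2.+1 x.

Lemma exp_term0 n : exp_term n.+1 0 = 0.
Proof. by rewrite /exp_term exprS mul0r mul0r. Qed.

Lemma is_derive_exp_term n x : is_derive x 1 (exp_term n.+1) (exp_term n x).
Proof.
have -> : exp_term n.+1 = (n.+1`!%:R^-1 : R) \*: (id ^+ n.+1 : R -> R).
  by apply/funext => y /=; rewrite /exp_term mulrC ?fctE.
apply: is_derive_eq; rewrite /exp_term /GRing.scale /= mulr1 factS natrM; field.
by rewrite nat1r !pnatr_eq0 -!lt0n fact_gt0.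
Qed.

Lemma is_derive_signed_exp_term (c : R) n x :
  is_derive x 1 (fun y => c * exp_term n.+1 y) (c * exp_term n x).
Proof.
have h := is_derive_exp_term n x.
have := is_deriveZ c h; congr (is_derive _ _ _ _).
Qed.

Lemma is_derive_sin_taylor N x : is_derive x 1 (sin_taylor N) (cos_taylor N x).
Proof.
elim: N => [|N ih].
  rewrite /cos_taylor big_ord0 (_ : sin_taylor 0 = cst 0); first exact: is_derive_cst.
  by apply/funext => y; rewrite /sin_taylor big_ord0.
rewrite /cos_taylor big_ord_recr /= -/(cos_taylor N x).
rewrite (_ : sin_taylor N.+1 = sin_taylor N + (fun y => (-1) ^+ N * exp_term N.*2.+1 y)).
  by apply: is_deriveD; exact: is_derive_signed_exp_term.
by apply/funext => y; rewrite /sin_taylor big_ord_recr.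
Qed.

(** The index drops by one because differentiation kills the constant term. *)
Lemma is_derive_cos_taylor N x : is_derive x 1 (cos_taylor N.+1) (- sin_taylor N x).
Proof.
elim: N => [|N ih].
  rewrite /sin_taylor big_ord0 oppr0 (_ : cos_taylor 1 = cst 1); first exact: is_derive_cst.
  by apply/funext => y; rewrite /cos_taylor big_ord1 /exp_term /= !expr0 !mul1r invr1.
rewrite /sin_taylor big_ord_recr /= -/(sin_taylor N x) opprD -mulNr -(mulN1r ((-1) ^+ N)) -exprS.
rewrite (_ : cos_taylor N.+2 = cos_taylor N.+1 + (fun y => (-1) ^+ N.+1 * exp_term N.+1.*2 y)).
  by apply: is_deriveD; exact: is_derive_signed_exp_term.
by apply/funext => y; rewrite /cos_taylor big_ord_recr.
Qed.

(** A derivative bound integrates: [exp_term n.+1] is the antiderivative of [exp_term n] vanishing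
    at 0, and the mean value theorem is applied to the difference, once for [f] and once for
    [- f]. *)
Lemma ler_exp_term_derive (f df : R -> R) n :
  (forall x, is_derive x 1 f (df x)) -> f 0 = 0 ->
  (forall x, 0 <= x -> `|df x| <= exp_term n x) ->
  forall x, 0 <= x -> `|f x| <= exp_term n.+1 x.
Proof.
move=> fdf f0 dfn.
have key (g dg : R -> R) : (forall x, is_derive x 1 g (dg x)) -> g 0 = 0 ->
  (forall x, 0 <= x -> dg x <= exp_term n x) ->
  forall x, 0 <= x -> g x <= exp_term n.+1 x.
  move=> gdg g0 dgn x; rewrite le_eqVlt => /predU1P[<-|x0].
    by rewrite g0 exp_term0.
  pose h (y : R) : R := g y - exp_term n.+1 y.
  have hd (y : R) : is_derive y 1 h (dg y - exp_term n y).
    by apply: is_deriveB; exact: is_derive_exp_term.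
  have [|c cx] := @MVT _ h (fun y => dg y - exp_term n y) 0 x x0 (fun y _ => hd y).
    apply: derivable_within_continuous => y _.
    by have [] := hd y.
  rewrite /h g0 exp_term0 !subr0 => e.
  rewrite -subr_le0 e mulr_le0_ge0 ?subr_le0 ?dgn //; last exact: ltW.
  by move: cx; rewrite in_itv /= => /andP[/ltW].
move=> x x0; rewrite ler_norml lerNl; apply/andP; split.
  apply: (key (- f) (fun y => - df y)) => //.
  - suff : - f 0 = 0 by []. by rewrite f0 oppr0.
  - by move=> y y0; have := dfn y y0; rewrite ler_norml lerNl => /andP[].
apply: (key f df) => // y y0; exact: le_trans (ler_norm _) (dfn y y0).
Qed.

(** The induction climbs alternately by [ler_exp_term_derive]: the cosine bound at [N] gives the
    sine bound at [N], which gives the cosine bound at [N.+1]. *)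
Lemma cos_sin_taylor_nonneg N x : 0 <= x ->
  `|cos x - cos_taylor N x| <= exp_term N.*2 x /\
  `|sin x - sin_taylor N x| <= exp_term N.*2.+1 x.
Proof.
elim: N x => [|N ih] x x0.
  have c0 y : 0 <= y -> `|cos y - cos_taylor 0 y| <= exp_term 0 y.
    by move=> _; rewrite /cos_taylor big_ord0 subr0 /exp_term expr0 invr1 mulr1 cos_max.
  split; first exact: c0.
  apply: (ler_exp_term_derive (f := @sin R - sin_taylor 0)
    (df := fun y => cos y - cos_taylor 0 y)) => //.
  - by move=> y; apply: is_deriveB; exact: is_derive_sin_taylor.
  - by rewrite ?fctE sin0 /sin_taylor big_ord0 subr0.
have cS y : 0 <= y -> `|cos y - cos_taylor N.+1 y| <= exp_term N.+1.*2 y.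
  apply: (ler_exp_term_derive (f := @cos R - cos_taylor N.+1)
    (df := fun y => - sin y - - sin_taylor N y)).
  - by move=> z; apply: is_deriveB; exact: is_derive_cos_taylor.
  - rewrite ?fctE cos0 /cos_taylor big_ord_recl big1 ?addr0.
      by rewrite /exp_term /= !expr0 invr1 !mulr1 subrr.
    by move=> i _; rewrite lift0 doubleS exp_term0 mulr0.
  - by move=> z z0; rewrite -opprD normrN (ih z z0).2.
split; first exact: cS.
apply: (ler_exp_term_derive (f := @sin R - sin_taylor N.+1)
  (df := fun y => cos y - cos_taylor N.+1 y)) => //.
- by move=> y; apply: is_deriveB; exact: is_derive_sin_taylor.
- rewrite ?fctE sin0 /sin_taylor big1 ?subr0 // => i _.
  by rewrite exp_term0 mulr0.
Qed.

Lemma cos_taylor_bound N x : `|cos x - cos_taylor N x| <= exp_term N.*2 x.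
Proof.
have e : forall n y, exp_term n.*2 `|y| = exp_term n.*2 y.
  by move=> n y; rewrite /exp_term -!mul2n !exprM real_normK // num_real.
have [x0|/ltW x0] := leP 0 x; first by have [] := cos_sin_taylor_nonneg N x0.
have nx0 : 0 <= - x by rewrite oppr_ge0.
have [+ _] := cos_sin_taylor_nonneg N nx0.
rewrite cosN; congr (`|_ - _| <= _); last by rewrite -e normrN e.
by apply: eq_bigr => i _; rewrite -e normrN e.
Qed.

(** A crude constant suffices for [n sin(x / n)] to converge to [x]. *)
Lemma sin_linear_bound x : `|sin x - x| <= `|x| ^+ 3.
Proof.
have pos (y : R) : 0 <= y -> `|sin y - y| <= y ^+ 3.
  move=> y0; have [_] := cos_sin_taylor_nonneg 1 y0.
  rewrite /sin_taylor big_ord1 /exp_term /= mul1r expr1 divr1 => h.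
  by rewrite (le_trans h) // ler_pdivrMr ?ltr0n ?fact_gt0 // ler_peMr ?exprn_ge0 // ler1n fact_gt0.
have [x0|x0] := leP 0 x; first by rewrite (ger0_norm x0) pos.
have -> : sin x - x = - (sin (- x) - - x) by rewrite sinN; ring.
by rewrite normrN (ltr0_norm x0) pos // oppr_ge0 ltW.
Qed.

End TaylorCos.

(** * Characteristic functions determine the law *)

Section CharacteristicFunction.
Context (R : realType) (m : nat).
Implicit Types a b y : 'cV[R]_m.

Lemma dotvDl a b y : dotv (a + b) y = dotv a y + dotv b y.
Proof. by rewrite /dotv linearD /= mulmxDl mxE. Qed.

Lemma dotvZl (c : R) a y : dotv (c *: a) y = c * dotv a y.
Proof. by rewrite /dotv linearZ /= -scalemxAl mxE. Qed.

Lemma dotvNl a y : dotv (- a) y = - dotv a y.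
Proof. by rewrite -scaleN1r dotvZl mulN1r. Qed.

Lemma dotvC a b : dotv a b = dotv b a.
Proof. by rewrite !dotvE; apply: eq_bigr => i _; rewrite mulrC. Qed.

Lemma dotvZr (c : R) a y : dotv a (c *: y) = c * dotv a y.
Proof. by rewrite dotvC dotvZl dotvC. Qed.

Lemma dotv_delta (i : 'I_m) y : dotv (delta_mx i 0) y = y i 0.
Proof.
rewrite dotvE (bigD1 i) //= mxE !eqxx mul1r big1 ?addr0 // => j ji.
by rewrite mxE (negbTE ji) mul0r.
Qed.

(** Only linear combinations are generated, so equality of expectations passes from the generators
    by linearity; closure under products comes from the product-to-sum formulas. *)
Inductive trigpoly : (Rm R m -> R) -> Prop :=
| trigpoly_cos a : trigpoly (fun y => cos (dotv a y))
| trigpoly_sin a : trigpoly (fun y => sin (dotv a y))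
| trigpoly_lin c f g : trigpoly f -> trigpoly g -> trigpoly (fun y => c * f y + g y).

Lemma trigpoly0 : trigpoly (fun=> 0).
Proof.
have := trigpoly_lin (- 1) (trigpoly_cos 0) (trigpoly_cos 0).
by congr trigpoly; apply/funext => y; ring.
Qed.

Lemma trigpolyZ c f : trigpoly f -> trigpoly (fun y => c * f y).
Proof.
by move=> tf; have := trigpoly_lin c tf trigpoly0; congr trigpoly; apply/funext => y; ring.
Qed.

Lemma trigpolyM f g : trigpoly f -> trigpoly g -> trigpoly (fun y => f y * g y).
Proof.
have half (u v w : Rm R m -> R) : trigpoly v -> trigpoly w ->
    (forall y, u y = (1 / 2) * v y + (1 / 2) * w y) -> trigpoly u.
  move=> tv tw e; have := trigpoly_lin (1 / 2) tv (trigpolyZ (1 / 2) tw).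
  by congr trigpoly; apply/funext => y; rewrite e.
move=> tf tg; elim: tf => {f} [a|a|c f1 f2 _ ih1 _ ih2]; last first.
- have := trigpoly_lin c ih1 ih2.
  by congr trigpoly; apply/funext => y; ring.
- elim: tg => {g} [b|b|c g1 g2 _ ih1 _ ih2]; last first.
  + have := trigpoly_lin c ih1 ih2.
    by congr trigpoly; apply/funext => y; ring.
  + apply: (half _ _ _ (trigpoly_cos (a - b)) (trigpolyZ (-1) (trigpoly_cos (a + b)))) => y.
    by rewrite !dotvDl dotvNl cosB cosD; field.
  + apply: (half _ _ _ (trigpoly_sin (a + b)) (trigpoly_sin (a - b))) => y.
    by rewrite !dotvDl dotvNl sinB sinD; field.
- elim: tg => {g} [b|b|c g1 g2 _ ih1 _ ih2]; last first.
  + have := trigpoly_lin c ih1 ih2.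
    by congr trigpoly; apply/funext => y; ring.
  + apply: (half _ _ _ (trigpoly_sin (a + b)) (trigpolyZ (-1) (trigpoly_sin (a - b)))) => y.
    by rewrite !dotvDl dotvNl sinB sinD; field.
  + apply: (half _ _ _ (trigpoly_cos (a + b)) (trigpoly_cos (a - b))) => y.
    by rewrite !dotvDl dotvNl cosB cosD; field.
Qed.

Lemma measurable_dotvr a : measurable_fun setT (fun y : Rm R m => dotv a y).
Proof. by apply: (@measurable_dotv _ _ _ _ (fun=> a : Rm R m) id) => //. Qed.

Lemma bounded_mfun_cos d (T : measurableType d) (f : T -> R) :
  measurable_fun setT f -> bounded_mfun (fun t => cos (f t)).
Proof.
move=> mf; split; last by exists 1 => x; exact: cos_max.
apply: (@measurableT_comp _ _ _ _ _ _ _ _ f) => //.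
by apply: continuous_measurable_fun => x; exact: continuous_cos.
Qed.

Lemma bounded_mfun_sin d (T : measurableType d) (f : T -> R) :
  measurable_fun setT f -> bounded_mfun (fun t => sin (f t)).
Proof.
move=> mf; split; last by exists 1 => x; exact: sin_max.
apply: (@measurableT_comp _ _ _ _ _ _ _ _ f) => //.
by apply: continuous_measurable_fun => x; exact: continuous_sin.
Qed.

Lemma trigpoly_bounded f : trigpoly f -> bounded_mfun f.
Proof.
elim=> {f} [a|a|c f g _ bf _ bg].
- by apply: bounded_mfun_cos; exact: measurable_dotvr.
- by apply: bounded_mfun_sin; exact: measurable_dotvr.
- by apply: bounded_mfunD => //; exact: bounded_mfunZ.
Qed.

Lemma cvg_scaled_sin (x : R) : (fun n => n.+1%:R * sin (x / n.+1%:R)) @ \oo --> x.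
Proof.
apply/cvgrPdist_le => e e0.
have : (fun n => (`|x| ^+ 3) * (n.+1%:R^-1 : R)) @ \oo --> (`|x| ^+ 3) * 0.
  by apply: cvgM; [exact: cvg_cst|exact: cvg_harmonic].
rewrite mulr0 => /cvgrPdist_le/(_ _ e0); apply: filterS => n.
rewrite sub0r normrN ger0_norm ?mulr_ge0 ?invr_ge0 ?exprn_ge0 // => h.
apply: le_trans h; have n0 : 0 < n.+1%:R :> R by [].
have -> : x - n.+1%:R * sin (x / n.+1%:R) = - (n.+1%:R * (sin (x / n.+1%:R) - x / n.+1%:R)).
  by field; rewrite nat1r.
rewrite normrN normrM gtr0_norm //.
apply: (@le_trans _ _ (n.+1%:R * `|x / n.+1%:R| ^+ 3)).
  by rewrite ler_pM2l // sin_linear_bound.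
rewrite normrM normfV (gtr0_norm n0) expr_div_n.
have -> : n.+1%:R * (`|x| ^+ 3 / n.+1%:R ^+ 3) = `|x| ^+ 3 / n.+1%:R / n.+1%:R.
  by field; rewrite nat1r.
by rewrite ler_pdivrMr // ler_peMr ?divr_ge0 ?exprn_ge0 // ler1n.
Qed.

(** What remains after the multiplicative class argument is that trigonometric polynomials generate
    the Borel sets. Coordinates are unbounded and not in the class, but they are limits of
    [n sin(y_i / n)]. *)
Lemma characteristic_function_unique (mu1 mu2 : probability (Rm R m) R) :
  (forall a, \int[mu1]_y cos (dotv a y) = \int[mu2]_y cos (dotv a y)) ->
  (forall a, \int[mu1]_y sin (dotv a y) = \int[mu2]_y sin (dotv a y)) ->
  forall S, measurable S -> mu1 S = mu2 S.
Proof.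
move=> ecos esin S mS.
have tp1 : trigpoly (fun=> 1).
  have := trigpoly_cos 0; congr trigpoly; apply/funext => y.
  by rewrite -(scale0r 0) dotvZl mul0r cos0.
apply: (multiplicative_class_unique (A := trigpoly)) => //.
- exact: trigpoly_bounded.
- by move=> *; exact: trigpoly_lin.
- by move=> *; exact: trigpolyM.
- move=> f; elim=> {f} [a|a|c f g tf ef tg eg]; [exact: ecos|exact: esin|].
  have bf := trigpoly_bounded tf; have bg := trigpoly_bounded tg.
  by rewrite !expectD ?expectZ ?ef ?eg //; exact: bounded_mfunZ.
set G := (X in <<s X >>).
(* Measurability of the identity from the generated sigma-algebra to the Borel one is precisely the
   inclusion of sigma-algebras. *)
suff mid : measurable_fun setT (id : g_sigma_algebraType G -> Rm R m).
  by have := mid measurableT S mS; rewrite setTI.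
apply: measurable_fun_Rm => i.
pose h n (y : g_sigma_algebraType G) : R := n.+1%:R * sin ((y : 'cV[R]_m) i 0 / n.+1%:R).
apply: (@measurable_fun_cvg _ _ _ setT h); last by move=> y _; exact: cvg_scaled_sin.
move=> n; apply: (measurability _ (RGenOInfty.measurableE R)).
move=> _ [_ [a ->] <-]; rewrite setTI; apply: sub_sigma_algebra.
exists (fun y => n.+1%:R * sin (dotv (n.+1%:R^-1 *: delta_mx i 0) y) + (- a) * 1).
  by apply: trigpoly_lin; [exact: trigpoly_sin|exact: trigpolyZ].
rewrite preimage_itvoy; apply/funext => y; apply/propext => /=.
by rewrite dotvZl dotv_delta mulr1 subr_gt0 /h mulrC [X in sin X]mulrC mulrC.
Qed.

End CharacteristicFunction.

(** * The chi distribution *)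

Section RadialDensity.
Context (R : realType).
Implicit Types r x : R.
Local Notation leb := (@lebesgue_measure R).

Definition radial_density (n : nat) r := r ^+ n * expR (- (r ^+ 2) / 2).

Lemma radial_density_ge0 n r : 0 <= r -> 0 <= radial_density n r.
Proof. by move=> r0; rewrite mulr_ge0 ?exprn_ge0 ?expR_ge0. Qed.

Lemma measurable_radial_density n : measurable_fun setT (radial_density n).
Proof.
apply: measurable_funM; first exact: measurable_funX.
apply: measurableT_comp => //; apply: measurable_funM => //.
by apply: measurableT_comp => //; exact: measurable_funX.
Qed.

Lemma is_derive_radial_density n x :
  is_derive x 1 (fun y => - radial_density n.+1 y)
    (radial_density n.+2 x - n.+1%:R * radial_density n x).
Proof.
have e1 : is_derive x 1 (fun y : R => - (y ^+ 2) / 2) (- x).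
  have -> : (fun y : R => - (y ^+ 2) / 2) = (- (1 / 2)) \*: (id ^+ 2 : R -> R).
    by apply/funext => y; rewrite /= !fctE /GRing.scale /=; field.
  have h1 : is_derive x 1 ((id : R -> R) ^+ 2) (2 * x).
    by apply: is_derive_eq; rewrite /GRing.scale /= mulr1 expr1.
  by apply: (is_derive_eq (is_deriveZ (- (1 / 2)) h1)); rewrite /GRing.scale /=; field.
have e2 : is_derive x 1 (fun y : R => expR (- (y ^+ 2) / 2)) (- x * expR (- (x ^+ 2) / 2)).
  have h := @is_derive1_comp _ expR (fun y : R => - (y ^+ 2) / 2) x _ _
    (is_derive_expR (- (x ^+ 2) / 2)) e1.
  by apply: (is_derive_eq h); rewrite /GRing.scale /= mulrC.
have e3 : is_derive x 1 (fun y : R => y ^+ n.+1) (n.+1%:R * x ^+ n).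
  have -> : (fun y : R => y ^+ n.+1) = (id : R -> R) ^+ n.+1 by apply/funext => y; rewrite !fctE.
  by apply: is_derive_eq; rewrite /GRing.scale /= mulr1.
have e4 := is_deriveN (is_deriveM e3 e2).
apply: (is_derive_eq e4).
by rewrite /radial_density /GRing.scale /= !exprS; ring.
Qed.

Lemma continuous_radial_density n : continuous (radial_density n).
Proof.
move=> x; apply: cvgM; first exact: exprn_continuous.
apply: (cvg_comp _ expR); last exact: continuous_expR.
by apply: cvgM; [apply: cvgN; exact: exprn_continuous|exact: cvg_cst].
Qed.

(** Half of the Gaussian exponent is spent on the power, which leaves [exp(- r ^ 2 / 4)] for
    integrability. For [1 <= r] the constant comes from the term of degree [n.+1] of the exponential
    series at [r ^ 2 / 4]; the summand 1 covers [r <= 1]. *)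
Lemma exprn_le_expR n r : 0 <= r ->
  r ^+ n <= (1 + 4 ^+ n.+1 * n.+1`!%:R) * expR (r ^+ 2 / 4).
Proof.
move=> r0; have e1 : 1 <= expR (r ^+ 2 / 4) by rewrite -expR0 ler_expR divr_ge0 // sqr_ge0.
have [r1|/ltW r1] := leP r 1.
  apply: (@le_trans _ _ 1); first by rewrite exprn_ile1.
  by rewrite (le_trans e1) // ler_peMl ?expR_ge0 // lerDl mulr_ge0 // exprn_ge0.
apply: (@le_trans _ _ (r ^+ (2 * n.+1))); first by rewrite ler_weXn2l // mulnS mul2n -addnn addnA leq_addl.
rewrite mulrDl mul1r; apply: (@le_trans _ _ (4 ^+ n.+1 * n.+1`!%:R * expR (r ^+ 2 / 4))); last first.
  by rewrite lerDr expR_ge0.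
have /(expR_ge1Dxn n) : 0 <= r ^+ 2 / 4 by rewrite divr_ge0 // sqr_ge0.
have f0 : 0 < n.+1`!%:R :> R by rewrite ltr0n fact_gt0.
have p0 : 0 < 4 ^+ n.+1 :> R by rewrite exprn_gt0.
rewrite expr_div_n exprM => h; have : (r ^+ 2) ^+ n.+1 / 4 ^+ n.+1 / n.+1`!%:R <= expR (r ^+ 2 / 4).
  by apply: le_trans h; rewrite lerDr.
by rewrite ler_pdivrMr // ler_pdivrMr // => h'; rewrite (le_trans h') // le_eqVlt; apply/orP; left; apply/eqP; ring.
Qed.

Lemma radial_density_le n r : 0 <= r ->
  radial_density n r <= (1 + 4 ^+ n.+1 * n.+1`!%:R) * expR (- (r ^+ 2) / 4).
Proof.
move=> r0; rewrite /radial_density (_ : - r ^+ 2 / 2 = - r ^+ 2 / 4 + - r ^+ 2 / 4); last by field.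
rewrite expRD mulrA ler_pM2r ?expR_gt0 //.
by rewrite mulNr expRN -[leLHS]/(r ^+ n / expR (r ^+ 2 / 4)) ler_pdivrMr ?expR_gt0 // exprn_le_expR.
Qed.

Lemma radial_density_bounded n : exists C : R, 0 < C /\
  forall r, 0 <= r -> radial_density n r <= C.
Proof.
exists (1 + 4 ^+ n.+1 * n.+1`!%:R); split.
  by rewrite ltr_pwDl // mulr_ge0 // exprn_ge0.
move=> r r0; rewrite (le_trans (radial_density_le n r0)) // ler_piMr //.
by rewrite -expR0 ler_expR mulNr oppr_le0 divr_ge0 // sqr_ge0.
Qed.

Lemma radial_density_integrable n : leb.-integrable `[0, +oo[ (EFin \o radial_density n).
Proof.
pose C : R := 1 + 4 ^+ n.+1 * n.+1`!%:R.
have C0 : 0 <= C by rewrite addr_ge0 // mulr_ge0 // exprn_ge0.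
(* The normal density of variance 2 has exponent [- r ^ 2 / 4], the one left by
   [radial_density_le]. *)
pose s := Num.sqrt 2 : R; have s0 : 0 < s by rewrite sqrtr_gt0.
apply: (@le_integrable _ _ _ leb `[0, +oo[%classic _ (EFin \o radial_density n)
  (fun x => ((C / normal_peak s) * normal_pdf 0 s x)%:E)) => //.
- by apply/measurable_EFinP; apply: measurable_funTS; exact: measurable_radial_density.
- move=> r; rewrite /= in_itv /= andbT => r0; rewrite lee_fin.
  have p0 := normal_peak_gt0 (lt0r_neq0 s0).
  rewrite ger0_norm ?radial_density_ge0 // normal_pdfE ?lt0r_neq0 //.
  rewrite mulrA divfK ?gt_eqF // ger0_norm; last by rewrite mulr_ge0 // expR_ge0.
  rewrite (le_trans (radial_density_le n r0)) // ler_wpM2l //.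
  by rewrite /normal_fun subr0 sqr_sqrtr // (_ : 2 *+ 2 = 4 :> R) //; ring.
- have h := integrable_normal_pdf (0 : R) s.
  have := integrableZl measurableT (C / normal_peak s) h.
  move=> h'; apply: (integrableS measurableT) => //; apply: eq_integrable h' => //.
Qed.

Definition radial_moment n := \int[leb]_(r in `[0, +oo[) radial_density n r.

Lemma radial_moment_trunc n :
  (fun N => \int[leb]_(r in `[0, N%:R]) radial_density n r) @ \oo --> radial_moment n.
Proof.
(* For odd [n] the density is negative on the left half-line, whereas monotone convergence wants a
   function nonnegative everywhere; on the domain of integration the absolute value changes
   nothing. *)
pose f (r : R) : R := `|radial_density n r|.
have f0 r : 0 <= f r by exact: normr_ge0.
have mf : measurable_fun setT f by apply: measurableT_comp => //; exact: measurable_radial_density.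
have e (A : set R) : A `<=` `[0, +oo[%classic ->
    (\int[leb]_(r in A) (f r)%:E = \int[leb]_(r in A) (radial_density n r)%:E)%E.
  move=> A0; apply: eq_integral => r /[!inE] /A0; rewrite /= in_itv /= andbT => r0.
  by rewrite /f ger0_norm // radial_density_ge0.
have := ge0_cvgn_integral f0 mf => /(_ leb); rewrite e //.
have -> : (\int[leb]_(r in `[0%R, +oo[) (radial_density n r)%:E = (radial_moment n)%:E)%E.
  by rewrite /radial_moment /Rintegral fineK //; exact/integrable_fin_num/radial_density_integrable.
move=> /fine_cvg; apply: cvg_trans; apply: near_eq_cvg; apply: nearW => N /=.
by rewrite e // => r; rewrite /= !in_itv /= => /andP[-> _].
Qed.

(** Integration by parts on [[0, N + 1]]. The boundary term [radial_density n.+1] is at most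
    [C / (N + 1)], because one more power of [r] still leaves a bounded function. *)
Lemma radial_moment_rec n : radial_moment n.+2 = n.+1%:R * radial_moment n.
Proof.
have int k (b : R) : leb.-integrable `[0, b] (EFin \o radial_density k).
  apply: continuous_compact_integrable; first exact: segment_compact.
  by apply: continuous_subspaceT => x; exact: continuous_radial_density.
have cvg0 : (fun N => radial_density n.+1 N.+1%:R) @ \oo --> (0 : R).
  have [C [C0 HC]] := radial_density_bounded n.+2.
  apply/cvgrPdist_le => e e0.
  have : (fun N => C * (N.+1%:R^-1 : R)) @ \oo --> C * 0.
    by apply: cvgM; [exact: cvg_cst|exact: cvg_harmonic].
  rewrite mulr0 => /cvgrPdist_le/(_ _ e0); apply: filterS => N.
  rewrite !sub0r !normrN !ger0_norm ?radial_density_ge0 //; last by rewrite mulr_ge0 // ltW.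
  apply: le_trans; rewrite ler_pdivlMr // mulrC.
  apply: le_trans (HC N.+1%:R _) => //; rewrite le_eqVlt; apply/orP; left; apply/eqP.
  by rewrite /radial_density [in RHS]exprS mulrA.
have rec N : \int[leb]_(r in `[0, N.+1%:R]) radial_density n.+2 r =
    n.+1%:R * \int[leb]_(r in `[0, N.+1%:R]) radial_density n r - radial_density n.+1 N.+1%:R.
  have d (x : R) := is_derive_radial_density n x.
  have N0 : 0 < N.+1%:R :> R by [].
  have cF : continuous (fun y => - radial_density n.+1 y).
    by move=> x; apply: cvgN; exact: continuous_radial_density.
  have := @continuous_FTC2 R (fun x => radial_density n.+2 x - n.+1%:R * radial_density n x)
    (fun y => - radial_density n.+1 y) _ _ N0.
  have -> : radial_density n.+1 0 = 0 by rewrite /radial_density exprS !mul0r.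
  rewrite oppr0 sube0 => ftc.
  suff e : \int[leb]_(r in `[0, N.+1%:R]) radial_density n.+2 r -
      n.+1%:R * \int[leb]_(r in `[0, N.+1%:R]) radial_density n r = - radial_density n.+1 N.+1%:R.
    by rewrite -e addrC subrK.
  have intn : leb.-integrable `[0, N.+1%:R] (EFin \o (fun r => n.+1%:R * radial_density n r)).
    apply: continuous_compact_integrable; first exact: segment_compact.
    apply: continuous_subspaceT => x; apply: cvgM; first exact: cvg_cst.
    exact: continuous_radial_density.
  rewrite -RintegralZl //.
  rewrite -RintegralB //.
  rewrite /Rintegral ftc //.
  - by apply: continuous_subspaceT => x; apply: cvgB; [|apply: cvgM; [exact: cvg_cst|]];
      exact: continuous_radial_density.
  - split; first by move=> x _; have [] := d x.
    + by apply: cvg_at_right_filter; exact: cF.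
    + by apply: cvg_at_left_filter; exact: cF.
  - by move=> x _; rewrite derive1E; have [_] := d x.
have t k : (fun N => \int[leb]_(r in `[0, N.+1%:R]) radial_density k r) @ \oo --> radial_moment k.
  by have := @radial_moment_trunc k; rewrite -cvg_shiftS.
have h : (fun N => n.+1%:R * \int[leb]_(r in `[0, N.+1%:R]) radial_density n r
    - radial_density n.+1 N.+1%:R) @ \oo --> n.+1%:R * radial_moment n - 0.
  by apply: cvgB; [apply: cvgM; [exact: cvg_cst|exact: t]|exact: cvg0].
rewrite subr0 in h; have := t n.+2.
have -> : (fun N => \int[leb]_(r in `[0, N.+1%:R]) radial_density n.+2 r) =
    (fun N => n.+1%:R * \int[leb]_(r in `[0, N.+1%:R]) radial_density n r
    - radial_density n.+1 N.+1%:R) by apply/funext => N; exact: rec.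
by move=> t2; exact: (cvg_unique _ t2 h).
Qed.
End RadialDensity.

Section ChiMeasure.
Context (R : realType) (m : nat).
Implicit Types r x : R.
Local Notation leb := (@lebesgue_measure R).

Lemma chi_densityE : @chi_density R m = radial_density m.-1.
Proof. by []. Qed.

Definition chi_mass : R := radial_moment R m.-1.

Lemma radial_moment_gt0 n : 0 < radial_moment R n.
Proof.
(* A lower bound of the integrand on [1, 2], an interval of length one. *)
pose c := expR (- 2) : R; have c0 : 0 < c by exact: expR_gt0.
apply: (@lt_le_trans _ _ c) => //.
have intd := radial_density_integrable R n.
have -> : c = \int[leb]_(r in `[(1 : R), 2]) c.
  have e : lebesgue_measure (`[(1 : R), 2]%classic : set R) = 1%E.
    by rewrite lebesgue_measure_itv /= lte_fin ltr1n -EFinB (_ : 2 - 1 = 1 :> R) //; ring.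
  by rewrite Rintegral_cst // (_ : fine _ = 1) ?mulr1 //; exact: (congr1 fine e).
have sub12 : `[1, 2] `<=` (`[0, +oo[%classic : set R).
  by move=> r; rewrite /= !in_itv /= andbT => /andP[r1 _]; rewrite (le_trans _ r1).
have int12 : leb.-integrable `[1, 2] (EFin \o radial_density n).
  by apply: integrableS intd => //.
apply: (@le_trans _ _ (\int[leb]_(r in `[1, 2]) radial_density n r)).
  apply: le_Rintegral => //.
    apply: continuous_compact_integrable; first exact: segment_compact.
    by apply: continuous_subspaceT => x; exact: cvg_cst.
  move=> r; rewrite /= in_itv /= => /andP[r1 r2].
  rewrite -[c]mul1r /radial_density ler_pM // ?expR_ge0 //.
    by rewrite exprn_ege1.
  rewrite ler_expR mulNr lerN2 ler_pdivrMr // -natrM.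
  by rewrite (_ : (2 * 2)%:R = 2 ^+ 2 :> R) ?lerXn2r ?nnegrE ?(le_trans _ r1) //; rewrite -natrX.
rewrite /radial_moment /Rintegral fine_le //.
- exact: integrable_fin_num.
- exact: integrable_fin_num.
- apply: ge0_subset_integral => //.
    by apply/measurable_EFinP/measurable_funTS; exact: measurable_radial_density.
  by move=> r; rewrite /= in_itv /= andbT => r0; rewrite lee_fin radial_density_ge0.
Qed.

Lemma chi_mass_gt0 : 0 < chi_mass. Proof. exact: radial_moment_gt0. Qed.

Definition chi_pdf r := if 0 <= r then chi_density m r / chi_mass else 0.

Lemma chi_pdf_ge0 r : 0 <= chi_pdf r.
Proof.
rewrite /chi_pdf; case: ifPn => // r0.
by rewrite divr_ge0 // ?(ltW chi_mass_gt0) // chi_densityE radial_density_ge0.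
Qed.

Lemma measurable_chi_pdf : measurable_fun setT chi_pdf.
Proof.
rewrite /chi_pdf; apply: measurable_fun_ifT => //=.
  exact: measurable_fun_ler.
apply: measurable_funM => //; rewrite chi_densityE; exact: measurable_radial_density.
Qed.

Lemma integral_chi_pdfE (A : set R) (f : R -> R) : measurable A ->
  (\int[leb]_(r in A) (f r * chi_pdf r)%:E =
   \int[leb]_(r in A `&` `[0%R, +oo[) (f r * (chi_density m r / chi_mass))%:E)%E.
Proof.
move=> mA; rewrite [RHS]integral_mkcondr /=; apply: eq_integral => r rA.
rewrite patchE; case: ifPn => [|].
  by rewrite inE /= in_itv /= andbT /chi_pdf => ->.
by rewrite notin_setE /= in_itv /= andbT /chi_pdf => /negP/negbTE ->; rewrite mulr0.
Qed.

Lemma integrable_chi_pdf : leb.-integrable setT (EFin \o chi_pdf).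
Proof.
apply/integrableP; split; first by apply/measurable_EFinP; exact: measurable_chi_pdf.
under eq_integral do rewrite /= ger0_norm ?chi_pdf_ge0 // -[chi_pdf _]mul1r.
rewrite (integral_chi_pdfE (cst 1)) // setTI /=.
under eq_integral do rewrite mul1r EFinM.
have intd := radial_density_integrable R m.-1.
rewrite integralZr //.
by rewrite ltey_eq fin_numM //; exact: integrable_fin_num.
Qed.

Lemma integral_chi_pdf : (\int[leb]_r (chi_pdf r)%:E = 1)%E.
Proof.
under eq_integral do rewrite -[chi_pdf _]mul1r.
rewrite (integral_chi_pdfE (cst 1)) // setTI /=.
under eq_integral do rewrite mul1r EFinM.
have intd := radial_density_integrable R m.-1.
rewrite integralZr //.
have -> : (\int[leb]_(r in `[0%R, +oo[) (chi_density m r)%:E = chi_mass%:E)%E.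
  by rewrite /chi_mass /radial_moment /Rintegral fineK //; exact: integrable_fin_num.
by rewrite -EFinM divff // gt_eqF // chi_mass_gt0.
Qed.

(** The quotient of integrals [chi_prob] recast as a probability measure, so that it can enter
    products and Fubini's theorem. *)
Definition chi_measure : set _ -> \bar R :=
  fun A => (\int[leb]_(r in A) (chi_pdf r)%:E)%E.

Let chi0 : chi_measure set0 = 0%E.
Proof. by rewrite /chi_measure integral_set0. Qed.

Let chi_ge0 A : (0 <= chi_measure A)%E.
Proof. by apply: integral_ge0 => r _; rewrite lee_fin chi_pdf_ge0. Qed.

Let chi_sigma_additive : semi_sigma_additive chi_measure.
Proof.
move=> /= A mA tA mUA.
rewrite /chi_measure /= integral_bigcup//=; last first.
  by apply: (integrableS _ _ (subsetT _)) => //; exact: integrable_chi_pdf.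
apply: is_cvg_ereal_nneg_natsum_cond => n _ _.
by apply: integral_ge0 => /= x ?; rewrite lee_fin chi_pdf_ge0.
Qed.

HB.instance Definition _ := isMeasure.Build _ _ _
  chi_measure chi0 chi_ge0 chi_sigma_additive.

Let chi_setT : chi_measure [set: R] = 1%E.
Proof. exact: integral_chi_pdf. Qed.

HB.instance Definition _ :=
  @Measure_isProbability.Build _ _ R chi_measure chi_setT.

Lemma chi_measure_dominates : chi_measure `<< leb.
Proof.
apply/null_content_dominatesP => A mA A0; rewrite /chi_measure.
apply: null_set_integral => //=; apply: measurable_funTS.
by apply/measurable_EFinP; exact: measurable_chi_pdf.
Qed.

(** The Radon-Nikodym derivative agrees almost everywhere with [chi_pdf], since both have the same
    integral over every measurable set. *)
Lemma integral_chi_measure (f : R -> \bar R) : chi_measure.-integrable setT f ->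
  (\int[chi_measure]_r f r = \int[leb]_r (f r * (chi_pdf r)%:E))%E.
Proof.
move=> fint; rewrite -(Radon_Nikodym_change_of_variables chi_measure_dominates) //.
apply: ae_eq_integral => //.
- apply: emeasurable_funM; first exact: measurable_int fint.
  apply: (measurable_int leb); apply: Radon_Nikodym_integrable.
  exact: chi_measure_dominates.
- apply: emeasurable_funM; first exact: measurable_int fint.
  by apply/measurable_EFinP; exact: measurable_chi_pdf.
- apply: ae_eqe_mul2l => /=.
  rewrite Radon_NikodymE//=; first exact: chi_measure_dominates.
  move=> dom; case: cid => /= h [h1 h2 h3].
  apply: integral_ae_eq => //=.
  + by apply/measurable_EFinP; exact: measurable_chi_pdf.
  + by move=> E _ mE; rewrite -h3.
Qed.

Lemma chi_probE (A : set R) : measurable A -> chi_prob m A = fine (chi_measure A).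
Proof.
move=> mA; rewrite /chi_measure.
under eq_integral do rewrite -[chi_pdf _]mul1r.
rewrite (integral_chi_pdfE (cst 1)) //=.
under eq_integral do rewrite mul1r EFinM.
have intd := radial_density_integrable R m.-1.
have intA : leb.-integrable (A `&` `[0, +oo[) (EFin \o chi_density m).
  by apply: (integrableS _ _ _ intd) => //; exact: measurableI.
rewrite integralZr //; last exact: measurableI.
by rewrite fineM //; apply: integrable_fin_num => //; exact: measurableI.
Qed.

Lemma expect_chi_measure (f : R -> R) : bounded_mfun f ->
  \int[chi_measure]_r f r =
  (\int[leb]_(r in `[0, +oo[) (f r * radial_density m.-1 r)) / chi_mass.
Proof.
move=> bf; rewrite {1}/Rintegral integral_chi_measure; last exact: bounded_mfun_integrable.
under eq_integral do rewrite -EFinM.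
rewrite integral_chi_pdfE // setTI.
under eq_integral do rewrite mulrA EFinM.
have [mf [C fC]] := bf.
have intd := radial_density_integrable R m.-1.
have intf : leb.-integrable `[0, +oo[ (EFin \o (fun r => f r * radial_density m.-1 r)).
  apply: (real_integrable_boundedM _ C) => //; exact: measurable_funTS.
by rewrite integralZr //= fineM //; exact: integrable_fin_num.
Qed.

End ChiMeasure.

(** * Moments of the uniform distribution on the sphere *)

Section PolynomialsAndReflections.
Context (R : realType).

Lemma poly_eq_nat (p q : {poly R}) :
  (forall n : nat, p.[n%:R] = q.[n%:R]) -> p = q.
Proof.
move=> pq; apply/eqP; rewrite -subr_eq0; apply/eqP.
apply: (@roots_geq_poly_eq0 _ _ [seq n%:R | n <- iota 0 (size (p - q)%R)]).
- apply/allP => _ /mapP[n _ ->]; rewrite rootE hornerD hornerN pq subrr //.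
- by rewrite map_inj_uniq ?iota_uniq // => i j /eqP; rewrite eqr_nat => /eqP.
- by rewrite size_map size_iota.
Qed.

Lemma dotvDr (m : nat) (a b y : 'cV[R]_m) : dotv y (a + b) = dotv y a + dotv y b.
Proof. by rewrite dotvC dotvDl !(dotvC y). Qed.

Lemma dotvNr (m : nat) (a y : 'cV[R]_m) : dotv y (- a) = - dotv y a.
Proof. by rewrite dotvC dotvNl dotvC. Qed.

(** The reflection in the hyperplane orthogonal to [a - b] exchanges two vectors of equal length. It
    turns invariance under orthogonal matrices into dependence on the length alone. *)
Lemma householder (m : nat) (a b : 'cV[R]_m) : dotv a a = dotv b b ->
  exists2 Q : 'M[R]_m, Q^T *m Q = 1%:M & Q *m a = b.
Proof.
move=> ab; have [->|aNb] := eqVneq a b.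
  by exists 1%:M; rewrite ?trmx1 ?mul1mx.
pose u := a - b; pose s := dotv u u.
have s0 : s != 0.
  apply: contra aNb => /eqP s0; rewrite -subr_eq0; apply/eqP/matrixP => i j.
  rewrite (ord1 j) [RHS]mxE; apply/eqP; rewrite -sqrf_eq0 -/u; move: s0.
  rewrite /s dotvE => /eqP; rewrite psumr_eq0; last by move=> k _; rewrite -expr2 sqr_ge0.
  by move=> /allP/(_ i); rewrite mem_index_enum => /(_ isT) /=; rewrite expr2.
have uTu : u^T *m u = s%:M by rewrite [LHS]mx11_scalar.
pose Q := 1%:M - (2 / s) *: (u *m u^T).
have QT : Q^T = Q by rewrite /Q linearB /= trmx1 linearZ /= trmx_mul trmxK.
exists Q.
  have AA : (u *m u^T) *m (u *m u^T) = s *: (u *m u^T).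
    by rewrite mulmxA -(mulmxA u) uTu mul_mx_scalar -scalemxAl.
  rewrite QT /Q mulmxBl mul1mx mulmxBr mulmx1 -scalemxAl -scalemxAr AA !scalerA.
  rewrite (_ : 2 / s * (2 / s) * s = 2 / s + 2 / s); last by field.
  by rewrite scalerDl opprB addrK subrK.
rewrite /Q mulmxBl mul1mx -scalemxAl -mulmxA.
have -> : u^T *m a = (dotv u a)%:M by rewrite [LHS]mx11_scalar.
rewrite mul_mx_scalar scalerA.
(* Equal lengths give [<a - b, a - b> = 2 <a - b, a>]. *)
have -> : 2 / s * dotv u a = 1.
  have e : s = 2 * dotv u a.
    by rewrite /s /u !(dotvDl, dotvDr, dotvNl, dotvNr) -ab (dotvC b a); ring.
  have d0 : dotv u a != 0 by apply: contra s0 => /eqP d0; rewrite e d0 mulr0.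
  by rewrite e; field; rewrite d0.
by rewrite scale1r /u opprB addrCA subrr addr0.
Qed.

End PolynomialsAndReflections.

Section SphereMoments.
Context (R : realType) (m : nat) (mu : probability (Rm R m) R).
Hypothesis mu_uniform : uniform_sphere mu.

Lemma measurable_sphere : measurable (@sphere R m).
Proof.
have md : measurable_fun setT (fun v : Rm R m => dotv v v).
  exact: (@measurable_dotv _ _ _ _ id id).
by have := md measurableT [set (1 : R)] (measurable_set1 _); rewrite setTI.
Qed.

(** As a factor it makes polynomials in [v] bounded on the whole space without changing their
    expectation, [mu] being carried by the sphere. *)
Definition on_sphere (v : Rm R m) : R := \1_(@sphere R m) v.

Lemma bounded_on_sphere (f : Rm R m -> R) C : measurable_fun setT f ->
  (forall v, sphere v -> `|f v| <= C) -> bounded_mfun (fun v => on_sphere v * f v).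
Proof.
move=> mf fC; split.
  by apply: measurable_funM => //; apply: measurable_indic; exact: measurable_sphere.
exists (Num.max C 0) => v; rewrite /on_sphere indicE.
have [vS|vS] := boolP (v \in _); last by rewrite mul0r normr0 le_max lexx orbT.
by rewrite mul1r le_max fC //; rewrite inE in vS.
Qed.

Lemma expect_on_sphere (f : Rm R m -> R) : measurable_fun setT f ->
  \int[mu]_v (on_sphere v * f v) = \int[mu]_v f v.
Proof.
move=> mf; congr fine; apply: ae_eq_integral => //.
- apply/measurable_EFinP/measurable_funM => //.
  by apply: measurable_indic; exact: measurable_sphere.
- exact/measurable_EFinP.
exists (~` @sphere R m); split.
- by apply: measurableC; exact: measurable_sphere.
- transitivity (1 - mu (@sphere R m))%E; first exact: (probability_setC mu measurable_sphere).
  by have [-> _] := mu_uniform; rewrite subee.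
- move=> v /= nv vS; apply: nv => _.
  by rewrite /on_sphere indicE mem_set // mul1r.
Qed.

Lemma expect_orthogonal (Q : 'M[R]_m) (f : Rm R m -> R) : Q^T *m Q = 1%:M ->
  bounded_mfun f -> \int[mu]_v f (Q *m v) = \int[mu]_v f v.
Proof.
move=> QQ bf; have mQ : measurable_fun setT (fun v : Rm R m => Q *m v : Rm R m).
  exact: (@measurable_mulmx _ _ _ _ _ id).
have bfQ : bounded_mfun (fun v : Rm R m => f (Q *m v)).
  have [mf [C fC]] := bf; split; last by exists C.
  exact: (measurableT_comp mf mQ).
congr fine; have := @integral_pushforward _ _ _ _ _ _ mQ mu setT (EFin \o f).
rewrite preimage_setT => <- //; last 2 first.
- by apply/measurable_EFinP; exact: bf.1.
- exact: (bounded_mfun_integrable mu bfQ).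
apply: eq_measure_integral => A mA _.
by rewrite /pushforward /=; exact: (mu_uniform.2 Q QQ A mA).
Qed.

Lemma sphere_coord (v : 'cV[R]_m) i : sphere v -> `|v i 0| <= 1.
Proof.
rewrite /sphere /= dotvE => v1; rewrite -ler_sqr ?nnegrE // expr1n real_normK ?num_real //.
rewrite -v1 (bigD1 i) //= -expr2 lerDl; apply: sumr_ge0 => j _.
by rewrite -expr2 sqr_ge0.
Qed.

Lemma sphere_orthogonal (Q : 'M[R]_m) v : Q^T *m Q = 1%:M ->
  on_sphere (Q *m v) = on_sphere v.
Proof.
move=> QQ; rewrite /on_sphere !indicE; congr ((nat_of_bool _)%:R).
have e : dotv (Q *m v) (Q *m v) = dotv v v.
  by rewrite /dotv trmx_mul mulmxA -(mulmxA v^T) QQ mulmx1.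
by apply/idP/idP; rewrite !inE /sphere /= e.
Qed.

Lemma dotv_bound (b v : 'cV[R]_m) : sphere v -> `|dotv b v| <= \sum_i `|b i 0|.
Proof.
move=> vS; rewrite dotvE (le_trans (ler_norm_sum _ _ _)) //; apply: ler_sum => i _.
by rewrite normrM ler_piMr // sphere_coord.
Qed.

Lemma bounded_dotvX b n : bounded_mfun (fun v : Rm R m => on_sphere v * dotv b v ^+ n).
Proof.
apply: (@bounded_on_sphere _ ((\sum_i `|b i 0|) ^+ n)).
  by apply: measurable_funX; exact: measurable_dotvr.
by move=> v vS; rewrite normrX lerXn2r ?nnegrE ?sumr_ge0 // dotv_bound.
Qed.

Definition sphere_moment (b : 'cV[R]_m) n := \int[mu]_v (on_sphere v * dotv b v ^+ n).

Lemma sphere_moment_rotation a b n : dotv a a = dotv b b ->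
  sphere_moment a n = sphere_moment b n.
Proof.
move=> ab; have [Q QQ Qa] := householder ab.
rewrite /sphere_moment -(expect_orthogonal QQ (bounded_dotvX b n)).
apply: eq_Rintegral => v _; rewrite sphere_orthogonal //; congr (_ * _ ^+ _).
by rewrite -Qa /dotv trmx_mul -mulmxA (mulmxA Q^T) QQ mul1mx.
Qed.

End SphereMoments.

(** * Fubini's theorem for bounded functions *)

Section ExpectProduct.
Context d1 (T1 : measurableType d1) d2 (T2 : measurableType d2) (R : realType).
Context (P1 : probability T1 R) (P2 : probability T2 R).
Variable f : T1 * T2 -> R.
Hypothesis bf : bounded_mfun f.

Let intf : (P1 \x P2)%E.-integrable setT (EFin \o f).
Proof. exact: bounded_mfun_integrable bf. Qed.

Let bf1 x : bounded_mfun (fun y => f (x, y)).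
Proof.
have [mf [C fC]] := bf; split; last by exists C.
exact: (measurableT_comp mf (measurable_pair1 x)).
Qed.

Let bf2 y : bounded_mfun (fun x => f (x, y)).
Proof.
have [mf [C fC]] := bf; split; last by exists C.
exact: (measurableT_comp mf (measurable_pair2 y)).
Qed.

Lemma bounded_mfun_expect2 : bounded_mfun (fun y => \int[P1]_x f (x, y)).
Proof.
have [mf [C fC]] := bf; split; last first.
  by exists C => y; apply: le_norm_expect => //; exact: bf2.
apply/measurable_EFinP; have := measurable_fubini_G intf.
congr (measurable_fun _ _); apply/funext => y.
by rewrite /fubini_G /= EFin_expect.
Qed.

Lemma bounded_mfun_expect1 : bounded_mfun (fun x => \int[P2]_y f (x, y)).
Proof.
have [mf [C fC]] := bf; split; last first.
  by exists C => x; apply: le_norm_expect => //; exact: bf1.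
apply/measurable_EFinP; have := measurable_fubini_F intf.
congr (measurable_fun _ _); apply/funext => x.
by rewrite /fubini_F /= EFin_expect.
Qed.

Lemma expect_prod21 :
  \int[(P1 \x P2)%E]_z f z = \int[P2]_y \int[P1]_x f (x, y).
Proof.
congr fine; have <- := integral21_prod_meas1 intf.
by apply: eq_integral => y _; rewrite /fubini_G /= EFin_expect.
Qed.

Lemma expect_prod12 :
  \int[(P1 \x P2)%E]_z f z = \int[P1]_x \int[P2]_y f (x, y).
Proof.
congr fine; have <- := integral12_prod_meas1 intf.
by apply: eq_integral => x _; rewrite /fubini_F /= EFin_expect.
Qed.

End ExpectProduct.

(** * Recursion for the even moments on the sphere *)

Section SphereRecurrence.
Context (R : realType) (m : nat) (mu : probability (Rm R m) R).
Hypothesis mu_uniform : uniform_sphere mu.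
Variable i0 : 'I_m.

Let e0 : 'cV[R]_m := delta_mx i0 0.
Definition even_moment k := sphere_moment mu e0 k.*2.
Local Notation c := even_moment.

Lemma dotv_deltaE (i j : 'I_m) :
  dotv (delta_mx i 0 : 'cV[R]_m) (delta_mx j 0) = (i == j)%:R.
Proof. by rewrite dotv_delta mxE eqxx andbT. Qed.

Lemma sphere_momentZ (s : R) (b : 'cV[R]_m) n :
  sphere_moment mu (s *: b) n = s ^+ n * sphere_moment mu b n.
Proof.
rewrite -(expectZ _ _ (bounded_dotvX b n)).
by apply: eq_Rintegral => v _; rewrite dotvZl exprMn mulrCA.
Qed.

Lemma dotvv_ge0 (b : 'cV[R]_m) : 0 <= dotv b b.
Proof. by rewrite dotvE; apply: sumr_ge0 => i _; rewrite -expr2 sqr_ge0. Qed.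

(** Rotate [b] to a multiple of [e0] of the same length and use homogeneity; the even degree removes
    the square root. *)
Lemma sphere_moment_even (b : 'cV[R]_m) k :
  sphere_moment mu b k.*2 = dotv b b ^+ k * c k.
Proof.
have s0 := dotvv_ge0 b.
rewrite (@sphere_moment_rotation _ _ _ mu_uniform b (Num.sqrt (dotv b b) *: e0)).
  by rewrite sphere_momentZ -{1}mul2n exprM sqr_sqrtr.
by rewrite dotvZl dotvZr dotv_deltaE eqxx mulr1 -expr2 sqr_sqrtr.
Qed.

Let mixed j n i (v : Rm R m) : R := on_sphere v * (v i0 0 ^+ (n - i) * v j 0 ^+ i).

Let bounded_mixed j n i : bounded_mfun (mixed j n i).
Proof.
apply: (@bounded_on_sphere _ _ _ 1) => [|v vS].
  by apply: measurable_funM; apply: measurable_funX; exact: measurable_coord.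
rewrite normrM !normrX mulr_ile1 ?exprn_ge0 ?exprn_ile1 //; exact: sphere_coord.
Qed.

Lemma even_momentE k : c k = \int[mu]_v (on_sphere v * v i0 0 ^+ k.*2).
Proof. by apply: eq_Rintegral => v _; rewrite dotv_delta. Qed.

(* Compare the coefficients of [t ^ 2] in [E <v, e0 + t ej> ^ (2k + 2) = c (k + 1) * (1 + t ^ 2) ^ (k + 1)], which holds for all [t] by rotation invariance. *)
Lemma mixed_moment j k : j != i0 ->
  k.*2.+1%:R * \int[mu]_v mixed j k.*2.+2 2 v = c k.+1.
Proof.
move=> ji; pose n := k.*2.+2.
pose p : {poly R} := \poly_(i < n.+1) ('C(n, i)%:R * \int[mu]_v mixed j n i v).
pose q : {poly R} := c k.+1 *: (1 + 'X ^+ 2) ^+ k.+1.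
have pq : p = q.
  apply: poly_eq_nat => t; set x : R := t%:R.
  rewrite horner_poly /q hornerZ horner_exp hornerD hornerXn -polyC1 hornerC.
  have := sphere_moment_even (e0 + x *: delta_mx j 0) k.+1.
  rewrite doubleS -/n dotvDl !dotvDr !dotvZl !dotvZr !dotv_deltaE !eqxx (negbTE ji) eq_sym (negbTE ji).
  rewrite !mulr0 addr0 add0r mulr1 -expr2 mulrC => <-.
  rewrite /sphere_moment.
  transitivity (\int[mu]_v (\sum_(i < n.+1) ('C(n, i)%:R * x ^+ i) * mixed j n i v)).
    rewrite expect_sum; last by move=> i; exact: bounded_mfunZ.
    by apply: eq_bigr => i _; rewrite expectZ // mulrAC.
  apply: eq_Rintegral => v _; rewrite dotvDl dotvZl !dotv_delta exprDn mulr_sumr.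
  apply: eq_bigr => i _; rewrite /mixed exprMn -mulr_natl; ring.
have : p`_2 = q`_2 by rewrite pq.
rewrite coef_poly /= /q coefZ exprDn coef_sum.
rewrite (bigD1 (inord 1)) //= big1; last first.
  move=> i i1; rewrite coefMn expr1n mul1r -exprM coefXn.
  case: eqP => [e|_]; last by rewrite mul0rn.
  case/eqP: i1; apply/val_inj; rewrite /= inordK //.
  by case: (val i) e => [|[|]] //= ?; rewrite mulnS.
rewrite inordK // addr0 coefMn expr1n mul1r expr1 coefXn eqxx bin1.
have -> : 'C(n, 2) = (k.+1 * k.*2.+1)%N.
  by rewrite bin2 /n -[k.*2.+2]/(k.+1.*2) -doubleMl doubleK.
rewrite natrM -mulrA [RHS]mulrC => /mulfI; apply.
by rewrite pnatr_eq0.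
Qed.

(** Insert [1 = \sum_j v_j ^ 2] under the expectation of [v_i0 ^ (2k)]. The term [j = i0] is
    [c (k + 1)] and each of the [m - 1] others is [c (k + 1) / (2k + 1)]; the total weight is
    [(m + 2k) / (2k + 1)]. *)
Lemma even_moment_rec k : k.*2.+1%:R * c k = (m + k.*2)%:R * c k.+1.
Proof.
have e : c k = \sum_(j < m) \int[mu]_v mixed j k.*2.+2 2 v.
  rewrite even_momentE -expect_sum //; apply: eq_Rintegral => v _.
  rewrite /mixed -mulr_sumr /on_sphere indicE.
  have [|_] := boolP (v \in _); last by rewrite !mul0r.
  rewrite inE /sphere /= dotvE !mul1r -mulr_sumr subSS subSS subn0 => v1.
  by under eq_bigr do rewrite expr2; rewrite v1 mulr1.
rewrite e mulr_sumr (bigD1 i0) //=.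
have -> : \int[mu]_v mixed i0 k.*2.+2 2 v = c k.+1.
  rewrite even_momentE; apply: eq_Rintegral => v _.
  by rewrite /mixed -exprD subSS subSS subn0 addn2 doubleS.
rewrite (eq_bigr (fun=> c k.+1)); last by move=> j ji; exact: mixed_moment.
rewrite sumr_const cardC1 card_ord -[c k.+1 *+ _]mulr_natl -mulrDl; congr (_ * _).
rewrite -natrD; congr (_%:R).
by case: (m) i0 => [[]//|m' _]; rewrite /= addnC addSnnS.
Qed.

Lemma even_moment0 : c 0 = 1.
Proof.
rewrite even_momentE (@eq_Rintegral _ _ _ mu setT (fun v => on_sphere v)); last first.
  by move=> v _; rewrite expr0 mulr1.
rewrite expect_indic; last exact: measurable_sphere.
by have [-> _] := mu_uniform.
Qed.

End SphereRecurrence.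

(** * Polar decomposition of the Gaussian law *)

Section PolarCharacteristic.
Context (R : realType) (m : nat) (mu : probability (Rm R m) R).
Hypothesis mu_uniform : uniform_sphere mu.
Variable i0 : 'I_m.
Local Notation leb := (@lebesgue_measure R).
Local Notation c := (even_moment mu i0).

Let RM k := radial_moment R (m.-1 + k.*2).

(** The factor [m + 2k] divides in the spherical recursion and multiplies in the radial one. It
    cancels in [c k * RM k], which is left with the dimension-free recursion of the Gaussian
    moments, factor [2k + 1]. *)
Lemma gaussian_moment k :
  c k * RM k / (k.*2)`!%:R = 2^-1 ^+ k / k`!%:R * chi_mass R m.
Proof.
elim: k => [|k ih].
  by rewrite /RM addn0 even_moment0 // /chi_mass !expr0 !mul1r invr1 mulr1 mul1r.
(* The index [i0] excludes [m = 0], so [m.-1.+1] is [m]. *)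
have rec : RM k.+1 = (m + k.*2)%:R * RM k.
  rewrite /RM doubleS !addnS radial_moment_rec; congr (_%:R * _).
  by case: (m) i0 => [[]|].
have e := even_moment_rec mu_uniform i0 k.
rewrite rec mulrCA !mulrA -e doubleS !factS !natrM exprS.
have f1 : (k.*2)`!%:R != 0 :> R by rewrite pnatr_eq0 -lt0n fact_gt0.
have f2 : k`!%:R != 0 :> R by rewrite pnatr_eq0 -lt0n fact_gt0.
have f3 : k.*2.+1%:R != 0 :> R by [].
have f4 : k.+1%:R != 0 :> R by [].
have -> : k.*2.+2%:R = 2 * k.+1%:R :> R by rewrite -natrM mul2n doubleS.
transitivity (c k * RM k / (k.*2)`!%:R / (2 * k.+1%:R)).
  by field; rewrite f1 ?nat1r f4 f3.
by rewrite ih; field; rewrite f2 nat1r f4.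
Qed.

Section FixedVector.
Variable b : 'cV[R]_m.
Let s := dotv b b.

Let h (r : R) : R := \int[mu]_v cos (r * dotv b v).

Lemma bounded_polar_cos :
  bounded_mfun (fun z : Rm R m * R => cos (z.2 * dotv b z.1)).
Proof.
apply: bounded_mfun_cos; apply: measurable_funM => //.
exact: (measurableT_comp (@measurable_dotvr _ _ b)).
Qed.

Let bounded_h : bounded_mfun h.
Proof. exact: (bounded_mfun_expect2 mu (chi_measure m) bounded_polar_cos). Qed.

(** [T N] is the spherical mean of the cosine Taylor polynomial at [r <b, v>], and [K N * r ^ (2N)]
    the mean of its remainder bound. *)
Let T N (r : R) : R := \sum_(k < N) (-1) ^+ k * s ^+ k * c k / (k.*2)`!%:R * r ^+ k.*2.
Let K N := s ^+ N * c N / (N.*2)`!%:R.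

Let term_expect N r : \int[mu]_v (on_sphere v * exp_term N.*2 (r * dotv b v)) = K N * r ^+ N.*2.
Proof.
rewrite (@eq_Rintegral _ _ _ mu setT
  (fun v => (r ^+ N.*2 / (N.*2)`!%:R) * (on_sphere v * dotv b v ^+ N.*2))); last first.
  by move=> v _; rewrite /exp_term exprMn; ring.
rewrite expectZ; last exact: bounded_dotvX.
have := sphere_moment_even mu_uniform i0 b N; rewrite /sphere_moment => ->.
by rewrite -/s /K; ring.
Qed.

Let bounded_term N r : bounded_mfun (fun v : Rm R m => on_sphere v * exp_term N.*2 (r * dotv b v)).
Proof.
rewrite (_ : (fun v => _) =
  (fun v : Rm R m => (r ^+ N.*2 / (N.*2)`!%:R) * (on_sphere v * dotv b v ^+ N.*2))).
  exact/bounded_mfunZ/bounded_dotvX.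
by apply/funext => v; rewrite /exp_term exprMn; ring.
Qed.

Let h_approx N r : `|h r - T N r| <= K N * r ^+ N.*2.
Proof.
have mcos : measurable_fun setT (fun v : Rm R m => cos (r * dotv b v)).
  apply: (bounded_mfun_cos _).1; apply: measurable_funM => //.
  exact: measurable_dotvr.
have bcos : bounded_mfun (fun v : Rm R m => on_sphere v * cos (r * dotv b v)).
  by apply: (bounded_on_sphere (C := 1)) => // v _; exact: cos_max.
have bT : bounded_mfun (fun v : Rm R m => on_sphere v * cos_taylor N (r * dotv b v)).
  rewrite (_ : (fun v => _) = (fun v : Rm R m =>
    \sum_(k < N) (-1) ^+ k * (on_sphere v * exp_term k.*2 (r * dotv b v)))).
    elim: N => [|N ih].
      by under eq_fun do rewrite big_ord0; exact: bounded_mfun_cst.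
    under eq_fun do rewrite big_ord_recr /=.
    by apply: bounded_mfunD => //; exact: bounded_mfunZ.
  apply/funext => v; rewrite /cos_taylor mulr_sumr.
  by apply: eq_bigr => k _; rewrite mulrCA.
have -> : T N r = \int[mu]_v (on_sphere v * cos_taylor N (r * dotv b v)).
  rewrite (@eq_Rintegral _ _ _ mu setT (fun v : Rm R m =>
    \sum_(k < N) (-1) ^+ k * (on_sphere v * exp_term k.*2 (r * dotv b v)))); last first.
    move=> v _; rewrite /cos_taylor mulr_sumr.
    by apply: eq_bigr => k _; rewrite mulrCA.
  rewrite expect_sum; last by move=> k; exact: bounded_mfunZ.
  apply: eq_bigr => k _; rewrite expectZ // term_expect /K; ring.
rewrite /h -(expect_on_sphere mu_uniform) // -expectB //.
rewrite -term_expect ler_norml -[X in X <= _ <= _]mulN1r -expectZ //.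
have key v : `|on_sphere v * cos (r * dotv b v) - on_sphere v * cos_taylor N (r * dotv b v)|
    <= on_sphere v * exp_term N.*2 (r * dotv b v).
  rewrite -mulrBr normrM ger0_norm; last by rewrite /on_sphere indicE.
  by rewrite ler_wpM2l ?cos_taylor_bound // /on_sphere indicE.
apply/andP; split; apply: le_expect => //; try exact: bounded_mfunB; try exact: bounded_mfunZ.
  by move=> v; have := key v; rewrite ler_norml mulN1r => /andP[].
by move=> v; have := key v; rewrite ler_norml => /andP[].
Qed.

Let pos_int (f : R -> R) := leb.-integrable `[0, +oo[ (EFin \o f).

Let pow_density k (r : R) : r ^+ k.*2 * radial_density m.-1 r = radial_density (m.-1 + k.*2) r.
Proof. by rewrite /radial_density mulrA -exprD addnC. Qed.

Let int_pow k (a : R) : pos_int (fun r => a * r ^+ k.*2 * radial_density m.-1 r) /\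
  \int[leb]_(r in `[0, +oo[) (a * r ^+ k.*2 * radial_density m.-1 r) = a * RM k.
Proof.
have e : (fun r : R => a * r ^+ k.*2 * radial_density m.-1 r) =
    (fun r : R => a * radial_density (m.-1 + k.*2) r).
  by apply/funext => r; rewrite -mulrA pow_density.
have i := radial_density_integrable R (m.-1 + k.*2).
rewrite e RintegralZl //; split => //.
exact: real_integrableZ.
Qed.

Let int_T N : pos_int (fun r => T N r * radial_density m.-1 r) /\
  \int[leb]_(r in `[0, +oo[) (T N r * radial_density m.-1 r) =
  \sum_(k < N) (-1) ^+ k * s ^+ k * c k / (k.*2)`!%:R * RM k.
Proof.
elim: N => [|N [ih1 ih2]].
  rewrite big_ord0 (_ : (fun r => _) = fun=> 0); last first.
    by apply/funext => r; rewrite /T big_ord0 mul0r.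
  split; first exact: integrable0.
  by rewrite /Rintegral integral0.
have [p1 p2] := int_pow N ((-1) ^+ N * s ^+ N * c N / (N.*2)`!%:R).
rewrite big_ord_recr /= -ih2 -p2 -RintegralD //.
rewrite (_ : (fun r => T N.+1 r * _) = (fun r => T N r * radial_density m.-1 r +
   (-1) ^+ N * s ^+ N * c N / (N.*2)`!%:R * r ^+ N.*2 * radial_density m.-1 r)).
  by split => //; exact: real_integrableD.
by apply/funext => r; rewrite /T big_ord_recr /= mulrDl.
Qed.

Let int_h : pos_int (fun r => h r * radial_density m.-1 r).
Proof.
have [mh [C hC]] := bounded_h.
apply: (real_integrable_boundedM _ C) => //; last exact: radial_density_integrable.
exact: measurable_funTS.
Qed.

Let approx N : `|\int[leb]_(r in `[0, +oo[) (h r * radial_density m.-1 r) -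
    \sum_(k < N) (-1) ^+ k * s ^+ k * c k / (k.*2)`!%:R * RM k| <= K N * RM N.
Proof.
have [i1 e1] := int_T N; have [i2 e2] := int_pow N (K N).
have i3 := int_h.
have i4 : pos_int (fun r => h r * radial_density m.-1 r - T N r * radial_density m.-1 r).
  exact: real_integrableB.
rewrite -e1 -e2 -RintegralB // (le_trans (le_normr_Rintegral _ _)) //.
apply: le_Rintegral => //; first exact: real_integrable_norm.
move=> r; rewrite /= in_itv /= andbT => r0.
by rewrite -mulrBl normrM (ger0_norm (radial_density_ge0 _ r0)) ler_wpM2r ?radial_density_ge0.
Qed.

(** Integrated against the chi density, [T N] becomes the [N]-th partial sum of [exp(- s / 2)] and
    the error bound becomes the [N]-th term of the series of [exp(s / 2)], which tends to 0. Working
    with partial sums avoids exchanging a series with an integral. *)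
Lemma polar_characteristic :
  \int[chi_measure m]_r \int[mu]_v cos (r * dotv b v) = expR (- s / 2).
Proof.
rewrite expect_chi_measure -/h; last exact: bounded_h.
set I := Rintegral _ _ _; have Z0 := chi_mass_gt0 R m.
have key N : `|I / chi_mass R m - series (exp_coeff (- s / 2)) N| <= exp_coeff (s / 2) N.
  have e1 : \sum_(k < N) (-1) ^+ k * s ^+ k * c k / (k.*2)`!%:R * RM k =
      chi_mass R m * series (exp_coeff (- s / 2)) N.
    rewrite /series /= big_mkord mulr_sumr; apply: eq_bigr => k _.
    rewrite /exp_coeff /= (_ : - s / 2 = (-1) * s * 2^-1); last by field.
    rewrite !exprMn; transitivity ((-1) ^+ k * s ^+ k * (c k * RM k / (k.*2)`!%:R)); first by ring.
    by rewrite gaussian_moment; ring.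
  have e2 : K N * RM N = chi_mass R m * exp_coeff (s / 2) N.
    rewrite /exp_coeff /= exprMn /K; transitivity (s ^+ N * (c N * RM N / (N.*2)`!%:R)); first by ring.
    by rewrite gaussian_moment; ring.
  have -> : I / chi_mass R m - series (exp_coeff (- s / 2)) N =
      (I - chi_mass R m * series (exp_coeff (- s / 2)) N) / chi_mass R m.
    by field; rewrite gt_eqF.
  rewrite normrM normfV (gtr0_norm Z0) ler_pdivrMr // [leRHS]mulrC -e1 -e2; exact: approx.
apply/esym; apply: cvg_lim; first exact: Rhausdorff.
apply/cvgrPdist_le => e e0.
have /cvgrPdist_le/(_ _ e0) := cvg_exp_coeff (s / 2).
apply: filterS => N; rewrite sub0r normrN => hN.
by rewrite (le_trans (key N)) // (le_trans (ler_norm _)).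
Qed.

End FixedVector.
End PolarCharacteristic.

Section ExpectDistribution.
Context d (T : measurableType d) d' (T' : measurableType d') (R : realType).
Context (P : probability T R) (X : {mfun T >-> T'}).

Lemma expect_distribution (f : T' -> R) : bounded_mfun f ->
  \int[distribution P X]_y f y = \int[P]_x f (X x).
Proof.
move=> bf; congr fine.
have := @integral_pushforward _ _ _ _ _ _ (measurable_funPT X) P setT (EFin \o f).
rewrite preimage_setT => -> //.
- by apply/measurable_EFinP; exact: bf.1.
- apply: (bounded_mfun_integrable P (f := f \o X)).
  have [mf [C fC]] := bf; split; last by exists C => x /=.
  exact: measurableT_comp.
Qed.

End ExpectDistribution.

Section SphericalRadial.
Context (R : realType) (m : nat) (d : measure_display) (Omega : measurableType d).
Context (P : probability Omega R) (Sigma L : 'M[R]_m) (xi : Omega -> Rm R m).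
Context (mu : probability (Rm R m) R).
Hypothesis xi_gaussian : gaussian P xi Sigma.
Hypothesis LL : L *m L^T = Sigma.
Hypothesis mu_uniform : uniform_sphere mu.

(** In dimension 0 the sphere is empty and cannot have mass one. *)
Lemma sphere_index : 'I_m.
Proof.
case: m mu mu_uniform => [|m' _ _]; last exact: ord0.
move=> mu0 [mu1 _]; exfalso; move: mu1.
rewrite (_ : @sphere R 0 = set0) ?measure0.
  by move=> /eqP; rewrite eqe eq_sym oner_eq0.
rewrite eqEsubset; split => // v; rewrite /sphere /= dotvE big_ord0 => /eqP.
by rewrite eq_sym oner_eq0.
Qed.

Let xi_mfun : {mfun Omega >-> Rm R m} :=
  MeasurableFun.Pack (MeasurableFun.Class (isMeasurableFun.Build _ _ _ _ _ xi_gaussian.1)).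

Definition polar_map (z : Rm R m * measurableTypeR R) : Rm R m := z.2 *: (L *m z.1).

Lemma measurable_polar_map : measurable_fun setT polar_map.
Proof.
apply: (@measurable_scale _ _ _ _ snd (fun z : Rm R m * R => L *m z.1 : Rm R m)).
  exact: measurable_snd.
by apply: (@measurable_mulmx _ _ _ _ L fst); exact: measurable_fst.
Qed.

Let polar_mfun : {mfun (Rm R m * measurableTypeR R)%type >-> Rm R m} :=
  MeasurableFun.Pack (MeasurableFun.Class (isMeasurableFun.Build _ _ _ _ _ measurable_polar_map)).

Let prodP : probability (Rm R m * measurableTypeR R)%type R := (mu \x chi_measure m)%E.

Let dotv_polar a z : dotv a (polar_map z) = z.2 * dotv (L^T *m a) z.1.
Proof. by rewrite /polar_map dotvZr /dotv trmx_mul trmxK mulmxA. Qed.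

(** The antipodal map preserves [mu] and changes the sign of the integrand. *)
Lemma expect_sin_sphere b (r : R) : \int[mu]_v sin (r * dotv b v) = 0.
Proof.
have bs : bounded_mfun (fun v : Rm R m => sin (r * dotv b v)).
  by apply: bounded_mfun_sin; apply: measurable_funM => //; exact: measurable_dotvr.
have QQ : ((-1)%:M : 'M[R]_m)^T *m (-1)%:M = 1%:M.
  by rewrite tr_scalar_mx -scalar_mxM mulrNN mulr1.
have := expect_orthogonal mu_uniform QQ bs.
rewrite (@eq_Rintegral _ _ _ mu setT (fun v : Rm R m => -1 * sin (r * dotv b v))); last first.
  by move=> v _; rewrite mul_scalar_mx scaleN1r dotvNr mulrN sinN mulN1r.
rewrite expectZ // => e; lra.
Qed.

(** Since [<a, r L v> = r <L^T a, v>], the polar characteristic function is taken at [b = L^T a],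
    and [<b, b> = <a, Sigma a>] by the factorisation of [Sigma]. *)
Lemma gaussian_polar_law (A : set (Rm R m)) : measurable A ->
  P (xi @^-1` A) = (mu \x chi_measure m)%E (polar_map @^-1` A).
Proof.
pose mu1 : probability (Rm R m) R := distribution P xi_mfun.
pose mu2 : probability (Rm R m) R := distribution prodP polar_mfun.
move=> mA; rewrite -[LHS]/(mu1 A) -[RHS]/(mu2 A).
have bcos a : bounded_mfun (fun y : Rm R m => cos (dotv a y)).
  by apply: bounded_mfun_cos; exact: measurable_dotvr.
have bsin a : bounded_mfun (fun y : Rm R m => sin (dotv a y)).
  by apply: bounded_mfun_sin; exact: measurable_dotvr.
have bpol a (h : R -> R) : (forall (dd : measure_display) (T : measurableType dd) (f : T -> R),
    measurable_fun setT f -> bounded_mfun (fun t => h (f t))) ->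
    bounded_mfun (fun z => h (dotv a (polar_map z))).
  move=> hh; apply: hh; exact: (measurableT_comp (@measurable_dotvr _ _ a) measurable_polar_map).
apply: characteristic_function_unique mA => a; rewrite !expect_distribution //=.
- have [_ /(_ a)[h _]] := xi_gaussian.
  transitivity (expR (- dotv a (Sigma *m a) / 2)); first by rewrite /Rintegral h.
  rewrite [RHS](expect_prod21 mu (chi_measure m) (bpol a _ (@bounded_mfun_cos R))).
  under eq_Rintegral do under eq_Rintegral do rewrite dotv_polar.
  rewrite (polar_characteristic mu_uniform sphere_index); congr (expR (- _ / 2)).
  by rewrite -LL /dotv trmx_mul trmxK -!mulmxA.
- have [_ /(_ a)[_ h]] := xi_gaussian.
  transitivity (0 : R); first by rewrite /Rintegral h.
  rewrite [RHS](expect_prod21 mu (chi_measure m) (bpol a _ (@bounded_mfun_sin R))).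
  under eq_Rintegral do under eq_Rintegral do rewrite dotv_polar.
  under eq_Rintegral do rewrite expect_sin_sphere.
  by rewrite expect_cst.
Qed.

Variables (U : normedModType R) (g : U -> 'cV[R]_m -> R).
Hypothesis g_lip : locally_lipschitz g.

Lemma lipschitz_continuous_snd u : continuous (g u).
Proof.
move=> z; have [r [K [r0 H]]] := g_lip u z.
have FF : Filter (nbhs (z : 'cV[R]_m)) by exact: nbhs_filter.
apply/(@cvgrPdist_lt _ _ _ (nbhs z) FF) => e e0.
have K0 : 0 < `|K| + 1 by rewrite ltr_wpDl.
apply/nbhs_ballP; exists (Num.min r (e / (`|K| + 1))); first by rewrite /= lt_min r0 divr_gt0.
move=> y; rewrite -ball_normE /= lt_min => /andP[yr ye].
apply: (@le_lt_trans _ _ (K * `|z - y|)).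
  have := H u u z y; rewrite !subrr !normr0 add0r; apply => //.
  by rewrite distrC.
apply: (@le_lt_trans _ _ ((`|K| + 1) * `|z - y|)).
  by rewrite ler_wpM2r // (le_trans (ler_norm K)) // lerDl.
by rewrite -ltr_pdivlMl // mulrC.
Qed.

Lemma measurable_sublevel u : measurable [set z : Rm R m | g u z <= 0].
Proof.
apply: (measurable_set_le (f := g u : Rm R m -> R) (g := cst 0)) => //.
by apply: continuous_measurable_Rm; exact: lipschitz_continuous_snd.
Qed.

Let prod_sublevel u := polar_map @^-1` [set z | g u z <= 0].

Let measurable_prod_sublevel u : measurable (prod_sublevel u).
Proof.
by have := measurable_polar_map measurableT (measurable_sublevel u); rewrite setTI.
Qed.

Let bounded_indic u : bounded_mfun (\1_(prod_sublevel u) : Rm R m * measurableTypeR R -> R).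
Proof. exact: bounded_mfun_indic. Qed.

Let radial_probE u v : radial_prob L g u v =
  \int[chi_measure m]_r (\1_(prod_sublevel u) (v, r) : R).
Proof.
have mline : measurable_fun setT (fun r : measurableTypeR R => polar_map (v, r)).
  exact: (@measurable_scale _ _ _ _ id (fun=> L *m v : Rm R m)).
have mS : measurable [set r : R | g u (r *: (L *m v)) <= 0].
  by have := mline measurableT _ (measurable_sublevel u); rewrite setTI.
transitivity (chi_prob m [set r : R | g u (r *: (L *m v)) <= 0]).
  rewrite /radial_prob /chi_prob; congr (fine (\int[_]_(r in _) _) / _).
  by apply/seteqP; split => r /=; rewrite in_itv /= andbT; tauto.
rewrite chi_probE // -expect_indic //.
Qed.

Lemma bounded_radial_prob u : bounded_mfun (fun v : Rm R m => radial_prob L g u v).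
Proof.
rewrite (_ : (fun v => _) =
  (fun v : Rm R m => \int[chi_measure m]_r (\1_(prod_sublevel u) (v, r) : R))).
  exact: (bounded_mfun_expect1 mu (chi_measure m) (bounded_indic u)).
by apply/funext => v; exact: radial_probE.
Qed.

Lemma prob_fun_spherical u : prob_fun P xi g u = \int[mu]_v radial_prob L g u v.
Proof.
rewrite /prob_fun (gaussian_polar_law (measurable_sublevel u)).
transitivity (\int[(mu \x chi_measure m)%E]_z (\1_(prod_sublevel u) z : R)).
  by rewrite /Rintegral integral_indic // setIT.
rewrite (expect_prod12 mu (chi_measure m) (bounded_indic u)).
by apply: eq_Rintegral => v _; rewrite radial_probE.
Qed.

End SphericalRadial.

(** * The radial distribution function *)

Section RadialCdf.
Context (R : realType) (m : nat).
Implicit Types a b r : R.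
Local Notation leb := (@lebesgue_measure R).
Local Notation dens := (@radial_density R m.-1).
Local Notation Z := (chi_mass R m).

Definition radial_cdf (r : R) : R := chi_prob m `[0, r]%classic.

Let int_dens a b : leb.-integrable `[a, b] (EFin \o dens).
Proof.
apply: continuous_compact_integrable; first exact: segment_compact.
by apply: continuous_subspaceT => x; exact: continuous_radial_density.
Qed.

Let int_dens_oc a b : leb.-integrable `]a, b] (EFin \o dens).
Proof.
apply: integrableS (int_dens a b) => //.
by move=> r; rewrite /= !in_itv /= => /andP[/ltW -> ->].
Qed.

Lemma radial_cdfB a b : 0 <= a -> a <= b ->
  radial_cdf b - radial_cdf a = (\int[leb]_(r in `]a, b]) dens r) / Z.
Proof.
move=> a0 ab.
have e c : radial_cdf c = (\int[leb]_(r in `[0, c]) dens r) / Z.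
  rewrite /radial_cdf /chi_prob /Z /radial_moment; congr (fine (\int[_]_(r in _) _) / _).
  by apply/seteqP; split => r /=; rewrite !in_itv /= andbT; [case|move=> /andP[-> ->]].
rewrite !e -mulrBl; congr (_ / _).
have := @Rintegral_itvB R dens (BLeft 0) (BRight b) a (int_dens 0 b).
by apply; rewrite bnd_simp.
Qed.

(** Common source of monotonicity, of the relative Lipschitz bound and of strict
    differentiability. *)
Lemma radial_cdf_bounds (lo hi a b : R) : 0 <= a -> a <= b ->
  (forall r, a < r <= b -> lo <= dens r <= hi) ->
  lo * (b - a) / Z <= radial_cdf b - radial_cdf a <= hi * (b - a) / Z.
Proof.
move=> a0 ab H; rewrite radial_cdfB // !ler_pM2r ?invr_gt0 ?chi_mass_gt0 //.
have c (k : R) : k * (b - a) = \int[leb]_(r in `]a, b]) k.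
  have e : lebesgue_measure (`]a, b]%classic : set R) = (b - a)%:E.
    rewrite lebesgue_measure_itv /= lte_fin.
    by move: ab; rewrite le_eqVlt => /predU1P[->|->]; rewrite ?ltxx ?subrr // -EFinB.
  by rewrite Rintegral_cst //; congr (k * _); exact: (congr1 fine (esym e)).
have int_k (k : R) : leb.-integrable `]a, b] (EFin \o cst k).
  have : leb.-integrable `[a, b] (EFin \o cst k).
    apply: continuous_compact_integrable; first exact: segment_compact.
    by apply: continuous_subspaceT => x; exact: cvg_cst.
  apply: integrableS => //.
  by move=> r; rewrite /= !in_itv /= => /andP[/ltW -> ->].
rewrite (c lo) (c hi); apply/andP; split; apply: le_Rintegral => //; try exact: int_k;
  by move=> r; rewrite /= in_itv /= => /H /andP[].
Qed.

Lemma radial_cdf_mono a b : 0 <= a -> a <= b -> radial_cdf a <= radial_cdf b.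
Proof.
move=> a0 ab; have [C [C0 HC]] := radial_density_bounded R m.-1.
have H : forall r, a < r <= b -> 0 <= dens r <= C.
  move=> r /andP[ar _]; have r0 : 0 <= r by rewrite (le_trans a0) // ltW.
  by rewrite radial_density_ge0 // HC.
by have /andP[] := radial_cdf_bounds a0 ab H; rewrite !mul0r subr_ge0.
Qed.

(** As [r] times the density is bounded, the density is at most [C / a] beyond [a]. The increment of
    the distribution function is thus controlled by the relative increment [(b - a) / a], the
    quantity that is uniform over directions. *)
Lemma radial_cdf_lipschitz : exists C : R, 0 <= C /\ forall a b, 0 < a -> a <= b ->
  radial_cdf b - radial_cdf a <= C * ((b - a) / a).
Proof.
have [C [C0 HC]] := radial_density_bounded R m.-1.+1.
exists (C / Z); split; first by rewrite divr_ge0 // ltW // chi_mass_gt0.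
move=> a b a0 ab; have H : forall r, a < r <= b -> 0 <= dens r <= C / a.
  move=> r /andP[ar _]; have r0 : 0 < r by rewrite (lt_trans a0).
  rewrite radial_density_ge0 ?(ltW r0) //= ler_pdivlMr //.
  have e : radial_density m.-1.+1 r = dens r * r by rewrite /radial_density exprSr mulrAC.
  by rewrite (le_trans _ (HC r (ltW r0))) // e ler_wpM2l ?radial_density_ge0 // ltW.
have /andP[_] := radial_cdf_bounds (ltW a0) ab H.
by move=> /le_trans; apply; rewrite le_eqVlt; apply/orP; left; apply/eqP; ring.
Qed.

(** Both endpoints move, as the Clarke quotient requires; continuity of the density at [x] gives
    this stronger form of differentiability. *)
Lemma radial_cdf_strict_derivative (x e : R) : 0 < x -> 0 < e ->
  exists2 h : R, 0 < h & forall a b, `|a - x| < h -> `|b - x| < h ->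
  `|radial_cdf b - radial_cdf a - dens x / Z * (b - a)| <= e * `|b - a|.
Proof.
move=> x0 e0; have Z0 := chi_mass_gt0 R m.
have /cvgrPdist_le/(_ (e * Z) (mulr_gt0 e0 Z0)) := @continuous_radial_density R m.-1 x.
move=> /nbhs_ballP[h /= h0 Hh].
(* The bound by [x] keeps both endpoints nonnegative. *)
exists (Num.min h x); first by rewrite lt_min h0.
have key a b : `|a - x| < Num.min h x -> `|b - x| < Num.min h x -> a <= b ->
    `|radial_cdf b - radial_cdf a - dens x / Z * (b - a)| <= e * `|b - a|.
  rewrite !lt_min => /andP[ah ax] /andP[bh bx] ab.
  have a0 : 0 <= a by move: ax; rewrite ltr_distl => /andP[]; rewrite subrr => /ltW.
  have : forall r, a < r <= b -> dens x - e * Z <= dens r <= dens x + e * Z.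
    move=> r /andP[ar rb]; have : ball x h r.
      rewrite -ball_normE /= ltr_distlC.
      move: ah bh; rewrite !ltr_distl => /andP[? ?] /andP[? ?].
      by apply/andP; split; lra.
    by move=> /Hh /=; rewrite ler_distlC.
  move=> /(radial_cdf_bounds a0 ab).
  have -> : (dens x - e * Z) * (b - a) / Z = dens x / Z * (b - a) - e * (b - a).
    by field; rewrite gt_eqF.
  have -> : (dens x + e * Z) * (b - a) / Z = dens x / Z * (b - a) + e * (b - a).
    by field; rewrite gt_eqF.
  by rewrite (ger0_norm (_ : 0 <= b - a)) ?subr_ge0 // ler_distl.
move=> a b ah bh; have [ab|/ltW ba] := leP a b; first exact: key.
have h1 := key b a bh ah ba; rewrite (distrC b a); apply: le_trans h1.
rewrite -normrN le_eqVlt; apply/orP; left; apply/eqP; congr `|_|; ring.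
Qed.

End RadialCdf.

(** * Clarke directional derivatives *)

Section ClarkeTools.
Context (R : realType) (U : normedModType R).
Implicit Types (f : U -> R) (u h y : U) (p c t : R).

Lemma clarke_dd_le_of f u h p : (forall e : R, 0 < e -> exists2 delta : R, 0 < delta &
    forall y t, `|y - u| < delta -> 0 < t < delta -> (f (y + t *: h) - f y) / t <= p + e) ->
  (clarke_dd f u h <= p%:E)%E.
Proof.
move=> H; apply/lee_addgt0Pr => e e0; have [delta d0 Hd] := H e e0.
apply: (@le_trans _ _ (ereal_sup [set q : \bar R | exists (y : U) (t : R),
   `|y - u| < delta /\ 0 < t < delta /\ q = ((f (y + t *: h) - f y) / t)%:E])).
  by apply: ereal_inf_lbound; exists delta.
by apply: ge_ereal_sup => _ [y [t [yd [td ->]]]]; rewrite -EFinD lee_fin Hd.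
Qed.

Lemma clarke_dd_lt f u h c : (clarke_dd f u h < c%:E)%E -> exists2 delta : R, 0 < delta &
  forall y t, `|y - u| < delta -> 0 < t < delta -> (f (y + t *: h) - f y) / t <= c.
Proof.
move=> /ereal_inf_lt[_ [delta /= d0 <-] Hs]; exists delta => // y t yd td.
rewrite -lee_fin; apply: le_trans (ltW Hs); apply: ereal_sup_ubound.
by exists y, t.
Qed.

Lemma clarke_dd_ge_of f u h p : (forall e : R, 0 < e -> forall delta : R, 0 < delta ->
    exists y t, [/\ `|y - u| < delta, 0 < t < delta & p - e <= (f (y + t *: h) - f y) / t]) ->
  (p%:E <= clarke_dd f u h)%E.
Proof.
move=> H; apply: le_ereal_inf_tmp => _ [delta /= d0 <-].
apply/lee_subgt0Pr => e e0; have [y [t [yd td pq]]] := H e e0 delta d0.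
apply: (@le_trans _ _ ((f (y + t *: h) - f y) / t)%:E); first by rewrite lee_fin.
by apply: ereal_sup_ubound; exists y, t.
Qed.

Definition lipschitz_near f u (r K : R) := forall u1 u2,
  `|u1 - u| < r -> `|u2 - u| < r -> `|f u1 - f u2| <= K * `|u1 - u2|.

Section Lipschitz.
Variables (f : U -> R) (u : U) (r K : R).
Hypotheses (r0 : 0 < r) (fK : lipschitz_near f u r K).

Lemma near_line h : exists2 delta : R, 0 < delta & forall y t,
  `|y - u| < delta -> `|t| < delta -> `|y - u| < r /\ `|y + t *: h - u| < r.
Proof.
have h0 : 0 < `|h| + 1 by rewrite ltr_wpDl.
(* Half of the radius is for [y - u] and half for [t *: h]; adding 1 to the norm covers [h = 0]. *)
exists (Num.min (r / 2) (r / 2 / (`|h| + 1))).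
  by rewrite lt_min !divr_gt0.
move=> y t; rewrite !lt_min => /andP[y1 y2] /andP[t1 t2].
split; first by rewrite (lt_trans y1) // gtr_pMr // invf_lt1 // ltr1n.
rewrite addrAC (le_lt_trans (ler_normD _ _)) // [ltRHS](splitr r).
rewrite ltr_leD // normrZ; move: t2; rewrite ltr_pdivlMr // => t2.
by rewrite (le_trans _ (ltW t2)) // ler_wpM2l // lerDl.
Qed.

Lemma lipschitz_quotient h : exists2 delta : R, 0 < delta & forall y t,
  `|y - u| < delta -> 0 < t < delta -> `|(f (y + t *: h) - f y) / t| <= K * `|h|.
Proof.
have [delta d0 Hd] := near_line h; exists delta => // y t yd /andP[t0 td].
have td' : `|t| < delta by rewrite gtr0_norm.
have [y1 y2] := Hd y t yd td'.
rewrite normrM normfV (gtr0_norm t0) ler_pdivrMr // (le_trans (fK y2 y1)) //.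
by rewrite addrAC subrr add0r normrZ (gtr0_norm t0) [t * _]mulrC mulrA.
Qed.

Lemma clarke_dd_lipschitz h : exists2 p : R, clarke_dd f u h = p%:E & `|p| <= K * `|h|.
Proof.
have [delta d0 Hd] := lipschitz_quotient h.
have le1 : (clarke_dd f u h <= (K * `|h|)%:E)%E.
  apply: clarke_dd_le_of => e e0; exists delta => // y t yd td.
  by rewrite (le_trans (ler_norm _)) // (le_trans (Hd y t yd td)) // lerDl ltW.
have ge1 : ((- (K * `|h|))%:E <= clarke_dd f u h)%E.
  apply: clarke_dd_ge_of => e e0 d d0'.
  pose t := Num.min delta d / 2; have m0 : 0 < Num.min delta d by rewrite lt_min d0.
  have t0 : 0 < t by rewrite divr_gt0.
  have tm : t < Num.min delta d by rewrite /t; lra.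
  move: tm; rewrite lt_min => /andP[td1 td2].
  exists u, t; rewrite subrr normr0 t0; split => //.
  have : `|(f (u + t *: h) - f u) / t| <= K * `|h|.
    by apply: Hd; rewrite ?subrr ?normr0 ?t0.
  rewrite ler_norml => /andP[q _]; apply: le_trans q.
  by rewrite gerBl ltW.
case E : (clarke_dd f u h) le1 ge1 => [p| |] //; rewrite !lee_fin => p1 p2.
by exists p => //; rewrite ler_norml p1 p2.
Qed.

(** For [f] Lipschitz near [u] the derivative is finite by [clarke_dd_lipschitz], so [fine] does not
    fall back to its default value. *)
Definition clarke_val h := fine (clarke_dd f u h).

Lemma clarke_valE h : clarke_dd f u h = (clarke_val h)%:E.
Proof. by rewrite /clarke_val; have [p -> _] := clarke_dd_lipschitz h. Qed.

Lemma clarke_val_norm h : `|clarke_val h| <= K * `|h|.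
Proof. by rewrite /clarke_val; have [p -> pK] := clarke_dd_lipschitz h. Qed.

Lemma clarke_val_quotient h (e : R) : 0 < e -> exists2 delta : R, 0 < delta &
  forall y t, `|y - u| < delta -> 0 < t < delta ->
  (f (y + t *: h) - f y) / t <= clarke_val h + e.
Proof. by move=> e0; apply: clarke_dd_lt; rewrite clarke_valE lte_fin ltrDl. Qed.

(** Step along [h2] from [y], then along [h1] from [y + t *: h2]: the limsup over all nearby base
    points admits the second one as well. *)
Lemma clarke_val_subadd h1 h2 : clarke_val (h1 + h2) <= clarke_val h1 + clarke_val h2.
Proof.
rewrite -lee_fin -clarke_valE; apply: clarke_dd_le_of => e e0.
have e20 : 0 < e / 2 by rewrite divr_gt0.
have [d1 d10 H1] := clarke_val_quotient h1 e20.
have [d2 d20 H2] := clarke_val_quotient h2 e20.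
have g0 : 0 < `|h2| + 1 by rewrite ltr_wpDl.
pose d := Num.min d2 (Num.min (d1 / 2) (d1 / 2 / (`|h2| + 1))).
exists d; first by rewrite !lt_min d20 !divr_gt0.
move=> y t; rewrite /d !lt_min => /andP[yd2 /andP[yd1 _]] /andP[t0 /andP[td2 /andP[td1 td3]]].
have y1 : `|y + t *: h2 - u| < d1.
  rewrite addrAC (le_lt_trans (ler_normD _ _)) // [ltRHS](splitr d1).
  rewrite ltr_leD // normrZ (gtr0_norm t0); move: td3; rewrite ltr_pdivlMr // => td3.
  by rewrite (le_trans _ (ltW td3)) // ler_wpM2l ?(ltW t0) // lerDl.
have q1 : (f (y + t *: h2 + t *: h1) - f (y + t *: h2)) / t <= clarke_val h1 + e / 2.
  by apply: H1 => //; rewrite t0; lra.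
have q2 : (f (y + t *: h2) - f y) / t <= clarke_val h2 + e / 2.
  by apply: H2 => //; rewrite t0.
rewrite (_ : y + t *: (h1 + h2) = y + t *: h2 + t *: h1); last by rewrite scalerDr [t *: h1 + _]addrC addrA.
rewrite -(subrKA (f (y + t *: h2))) mulrDl; lra.
Qed.

Lemma clarke_val_le_scale (l : R) h : 0 < l -> clarke_val (l *: h) <= l * clarke_val h.
Proof.
move=> l0; rewrite -lee_fin -clarke_valE; apply: clarke_dd_le_of => e e0.
have [d d0 H] := clarke_val_quotient h (divr_gt0 e0 l0).
exists (Num.min d (d / l)); first by rewrite lt_min d0 divr_gt0.
move=> y t; rewrite !lt_min => /andP[yd _] /andP[t0 /andP[_ tl]].
have q : (f (y + (t * l) *: h) - f y) / (t * l) <= clarke_val h + e / l.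
  by apply: H => //; rewrite mulr_gt0 //=; move: tl; rewrite ltr_pdivlMr.
rewrite scalerA; have -> : (f (y + (t * l) *: h) - f y) / t =
    l * ((f (y + (t * l) *: h) - f y) / (t * l)) by field; rewrite !gt_eqF.
by rewrite (le_trans (ler_wpM2l (ltW l0) q)) // mulrDr mulrCA divff ?mulr1 // gt_eqF.
Qed.

End Lipschitz.

(** For a concave function the Clarke derivative is the left one, so the steps go backwards from
    [u]. *)
Definition backward_quotient f u h (n : nat) := (f u - f (u - n.+1%:R^-1 *: h)) * n.+1%:R.

(** A backward quotient at [u] is a forward quotient at the base point [u - h / (n + 1)], which
    tends to [u]. *)
Lemma backward_quotient_le f u h r K (e : R) : 0 < r -> lipschitz_near f u r K -> 0 < e ->
  \forall n \near \oo, backward_quotient f u h n <= clarke_val f u h + e.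
Proof.
move=> r0 fK e0; have [d d0 H] := clarke_val_quotient r0 fK h e0.
have g0 : 0 < `|h| + 1 by rewrite ltr_wpDl.
have m0 : 0 < Num.min d (d / (`|h| + 1)) by rewrite lt_min d0 divr_gt0.
have /cvgrPdist_lt/(_ _ m0) := @cvg_harmonic R; apply: filterS => n.
rewrite sub0r normrN gtr0_norm ?invr_gt0 // lt_min => /andP[nd].
rewrite ltr_pdivlMr // => nh.
have := H (u - n.+1%:R^-1 *: h) n.+1%:R^-1; rewrite subrK invrK; apply.
  rewrite addrAC subrr add0r normrN normrZ gtr0_norm ?invr_gt0 //.
  by rewrite (le_lt_trans _ nh) // ler_wpM2l ?invr_ge0 // lerDl.
by rewrite invr_gt0 ltr0n.
Qed.

Lemma backward_quotient_le_clarke f u h r K p : 0 < r -> lipschitz_near f u r K ->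
  backward_quotient f u h @ \oo --> p -> p <= clarke_val f u h.
Proof.
move=> r0 fK qp; apply/ler_addgt0Pr => e e0.
by apply: (cvgr_to_le qp); exact: backward_quotient_le fK e0.
Qed.

Definition concave_near f u (r : R) := forall (t : R) u1 u2, 0 <= t <= 1 ->
  `|u1 - u| < r -> `|u2 - u| < r ->
  t * f u1 + (1 - t) * f u2 <= f (t *: u1 + (1 - t) *: u2).

(** [y] divides the segment from [y - s *: h] to [y + t *: h] with weights [t / (s + t)] and
    [s / (s + t)]. The two steps are unrelated: [s] will be fixed while [t] tends to 0. *)
Lemma concave_slope (rho : U -> R) u r h y (s t : R) : concave_near rho u r ->
  0 < s -> 0 < t -> `|y + t *: h - u| < r -> `|y - s *: h - u| < r ->
  (rho (y + t *: h) - rho y) / t <= (rho y - rho (y - s *: h)) / s.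
Proof.
move=> rc s0 t0 y1 y2; have st0 : 0 < s + t by rewrite addr_gt0.
pose l := s / (s + t).
have l1 : 1 - l = t / (s + t) by rewrite /l; field; rewrite gt_eqF.
have l01 : 0 <= l <= 1.
  by rewrite /l divr_ge0 ?(ltW s0) ?(ltW st0) //= ler_pdivrMr // mul1r lerDl ltW.
have := rc l _ _ l01 y1 y2; rewrite l1.
have -> : l *: (y + t *: h) + (t / (s + t)) *: (y - s *: h) = y.
  rewrite !scalerDr addrACA -scalerDl -l1 [l + _]addrC subrK scale1r scalerN !scalerA.
  by rewrite l1 /l (_ : s / (s + t) * t = t / (s + t) * s) ?subrr ?addr0 //; ring.
move=> H; rewrite ler_pdivrMr // mulrAC ler_pdivlMr //.
have : (s + t) * (l * rho (y + t *: h) + t / (s + t) * rho (y - s *: h)) <= (s + t) * rho y.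
  by rewrite ler_wpM2l // ltW.
rewrite (_ : (s + t) * _ = s * rho (y + t *: h) + t * rho (y - s *: h)); last first.
  by rewrite /l; field; rewrite gt_eqF.
lra.
Qed.

End ClarkeTools.

(** * Clarke derivative of a smooth function of a concave one *)

Section Regularity.
Context (R : realType) (U : normedModType R).
Variables (f rho : U -> R) (F : R -> R) (u : U) (r K Kf D : R).
Hypotheses (r0 : 0 < r) (K0 : 0 <= K) (D0 : 0 <= D).
Hypothesis rho_concave : concave_near rho u r.
Hypothesis rho_lip : lipschitz_near rho u r K.
Hypothesis f_lip : lipschitz_near f u r Kf.
Hypothesis f_comp : forall y, `|y - u| < r -> f y = F (rho y).
Hypothesis F_strict : forall e : R, 0 < e -> exists2 h : R, 0 < h &
  forall a b, `|a - rho u| < h -> `|b - rho u| < h ->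
  `|F b - F a - D * (b - a)| <= e * `|b - a|.

Lemma strict_difference (e : R) : 0 < e -> exists2 r1 : R, 0 < r1 <= r &
  forall y1 y2, `|y1 - u| < r1 -> `|y2 - u| < r1 ->
  `|f y2 - f y1 - D * (rho y2 - rho y1)| <= e * (K * `|y2 - y1|).
Proof.
move=> e0; have [h h0 H] := F_strict e0.
have k0 : 0 < K + 1 by rewrite ltr_wpDl.
have m0 : 0 < Num.min r (h / (K + 1)) by rewrite lt_min r0 divr_gt0.
exists (Num.min r (h / (K + 1))); first by rewrite m0 ge_min lexx.
have near y : `|y - u| < Num.min r (h / (K + 1)) -> `|y - u| < r /\ `|rho y - rho u| < h.
  rewrite lt_min => /andP[yr yh]; split => //.
  have uu : `|u - u| < r by rewrite subrr normr0.
  rewrite (le_lt_trans (rho_lip yr uu)) //; move: yh; rewrite ltr_pdivlMr // => yh.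
  by rewrite (le_lt_trans _ yh) // mulrC ler_wpM2l // lerDl.
move=> y1 y2 /near[y1r y1h] /near[y2r y2h].
rewrite !f_comp // (le_trans (H _ _ y1h y2h)) // ler_wpM2l ?(ltW e0) //.
exact: rho_lip.
Qed.

(** One inequality is [backward_quotient_le]. For the other, fix the step [s]: by concavity every
    forward slope of [rho] at [y] near [u] is at most its backward slope over [s] at [y], which
    differs from the one at [u] by at most [2 K |y - u| / s]. The factor [D], nonnegative, carries
    this over to [f]. *)
Lemma regular_backward_quotient h :
  backward_quotient f u h @ \oo --> clarke_val f u h.
Proof.
apply/cvgrPdist_le => e e0.
have g0 : 0 < 2 * K * `|h| + 1 by rewrite ltr_wpDl // !mulr_ge0.
(* Two linearisation errors [e1 K |h|], one for each quotient of [f], and one error [e1] from moving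
   the base point add up to [e]. *)
pose e1 := e / (2 * K * `|h| + 1); have e10 : 0 < e1 by rewrite divr_gt0.
have [r1 /andP[r10 r1r] H] := strict_difference e10.
have h0 : 0 < `|h| + 1 by rewrite ltr_wpDl.
have small : \forall n \near \oo, n.+1%:R^-1 * (`|h| + 1) < r1.
  have /cvgrPdist_lt/(_ (r1 / (`|h| + 1)) (divr_gt0 r10 h0)) := @cvg_harmonic R.
  apply: filterS => n; rewrite sub0r normrN gtr0_norm ?invr_gt0 //.
  by rewrite ltr_pdivlMr.
apply: filterS2 (backward_quotient_le h r0 f_lip e0) small => n qle ns.
set s : R := n.+1%:R^-1 in ns; have s0 : 0 < s by rewrite invr_gt0.
have sh : s * `|h| < r1 by rewrite (le_lt_trans _ ns) // ler_wpM2l ?(ltW s0) // lerDl.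
pose a := (rho u - rho (u - s *: h)) / s.
have uu : `|u - u| < r1 by rewrite subrr normr0.
have us : `|u - s *: h - u| < r1.
  by rewrite addrAC subrr add0r normrN normrZ gtr0_norm.
have lower : D * a - e1 * (K * `|h|) <= backward_quotient f u h n.
  have := H _ _ us uu; rewrite opprB addrCA subrr addr0 normrZ gtr0_norm //.
  rewrite ler_norml => /andP[q _].
  have -> : backward_quotient f u h n = (f u - f (u - s *: h)) / s.
    by rewrite /backward_quotient /s invrK.
  rewrite ler_pdivlMr // mulrBl -mulrA (_ : a * s = rho u - rho (u - s *: h)); last by rewrite /a divfK ?gt_eqF.
  lra.
have upper : clarke_val f u h <= D * a + e1 * (K * `|h|) + e1.
  rewrite -lee_fin -(clarke_valE r0 f_lip).
  apply: clarke_dd_le_of => e2 e20.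
  have k0 : 0 < 2 * D * K + 1 by rewrite ltr_wpDl // !mulr_ge0.
  (* [c] is half the room left by [s *: h], so that [y], [y + t *: h] and [y - s *: h] stay in the
     ball; the last entry of [d] makes [2 D K |y - u| / s] at most [e1]. *)
  pose c := (r1 - s * `|h|) / 2; have c0 : 0 < c by rewrite divr_gt0 // subr_gt0.
  pose d := Num.min c (Num.min (c / (`|h| + 1)) (e1 * s / (2 * D * K + 1))).
  exists d.
    by rewrite /d !lt_min c0 /= (divr_gt0 c0 h0) (divr_gt0 (mulr_gt0 e10 s0) k0).
  move=> y t; rewrite /d !lt_min => /andP[yc /andP[_ ye]] /andP[t0 /andP[_ /andP[tc _]]].
  have sh0 : 0 <= s * `|h| by rewrite mulr_ge0 // ltW.
  have y1 : `|y - u| < r1 by rewrite /c in yc; lra.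
  have y2 : `|y + t *: h - u| < r1.
    rewrite addrAC (le_lt_trans (ler_normD _ _)) // normrZ (gtr0_norm t0).
    have : t * `|h| < c.
      move: tc; rewrite ltr_pdivlMr // => tc.
      by rewrite (le_lt_trans _ tc) // ler_wpM2l ?(ltW t0) // lerDl.
    by move: yc; rewrite /c; move: (`|y - u|) (t * `|h|) => ? ?; lra.
  have y3 : `|y - s *: h - u| < r1.
    rewrite addrAC (le_lt_trans (ler_normB _ _)) // normrZ (gtr0_norm s0).
    by move: yc; rewrite /c; move: (`|y - u|) => ?; lra.
  have lt1 z : `|z - u| < r1 -> `|z - u| < r by move=> /lt_le_trans; apply.
  have slope := concave_slope rho_concave s0 t0 (lt1 _ y2) (lt1 _ y3).
  have dl : (rho y - rho (y - s *: h)) / s <= a + 2 * K * `|y - u| / s.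
    rewrite /a -mulrDl ler_pM2r ?invr_gt0 //.
    have l1 := rho_lip (lt1 _ y1) (lt1 _ uu); have l2 := rho_lip (lt1 _ us) (lt1 _ y3).
    have n2 : `|u - s *: h - (y - s *: h)| = `|y - u|.
      by rewrite opprB addrA subrK distrC.
    rewrite n2 in l2; move: l1 l2; rewrite !ler_norml => /andP[_ l1] /andP[_ l2]; lra.
  have q := H _ _ y1 y2; rewrite [y + _ - y]addrAC subrr add0r normrZ (gtr0_norm t0) in q.
  have q1 : (f (y + t *: h) - f y) / t <= D * ((rho (y + t *: h) - rho y) / t) + e1 * (K * `|h|).
    rewrite ler_pdivrMr // mulrDl -mulrA divfK ?gt_eqF //.
    move: q; rewrite ler_norml => /andP[_ q].
    by rewrite (_ : e1 * (K * `|h|) * t = e1 * (K * (t * `|h|))); [lra|ring].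
  have q2 := ler_wpM2l D0 (le_trans slope dl).
  have q3 : D * (2 * K * `|y - u| / s) <= e1.
    have := ltW ye; rewrite ler_pdivlMr // => ye'.
    rewrite (_ : D * _ = (`|y - u| * (2 * D * K)) / s); last by ring.
    by rewrite ler_pdivrMr // (le_trans _ ye') // ler_wpM2l // lerDl.
  rewrite mulrDr in q2; lra.
have ee : e1 * (2 * K * `|h| + 1) = e by rewrite /e1 divfK ?gt_eqF.
rewrite ler_norml; move: qle lower upper => /= qle lower upper.
rewrite mulrDr mulr1 (_ : e1 * (2 * K * `|h|) = e1 * (K * `|h|) + e1 * (K * `|h|)) in ee; last by ring.
by apply/andP; split; lra.
Qed.

End Regularity.

(** * Regularity of the radial probability function *)

Section RadialFunction.
Context (R : realType) (U : normedModType R) (m : nat) (g : U -> 'cV[R]_m -> R) (ubar : U).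
Hypothesis g_lip : locally_lipschitz g.
Hypothesis g_convex : jointly_convex g.
Hypothesis g_neg : g ubar 0 < 0.

Lemma negative_ball : exists2 r : R, 0 < r & forall u, `|u - ubar| < r -> g u 0 < 0.
Proof.
have [r [K [r0 H]]] := g_lip ubar 0.
have k0 : 0 < `|K| + 1 by rewrite ltr_wpDl.
exists (Num.min r (- g ubar 0 / (`|K| + 1))).
  by rewrite lt_min r0 divr_gt0 // oppr_gt0.
move=> u; rewrite lt_min => /andP[ur uK].
have := H u ubar 0 0; rewrite !subrr !normr0 addr0 => /(_ ur r0 r0 r0) H1.
move: uK; rewrite ltr_pdivlMr // => uK.
have : K * `|u - ubar| <= (`|K| + 1) * `|u - ubar|.
  by rewrite ler_wpM2r // (le_trans (ler_norm K)) // lerDl.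
rewrite [(_ + 1) * _]mulrC => H2; move: H1; rewrite ler_norml => /andP[_ H1]; lra.
Qed.

Section Direction.
Variables (r0 : R) (w : 'cV[R]_m).
Hypothesis r0_gt0 : 0 < r0.
Hypothesis g_ball : forall u, `|u - ubar| < r0 -> g u 0 < 0.

Definition radial_set (u : U) : set R := [set r | 0 <= r /\ g u (r *: w) <= 0].

(** With [s = kap |u1 - u2|], prolonging the segment from [u1] to [u2] by the factor [1 / s] travels
    exactly [r0 / 2]. Starting within [r0 / 8] of [ubar] it stays in the ball of radius [r0], and
    [|u1 - u2| < r0 / 4] gives [s <= 1 / 2]. *)
Let r1 := r0 / 8.
Let kap := 2 / r0.

Let r1_gt0 : 0 < r1. Proof. by rewrite divr_gt0. Qed.

Lemma radial_step_le (u1 u2 : U) : `|u1 - ubar| < r1 -> `|u2 - ubar| < r1 ->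
  kap * `|u1 - u2| <= 1 / 2.
Proof.
move=> h1 h2; have h : `|u1 - u2| <= `|u1 - ubar| + `|u2 - ubar|.
  by rewrite [`|u2 - _|]distrC -{1}(subrKA ubar) ler_normD.
rewrite /kap mulrAC ler_pdivrMr //; move: h h1 h2; rewrite /r1; lra.
Qed.

(* [(u2, (1 - kap |u1 - u2|) r w)] is a convex combination of [(u1, r w)] and of a point [(y, 0)] with [|y - ubar| < r0], where [g y 0 < 0]. *)
Lemma radial_set_shrink (u1 u2 : U) r : `|u1 - ubar| < r1 -> `|u2 - ubar| < r1 ->
  radial_set u1 r -> radial_set u2 ((1 - kap * `|u1 - u2|) * r).
Proof.
move=> h1 h2 [rr gr]; set s := kap * `|u1 - u2|.
have s12 := radial_step_le h1 h2; rewrite -/s in s12.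
have k0 : 0 < kap by rewrite divr_gt0.
have s0 : 0 <= s by rewrite mulr_ge0 // ltW.
split; first by rewrite mulr_ge0 // subr_ge0; lra.
have [u12|u12] := eqVneq u1 u2.
  by rewrite /s u12 subrr normr0 mulr0 subr0 mul1r -u12.
have n0 : 0 < `|u1 - u2| by rewrite normr_gt0 subr_eq0.
have sp : 0 < s by rewrite mulr_gt0.
pose u' := u1 + s^-1 *: (u2 - u1).
have gu' : g u' 0 < 0.
  apply: g_ball; rewrite /u' addrAC (le_lt_trans (ler_normD _ _)) // normrZ normfV (gtr0_norm sp).
  rewrite [`|u2 - u1|]distrC (_ : s^-1 * `|u1 - u2| = r0 / 2); last first.
    by rewrite /s /kap; field; rewrite !gt_eqF.
  by move: h1 r0_gt0; rewrite /r1; lra.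
have s01 : 0 <= 1 - s <= 1 by apply/andP; split; lra.
have := g_convex u1 u' (r *: w) 0 s01.
rewrite scaler0 addr0 scalerA.
have -> : (1 - s) *: u1 + (1 - (1 - s)) *: u' = u2.
  rewrite /u' (_ : 1 - (1 - s) = s); last by ring.
  rewrite scalerDr scalerA divff ?gt_eqF // scale1r addrA -scalerDl subrK scale1r.
  by rewrite addrCA subrr addr0.
move=> /le_trans; apply.
have t1 : (1 - s) * g u1 (r *: w) <= 0 by rewrite mulr_ge0_le0 //; lra.
have t2 : (1 - (1 - s)) * g u' 0 <= 0 by rewrite mulr_ge0_le0 //; lra.
lra.
Qed.

(** Convexity along the ray, whose origin has a negative value of [g]. *)
Lemma radial_set_down (u : U) r r' : `|u - ubar| < r0 -> 0 <= r' -> r' <= r ->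
  radial_set u r -> radial_set u r'.
Proof.
move=> ur r'0 r'r [rr gr]; split => //.
have [r00|rN0] := eqVneq r 0.
  have -> : r' = 0 by apply/eqP; rewrite eq_le r'0 andbT -r00.
  by rewrite scale0r ltW // g_ball.
have rp : 0 < r by rewrite lt_neqAle eq_sym rN0.
pose t := r' / r; have t01 : 0 <= t <= 1.
  by rewrite /t divr_ge0 //= ler_pdivrMr // mul1r.
have := g_convex u u (r *: w) 0 t01.
rewrite scaler0 addr0 scalerA (_ : t * r = r'); last by rewrite /t divfK.
rewrite -scalerDl addrCA subrr addr0 scale1r => /le_trans; apply.
case/andP: t01 => t0 t1.
have a1 : t * g u (r *: w) <= 0 by rewrite mulr_ge0_le0.
have a2 : (1 - t) * g u 0 <= 0 by rewrite mulr_ge0_le0 ?subr_ge0 // ltW // g_ball.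
lra.
Qed.

Let in_r0 u : `|u - ubar| < r1 -> `|u - ubar| < r0.
Proof. by rewrite /r1 => h; move: h r0_gt0; lra. Qed.

(** Whether a ray stays in the sublevel set forever is the same for all points near [ubar]: a given
    [r] is the shrunk image of [r / (1 - kap |u1 - u2|)]. *)
Lemma radial_set_full (u1 u2 : U) : `|u1 - ubar| < r1 -> `|u2 - ubar| < r1 ->
  (forall r, 0 <= r -> radial_set u1 r) -> (forall r, 0 <= r -> radial_set u2 r).
Proof.
move=> h1 h2 full r rr; have s := radial_step_le h1 h2.
have p : 0 < 1 - kap * `|u1 - u2| by lra.
have q := radial_set_shrink h1 h2 (full _ (divr_ge0 rr (ltW p))).
by rewrite mulrC divfK ?gt_eqF // in q.
Qed.

(** A genuine supremum under [not_full]; for a full ray [sup] only returns a default value, and that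
    case is treated apart. *)
Definition radial_sup (u : U) : R := sup (radial_set u).

Section Bounded.
Hypothesis not_full : exists2 r, 0 <= r & 0 < g ubar (r *: w).

Let cu : `|ubar - ubar| < r1. Proof. by rewrite subrr normr0. Qed.

Lemma radial_set_has_sup u : `|u - ubar| < r1 -> has_sup (radial_set u).
Proof.
move=> ur; split.
  by exists 0; split => //; rewrite scale0r ltW // g_ball // in_r0.
have [R0 [R00 gR]] : exists R0 : R, 0 <= R0 /\ 0 < g u (R0 *: w).
  (* A ray that is full at [u] would be full at [ubar] too. *)
  apply: contrapT => H; have [r rr gr] := not_full.
  have full : forall r', 0 <= r' -> radial_set u r'.
    move=> r' r'0; split => //; rewrite leNgt; apply/negP => gg.
    by apply: H; exists r'.
  by have [_] := radial_set_full ur cu full rr; rewrite leNgt gr.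
exists R0 => r Sr; rewrite leNgt; apply/negP => lt.
have [_] := radial_set_down (in_r0 ur) R00 (ltW lt) Sr.
by rewrite leNgt gR.
Qed.

Lemma radial_setE u : `|u - ubar| < r1 -> radial_set u = `[0, radial_sup u]%classic.
Proof.
move=> ur; have hs := radial_set_has_sup ur.
have ub r : radial_set u r -> r <= radial_sup u by move=> ?; apply: sup_upper_bound.
apply/seteqP; split => r /=; first by rewrite in_itv /= => Sr; rewrite (ub r Sr) (proj1 Sr).
rewrite in_itv /= => /andP[rr rs].
have S0 : 0 <= radial_sup u by exact: le_trans rs.
apply: (radial_set_down (in_r0 ur) rr rs); split => //.
(* The supremum is attained: a positive value there would persist nearby, where members of the set
   accumulate. *)
rewrite leNgt; apply/negP => gp.
have gc : {for radial_sup u, continuous (fun r : R => g u (r *: w))}.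
  apply: (@continuous_comp _ _ _ (fun r : R => r *: w) (g u)).
    exact: scalel_continuous.
  exact: (lipschitz_continuous_snd g_lip).
have /nbhs_ballP[e /= e0 He] : \forall r \near radial_sup u, 0 < g u (r *: w).
  by have := cvgr_gt _ gc _ gp; exact.
have [r' Sr' lt] := sup_adherent e0 hs.
have : ball (radial_sup u) e r'.
  rewrite -ball_normE /= ger0_norm ?subr_ge0 ?ub //.
  by move: lt; rewrite /radial_sup; lra.
by move=> /He; rewrite ltNge (proj2 Sr').
Qed.

Lemma radial_sup_mem u : `|u - ubar| < r1 -> radial_set u (radial_sup u).
Proof.
move=> ur; rewrite radial_setE //= in_itv /= lexx andbT.
have : radial_set u 0 by split => //; rewrite scale0r ltW // g_ball // in_r0.
by rewrite radial_setE //= in_itv /= => /andP[].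
Qed.

Lemma radial_sup_ub u r : `|u - ubar| < r1 -> radial_set u r -> r <= radial_sup u.
Proof. by move=> ur Sr; apply: sup_upper_bound => //; exact: radial_set_has_sup. Qed.

Lemma radial_sup_gt0 u : `|u - ubar| < r1 -> 0 < radial_sup u.
Proof.
move=> ur.
have gc : {for 0, continuous (fun r : R => g u (r *: w))}.
  apply: (@continuous_comp _ _ _ (fun r : R => r *: w) (g u)).
    exact: scalel_continuous.
  exact: (lipschitz_continuous_snd g_lip).
have g0 : g u (0 *: w) < 0 by rewrite scale0r g_ball // in_r0.
have /nbhs_ballP[e /= e0 He] : \forall r \near (0 : R), g u (r *: w) < 0.
  by have := cvgr_lt _ gc _ g0; exact.
apply: (@lt_le_trans _ _ (e / 2)); first by rewrite divr_gt0.
apply: radial_sup_ub => //; split; first by rewrite divr_ge0 // ltW.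
apply/ltW/He; rewrite -ball_normE /= sub0r normrN gtr0_norm ?divr_gt0 //.
by rewrite gtr_pMr // invf_lt1 // ltr1n.
Qed.

(** Joint convexity makes the convex combination of the two extreme radii admissible at the combined
    point. *)
Lemma radial_sup_concave : concave_near radial_sup ubar r1.
Proof.
move=> t u1 u2 t01 h1 h2; case/andP: (t01) => t0 t1.
have h3 : `|t *: u1 + (1 - t) *: u2 - ubar| < r1.
  have -> : t *: u1 + (1 - t) *: u2 - ubar = t *: (u1 - ubar) + (1 - t) *: (u2 - ubar).
    by rewrite !scalerBr addrACA -opprD -scalerDl addrCA subrr addr0 scale1r.
  rewrite (le_lt_trans (ler_normD _ _)) // !normrZ (ger0_norm t0) ger0_norm ?subr_ge0 //.
  move: h1 h2; set a := `|_|; set b := `|_| => h1 h2.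
  have [t0'|tN] := eqVneq t 0; first by rewrite t0' mul0r add0r subr0 mul1r.
  have tp : 0 < t by rewrite lt_neqAle eq_sym tN.
  have l1 : t * a < t * r1 by rewrite ltr_pM2l.
  have l2 : (1 - t) * b <= (1 - t) * r1 by rewrite ler_wpM2l ?subr_ge0 // ltW.
  lra.
apply: radial_sup_ub => //.
have [p1 q1] := radial_sup_mem h1; have [p2 q2] := radial_sup_mem h2.
split; first by rewrite addr_ge0 // mulr_ge0 // subr_ge0.
rewrite [(_ + _) *: w]scalerDl -!scalerA (le_trans (g_convex _ _ _ _ t01)) //.
have l1 : t * g u1 (radial_sup u1 *: w) <= 0 by rewrite mulr_ge0_le0.
have l2 : (1 - t) * g u2 (radial_sup u2 *: w) <= 0 by rewrite mulr_ge0_le0 // subr_ge0.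
lra.
Qed.

Lemma radial_sup_shrink u1 u2 : `|u1 - ubar| < r1 -> `|u2 - ubar| < r1 ->
  (1 - kap * `|u1 - u2|) * radial_sup u1 <= radial_sup u2.
Proof.
move=> h1 h2; apply: radial_sup_ub => //; apply: radial_set_shrink => //.
exact: radial_sup_mem.
Qed.

(** Shrinking by at most one half gives [radial_sup u <= 2 radial_sup ubar]. The constant depends on
    the direction, which is harmless in the pointwise regularity argument. *)
Lemma radial_sup_lipschitz : lipschitz_near radial_sup ubar r1 (2 * kap * radial_sup ubar).
Proof.
have k0 : 0 < kap by rewrite divr_gt0.
have ubd u : `|u - ubar| < r1 -> radial_sup u <= 2 * radial_sup ubar.
  move=> ur; have := radial_sup_shrink ur cu; have := radial_step_le ur cu.
  set s := kap * _ => s12 h; have p := radial_sup_gt0 ur.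
  have : 1 / 2 * radial_sup u <= (1 - s) * radial_sup u by rewrite ler_pM2r //; lra.
  lra.
have half u1 u2 : `|u1 - ubar| < r1 -> `|u2 - ubar| < r1 ->
    radial_sup u1 - radial_sup u2 <= 2 * kap * radial_sup ubar * `|u1 - u2|.
  move=> h1 h2; have := radial_sup_shrink h1 h2; rewrite mulrBl mul1r.
  have : kap * `|u1 - u2| * radial_sup u1 <= kap * `|u1 - u2| * (2 * radial_sup ubar).
    by rewrite ler_wpM2l ?ubd // mulr_ge0 // ltW.
  rewrite (_ : kap * `|u1 - u2| * (2 * _) = 2 * kap * radial_sup ubar * `|u1 - u2|); last by ring.
  lra.
move=> u1 u2 h1 h2; rewrite ler_norml lerNl opprB.
by rewrite {1}[`|u1 - u2|]distrC !half.
Qed.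

(** Here the constant is free of the direction: with [s = kap |u1 - u2| <= 1 / 2], the relative
    increment of the radius is at most [2 s]. *)
Lemma radial_cdf_sup_lipschitz (C : R) : 0 <= C ->
  (forall a b : R, 0 < a -> a <= b -> radial_cdf m b - radial_cdf m a <= C * ((b - a) / a)) ->
  lipschitz_near (fun u => radial_cdf m (radial_sup u)) ubar r1 (2 * C * kap).
Proof.
move=> C0 HC; have k0 : 0 < kap by rewrite divr_gt0.
have half u1 u2 : `|u1 - ubar| < r1 -> `|u2 - ubar| < r1 ->
    radial_cdf m (radial_sup u1) - radial_cdf m (radial_sup u2) <= 2 * C * kap * `|u1 - u2|.
  move=> h1 h2; have p1 := radial_sup_gt0 h1; have p2 := radial_sup_gt0 h2.
  have rhs0 : 0 <= 2 * C * kap * `|u1 - u2| by rewrite mulr_ge0 // mulr_ge0 ?(ltW k0) // mulr_ge0.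
  have [le12|/ltW le21] := leP (radial_sup u1) (radial_sup u2).
    by rewrite (le_trans _ rhs0) // subr_le0 radial_cdf_mono // ltW.
  rewrite (le_trans (HC _ _ p2 le21)) //.
  have := radial_sup_shrink h1 h2; have := radial_step_le h1 h2.
  set s := kap * `|u1 - u2| => s12 h.
  have s0 : 0 <= s by rewrite mulr_ge0 // ltW.
  rewrite (_ : 2 * C * kap * `|u1 - u2| = C * (2 * s)); last by rewrite /s; ring.
  rewrite ler_wpM2l // ler_pdivrMr //.
  have l1 : 1 / 2 * radial_sup u1 <= (1 - s) * radial_sup u1 by rewrite ler_pM2r //; lra.
  have l2 : s * radial_sup u1 <= s * (2 * radial_sup u2) by rewrite ler_wpM2l //; lra.
  rewrite mulrBl mul1r in h; rewrite (_ : 2 * s * _ = s * (2 * radial_sup u2)); last by ring.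
  lra.
move=> u1 u2 h1 h2; rewrite ler_norml lerNl opprB.
by rewrite {1}[`|u1 - u2|]distrC !half.
Qed.

End Bounded.
End Direction.

Lemma chi_prob_full : chi_prob m [set r : R | 0 <= r] = 1.
Proof.
rewrite /chi_prob (_ : _ `&` _ = `[0, +oo[%classic); last first.
  by apply/seteqP; split => r /=; rewrite in_itv /= andbT; [case|].
by rewrite divff // gt_eqF //; exact: (chi_mass_gt0 R m).
Qed.

(** [r] and [K] are chosen before [v]; this uniformity is the domination needed to integrate over
    the sphere. *)
Lemma radial_prob_regular (L : 'M[R]_m) : exists r K : R, [/\ 0 < r, 0 <= K & forall v,
  lipschitz_near (fun u => radial_prob L g u v) ubar r K /\
  forall h, backward_quotient (fun u => radial_prob L g u v) ubar h @ \oo -->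
    clarke_val (fun u => radial_prob L g u v) ubar h].
Proof.
have [r0 r00 g_ball] := negative_ball.
have [C [C0 HC]] := radial_cdf_lipschitz R m.
have r10 : 0 < r0 / 8 by rewrite divr_gt0.
have cu : `|ubar - ubar| < r0 / 8 by rewrite subrr normr0.
have k0 : 0 <= 2 * C * (2 / r0) by rewrite !mulr_ge0 // invr_ge0 ltW.
exists (r0 / 8), (2 * C * (2 / r0)); split => // v.
pose w := L *m v.
have [full|] := pselect (forall r, 0 <= r -> radial_set w ubar r).
  have one u : `|u - ubar| < r0 / 8 -> radial_prob L g u v = 1.
    move=> ur; rewrite -chi_prob_full; congr chi_prob; apply/seteqP; split => r /=; first by case.
    by move=> rr; exact: (radial_set_full r00 g_ball cu ur full rr).
  have lip : lipschitz_near (fun u => radial_prob L g u v) ubar (r0 / 8) (2 * C * (2 / r0)).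
    by move=> u1 u2 h1 h2; rewrite !one // subrr normr0 mulr_ge0.
  split => // h.
  (* On a full ray the function is constant near [ubar]: a degenerate composition with derivative
     [D = 0]. *)
  apply: (@regular_backward_quotient _ _ _ (fun=> 0) (fun=> 1) _ (r0 / 8) 0 _ 0 _ _ _ _ _ lip) => //.
  - by move=> t u1 u2 _ _ _; rewrite !mulr0 addr0.
  - by move=> u1 u2 _ _; rewrite subrr normr0 mul0r.
  - by move=> e e0; exists 1 => // a b _ _; rewrite subrr mul0r subr0 normr0 mulr_ge0 // ltW.
move=> /existsNP[r /not_implyP[rr nr]].
have not_full : exists2 r, 0 <= r & 0 < g ubar (r *: w).
  by exists r => //; rewrite ltNge; apply/negP => gr; exact: nr.
have eE u : `|u - ubar| < r0 / 8 -> radial_prob L g u v = radial_cdf m (radial_sup w u).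
  by move=> ur; rewrite /radial_cdf -(radial_setE r00 g_ball not_full ur).
have lip : lipschitz_near (fun u => radial_prob L g u v) ubar (r0 / 8) (2 * C * (2 / r0)).
  move=> u1 u2 h1 h2; rewrite !eE //.
  exact: (radial_cdf_sup_lipschitz r00 g_ball not_full C0 HC).
split => // h.
have s0 := radial_sup_gt0 r00 g_ball not_full cu.
apply: (@regular_backward_quotient _ _ _ (radial_sup w) (radial_cdf m) _ (r0 / 8)
  (2 * (2 / r0) * radial_sup w ubar) _
  (radial_density m.-1 (radial_sup w ubar) / chi_mass R m) _ _ _ _ _ lip) => //.
- by rewrite !mulr_ge0 // ?invr_ge0 ltW.
- by rewrite divr_ge0 ?radial_density_ge0 // ltW // chi_mass_gt0.
- exact: (radial_sup_concave r00 g_ball not_full).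
- exact: (radial_sup_lipschitz r00 g_ball not_full).
- by move=> e e0; exact: radial_cdf_strict_derivative.
Qed.

End RadialFunction.

(** * Clarke derivative of an expectation *)

Section ClarkeExpectation.
Context d (T : measurableType d) (R : realType) (mu : probability T R).
Context (U : normedModType R) (e : U -> T -> R) (ubar : U) (r K : R).
Hypothesis r0 : 0 < r.
Hypothesis e_bounded : forall u, bounded_mfun (e u).
Hypothesis e_lip : forall v, lipschitz_near (e^~ v) ubar r K.
Hypothesis e_regular : forall v h,
  backward_quotient (e^~ v) ubar h @ \oo --> clarke_val (e^~ v) ubar h.

Let phi u := \int[mu]_v e u v.
Let q h v := clarke_val (e^~ v) ubar h.

Lemma expect_lipschitz : lipschitz_near phi ubar r K.
Proof.
move=> u1 u2 h1 h2; rewrite /phi -expectB //.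
apply: le_norm_expect; first exact: bounded_mfunB.
by move=> v; exact: e_lip.
Qed.

Lemma small_harmonic h : \forall n \near \oo, `|ubar - n.+1%:R^-1 *: h - ubar| < r.
Proof.
have h0 : 0 < `|h| + 1 by rewrite ltr_wpDl.
have /cvgrPdist_lt/(_ (r / (`|h| + 1)) (divr_gt0 r0 h0)) := @cvg_harmonic R.
apply: filterS => n; rewrite sub0r normrN gtr0_norm ?invr_gt0 // ltr_pdivlMr // => nh.
rewrite addrAC subrr add0r normrN normrZ gtr0_norm ?invr_gt0 //.
by rewrite (le_lt_trans _ nh) // ler_wpM2l ?invr_ge0 // lerDl.
Qed.

(** The Clarke derivative is an uncountable limsup; as a limit of a sequence of measurable quotients
    it becomes measurable in [v]. *)
Lemma expect_backward h : bounded_mfun (q h) /\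
  backward_quotient phi ubar h @ \oo --> \int[mu]_v q h v.
Proof.
have [N _ HN] := small_harmonic h.
have uu : `|ubar - ubar| < r by rewrite subrr normr0.
(* The shift by [N] puts every base point in the Lipschitz ball, so one bound serves the whole
   sequence. *)
pose f n v := backward_quotient (e^~ v) ubar h (n + N).
have bf n : bounded_mfun (f n).
  rewrite /f /backward_quotient.
  under eq_fun do rewrite mulrC.
  by apply: bounded_mfunZ; exact: bounded_mfunB.
have fK n v : `|f n v| <= K * `|h|.
  have ns : `|ubar - (n + N).+1%:R^-1 *: h - ubar| < r by apply: HN => /=; exact: leq_addl.
  have := e_lip v uu ns; rewrite opprB addrCA subrr addr0 normrZ gtr0_norm ?invr_gt0 // => l.
  rewrite /f /backward_quotient normrM [X in _ * X]ger0_norm //.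
  rewrite -ler_pdivlMr // (le_trans l) // le_eqVlt; apply/orP; left; apply/eqP; ring.
have fq v : f ^~ v @ \oo --> q h v.
  have := @e_regular v h; rewrite -(cvg_shiftn N); exact.
have [bq cq] := expect_cvg mu (fun n => (bf n).1) fK fq.
split => //; rewrite -(cvg_shiftn N).
have e1 : (fun n => \int[mu]_v f n v) = (fun n => backward_quotient phi ubar h (n + N)).
  apply/funext => n; rewrite /f /backward_quotient.
  rewrite (@eq_Rintegral _ _ _ mu setT (fun v => (n + N).+1%:R *
     (e ubar v - e (ubar - (n + N).+1%:R^-1 *: h) v))); last by move=> v _; rewrite mulrC.
  by rewrite expectZ ?expectB // 1?mulrC //; exact: bounded_mfunB.
by rewrite -e1.
Qed.

Lemma clarke_val_expect_ge h : \int[mu]_v q h v <= clarke_val phi ubar h.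
Proof.
apply: (backward_quotient_le_clarke r0 expect_lipschitz).
by have [_] := expect_backward h.
Qed.

(* The difference quotients only satisfy [limsup <= q]; replacing them by their maximum with [q] makes them converge, so that dominated convergence applies. *)
Lemma clarke_val_expect_le h : clarke_val phi ubar h <= \int[mu]_v q h v.
Proof.
have [bq _] := expect_backward h.
rewrite leNgt; apply/negP => lt; pose c := (\int[mu]_v q h v + clarke_val phi ubar h) / 2.
have c1 : \int[mu]_v q h v < c by rewrite /c; lra.
have c2 : c < clarke_val phi ubar h by rewrite /c; lra.
have [d0 d00 Hd] := @near_line _ _ ubar _ r0 h.
have bad (n : nat) : {yt : U * R | [/\ `|yt.1 - ubar| < Num.min d0 n.+1%:R^-1,
    0 < yt.2 < Num.min d0 n.+1%:R^-1 & c <= (phi (yt.1 + yt.2 *: h) - phi yt.1) / yt.2]}.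
  apply: cid; apply: contrapT => no.
  have : (clarke_dd phi ubar h <= c%:E)%E.
    apply: clarke_dd_le_of => e1 e10; exists (Num.min d0 n.+1%:R^-1).
      by rewrite lt_min d00 /= invr_gt0 ltr0n.
    move=> y t yd td; rewrite leNgt; apply/negP => gt; apply: no; exists (y, t); split => //.
    by rewrite (le_trans _ (ltW gt)) // lerDl ltW.
  by rewrite (clarke_valE r0 expect_lipschitz) lee_fin leNgt c2.
pose y n := (sval (bad n)).1; pose t n := (sval (bad n)).2.
have badP n : [/\ `|y n - ubar| < Num.min d0 n.+1%:R^-1,
    0 < t n < Num.min d0 n.+1%:R^-1 & c <= (phi (y n + t n *: h) - phi (y n)) / t n].
  exact: (svalP (bad n)).
pose Q n v := (e (y n + t n *: h) v - e (y n) v) / t n.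
have bQ n : bounded_mfun (Q n).
  rewrite /Q; under eq_fun do rewrite mulrC.
  by apply: bounded_mfunZ; exact: bounded_mfunB.
have t0 n : 0 < t n by have [_ /andP[]] := badP n.
have QK n v : `|Q n v| <= K * `|h|.
  have [yn /andP[_ tn] _] := badP n; move: yn tn; rewrite !lt_min => /andP[yn _] /andP[tn _].
  have tn' : `|t n| < d0 by rewrite gtr0_norm.
  have [y1 y2] := Hd _ _ yn tn'.
  rewrite /Q normrM normfV (gtr0_norm (t0 n)) ler_pdivrMr // (le_trans (e_lip v y2 y1)) //.
  by rewrite addrAC subrr add0r normrZ (gtr0_norm (t0 n)) [t n * _]mulrC mulrA.
have qK v : `|q h v| <= K * `|h| by exact: clarke_val_norm r0 _ _.
pose f n v := Num.max (Q n v) (q h v).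
have bf n : bounded_mfun (f n) by exact: bounded_mfun_max.
have fK n v : `|f n v| <= K * `|h|.
  by rewrite /f; case: (leP (Q n v) (q h v)).
have fq v : f ^~ v @ \oo --> q h v.
  apply/cvgrPdist_le => e1 e10.
  have [d1 d10 H] := clarke_val_quotient r0 (@e_lip v) h e10.
  have /cvgrPdist_lt/(_ _ d10) := @cvg_harmonic R; apply: filterS => n.
  rewrite sub0r normrN gtr0_norm ?invr_gt0 // => nd.
  have [yn /andP[_ tn] _] := badP n; move: yn tn; rewrite !lt_min => /andP[_ yn] /andP[_ tn].
  have Qle : Q n v <= q h v + e1.
    by apply: H; rewrite ?t0 /=; apply: lt_trans nd.
  rewrite /f; case: (leP (Q n v) (q h v)) => [_|gt]; first by rewrite subrr normr0 ltW.
  by rewrite distrC ger0_norm; lra.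
have [_ cf] := expect_cvg mu (fun n => (bf n).1) fK fq.
have : c <= \int[mu]_v q h v.
  apply: (cvgr_to_ge cf); apply: nearW => n.
  apply: (@le_trans _ _ (\int[mu]_v Q n v)).
    have [_ _ cn] := badP n; apply: (le_trans cn).
    rewrite (@eq_Rintegral _ _ _ mu setT (fun v => (t n)^-1 *
      (e (y n + t n *: h) v - e (y n) v))); last by move=> v _; rewrite mulrC.
    by rewrite expectZ ?expectB // 1?mulrC //; exact: bounded_mfunB.
  by apply: le_expect => // v; rewrite le_max lexx.
by rewrite leNgt c1.
Qed.

Lemma clarke_val_expect h : clarke_val phi ubar h = \int[mu]_v q h v.
Proof. by apply/eqP; rewrite eq_le clarke_val_expect_le clarke_val_expect_ge. Qed.

End ClarkeExpectation.

(** * Hahn-Banach *)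

Section HahnBanach.
Context (R : realType) (V : lmodType R) (B : set V).
Hypothesis B0 : B 0.
Hypothesis B_lin : forall (a : R) x y, B x -> B y -> B (a *: x + y).
Implicit Types (q : V -> R) (x y : V).

(** [B] acts as a subspace kept as a predicate. Homogeneity is asked as an inequality, easier to
    check for infima; [sublinearZ] recovers equality through [t^-1]. *)
Definition sublinear_on q :=
  (forall x y, B x -> B y -> q (x + y) <= q x + q y) /\
  (forall (t : R) x, 0 < t -> B x -> q (t *: x) <= t * q x).

Let BD x y : B x -> B y -> B (x + y).
Proof. by move=> Bx By; rewrite -[x]scale1r; exact: B_lin. Qed.

Let BZ (a : R) x : B x -> B (a *: x).
Proof. by move=> Bx; rewrite -[_ *: _]addr0; exact: B_lin. Qed.

Let BN x : B x -> B (- x).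
Proof. by rewrite -scaleN1r; exact: BZ. Qed.

Lemma sublinearZ q (t : R) x : sublinear_on q -> 0 < t -> B x -> q (t *: x) = t * q x.
Proof.
move=> [_ qZ] t0 Bx; apply/eqP; rewrite eq_le qZ //=.
have ti : 0 < t^-1 by rewrite invr_gt0.
have := qZ _ _ ti (BZ t Bx).
by rewrite scalerA mulVf ?gt_eqF // scale1r mulrC ler_pdivlMr // mulrC.
Qed.

Lemma sublinear0 q : sublinear_on q -> q 0 = 0.
Proof.
move=> sq; have := sublinearZ sq (ltr0Sn R 1) B0; rewrite scaler0 => e; lra.
Qed.

Lemma sublinear_opp q x : sublinear_on q -> B x -> - q (- x) <= q x.
Proof.
move=> sq Bx; have := sq.1 x (- x) Bx (BN Bx).
by rewrite subrr (sublinear0 sq); lra.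
Qed.

Lemma inf_le_add (A C D : set R) : has_lbound A -> has_inf C -> has_inf D ->
  (forall c e, C c -> D e -> exists2 a, A a & a <= c + e) -> inf A <= inf C + inf D.
Proof.
move=> lA [C0 _] [D0 _] H; rewrite -lerBlDr; apply: lb_le_inf => // c Cc.
rewrite lerBlDr -lerBlDl; apply: lb_le_inf => // e De.
have [a Aa ae] := H c e Cc De.
by rewrite lerBlDl (le_trans _ ae) //; exact: ge_inf.
Qed.

Lemma inf_le_scale (A C : set R) (t : R) : 0 < t -> has_lbound A -> has_inf C ->
  (forall c, C c -> exists2 a, A a & a <= t * c) -> inf A <= t * inf C.
Proof.
move=> t0 lA [C0 _] H; rewrite -ler_pdivrMl //; apply: lb_le_inf => // c Cc.
have [a Aa ae] := H c Cc.
by rewrite ler_pdivrMl // (le_trans _ ae) //; exact: ge_inf.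
Qed.

Variable p : V -> R.
Hypothesis p_sub : sublinear_on p.

Let S := {q : V -> R | sublinear_on q /\ forall x, B x -> q x <= p x}.
Let ge_on (q1 q2 : S) : Prop := forall x, B x -> sval q2 x <= sval q1 x.

Let lower (q : S) x : B x -> - p (- x) <= sval q x.
Proof.
move=> Bx; case: q => q [sq qp] /=.
by rewrite (le_trans _ (sublinear_opp sq Bx)) // lerN2 qp //; exact: BN.
Qed.

(** The pointwise infimum is bounded below by [- p (- x)], and it is subadditive because of two
    members of a chain the smaller serves at both points. *)
Let chain_bound (A : set S) : total_on A ge_on -> exists t, forall s, A s -> ge_on s t.
Proof.
move=> tA; have [[q0 Aq0]|noA] := pselect (A !=set0); last first.
  by exists (exist _ p (conj p_sub (fun x _ => lexx _))) => s As; exfalso; apply: noA; exists s.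
pose E x := [set sval q x | q in A].
have En x : E x !=set0 by exists (sval q0 x); exists q0.
have El x : B x -> has_lbound (E x).
  by move=> Bx; exists (- p (- x)) => _ [q _ <-]; exact: lower.
have Ei x : B x -> has_inf (E x) by move=> Bx; split => //; exact: El.
pose qi x := inf (E x).
have sqi : sublinear_on qi /\ forall x, B x -> qi x <= p x.
  split; [split|].
  - move=> x y Bx By; apply: inf_le_add; [exact/El/BD|exact: Ei|exact: Ei|].
    move=> _ _ [q1 A1 <-] [q2 A2 <-].
    have [le12|le21] := tA _ _ A1 A2.
      exists (sval q2 (x + y)); first by exists q2.
      by rewrite (le_trans ((svalP q2).1.1 x y Bx By)) // lerD2r le12.
    exists (sval q1 (x + y)); first by exists q1.
    by rewrite (le_trans ((svalP q1).1.1 x y Bx By)) // lerD2l le21.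
  - move=> t x t0 Bx; apply: inf_le_scale => //; [exact/El/BZ|exact: Ei|].
    move=> _ [q Aq <-]; exists (sval q (t *: x)); first by exists q.
    exact: (svalP q).1.2.
  - move=> x Bx; apply: (@le_trans _ _ (sval q0 x)); last exact: (svalP q0).2.
    by apply: ge_inf; [exact: El|exists q0].
exists (exist _ qi sqi) => q Aq x Bx /=.
by apply: ge_inf; [exact: El|exists q].
Qed.

(** Lowering [q] along [h] to the infimum over [0 <= t] of [q (y + t *: h) - t * q h] keeps it
    sublinear. By minimality nothing is lowered, and [t = 1] gives superadditivity. *)
Lemma minimal_additive (q : S) : (forall s, ge_on q s -> ge_on s q) ->
  forall x y, B x -> B y -> sval q x + sval q y <= sval q (x + y).
Proof.
case: q => q [sq qp] min x h Bx Bh /=.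
pose E y := [set q (y + t *: h) - t * q h | t in [set t : R | 0 <= t]].
have En y : E y !=set0.
  by exists (q (y + 0 *: h) - 0 * q h); exists 0 => /=.
have Bt y (t : R) : B y -> B (y + t *: h) by move=> By; apply: BD => //; exact: BZ.
have El y : B y -> has_lbound (E y).
  move=> By; exists (- q (- y)) => _ [t /= t0 <-].
  have := sq.1 _ _ (Bt y t By) (BN By); rewrite addrAC subrr add0r.
  have -> : q (t *: h) = t * q h.
    move: t0; rewrite le_eqVlt => /predU1P[<-|t0]; last exact: sublinearZ.
    by rewrite scale0r mul0r (sublinear0 sq).
  lra.
have Ei y : B y -> has_inf (E y) by move=> By; split => //; exact: El.
pose q' y := inf (E y).
have q'q y : B y -> q' y <= q y.
  move=> By; apply: ge_inf; first exact: El.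
  by exists 0 => //=; rewrite scale0r addr0 mul0r subr0.
have sq' : sublinear_on q' /\ forall y, B y -> q' y <= p y.
  split; [split|].
  - move=> y z By Bz; apply: inf_le_add; [exact/El/BD|exact: Ei|exact: Ei|].
    move=> _ _ [t /= t0 <-] [s /= s0 <-].
    exists (q (y + z + (t + s) *: h) - (t + s) * q h); first by exists (t + s) => //=; exact: addr_ge0.
    have := sq.1 _ _ (Bt y t By) (Bt z s Bz).
    rewrite scalerDl addrACA; lra.
  - move=> l y l0 By; apply: inf_le_scale => //; [exact/El/BZ|exact: Ei|].
    move=> _ [t /= t0 <-].
    exists (q (l *: y + (l * t) *: h) - (l * t) * q h).
      by exists (l * t) => //=; rewrite mulr_ge0 // ltW.
    have := sq.2 l _ l0 (Bt y t By); rewrite scalerDr scalerA mulrBr; lra.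
  - by move=> y By; rewrite (le_trans (q'q y By)) // qp.
have /= H := min (exist _ q' sq') (fun y By => q'q y By) x Bx.
have q'1 : q' x <= q (x + h) - q h.
  by apply: ge_inf; [exact: El|exists 1 => /=; rewrite ?ler01 // scale1r mul1r].
rewrite /= in H; lra.
Qed.

Lemma hahn_banach : exists Lam : V -> R,
  (forall (a : R) x y, B x -> B y -> Lam (a *: x + y) = a * Lam x + Lam y) /\
  forall x, B x -> Lam x <= p x.
Proof.
have refl_on (q : S) : `[< ge_on q q >] by apply/asboolP => x _.
have trans_on (q1 q2 q3 : S) : `[< ge_on q1 q2 >] -> `[< ge_on q2 q3 >] -> `[< ge_on q1 q3 >].
  move=> /asboolP h1 /asboolP h2; apply/asboolP => x Bx.
  by rewrite (le_trans (h2 x Bx)) // h1.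
have chains (A : set S) : total_on A (fun q1 q2 : S => `[< ge_on q1 q2 >]) ->
    exists t, forall s, A s -> `[< ge_on s t >].
  move=> tA; have [|t Ht] := @chain_bound A.
    by move=> s t As At; case: (tA s t As At) => /asboolP; [left|right].
  by exists t => s As; apply/asboolP; exact: Ht.
have [q min'] := ZL_preorder (exist _ p (conj p_sub (fun x _ => lexx _)) : S) refl_on trans_on chains.
have min s : ge_on q s -> ge_on s q.
  by move=> qs; apply/asboolP; apply: min'; exact/asboolP.
have add x y : B x -> B y -> sval q (x + y) = sval q x + sval q y.
  move=> Bx By; apply/eqP; rewrite eq_le minimal_additive // andbT.
  exact: (svalP q).1.1.
have sq := (svalP q).1.
have opp x : B x -> sval q (- x) = - sval q x.
  by move=> Bx; have := add x (- x) Bx (BN Bx); rewrite subrr (sublinear0 sq); lra.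
exists (sval q); split; last exact: (svalP q).2.
move=> a x y Bx By; rewrite add //; last exact: BZ.
congr (_ + _); have [a0|a0|->] := ltgtP a 0.
- have na : 0 < - a by rewrite oppr_gt0.
  rewrite -[a *: x]opprK -scaleNr opp; last exact: BZ.
  by rewrite (sublinearZ sq na Bx) mulNr opprK.
- exact: sublinearZ.
- by rewrite scale0r mul0r (sublinear0 sq).
Qed.

End HahnBanach.

(** * Extension from a countable rational subspace *)

Section RationalExtension.
Context (R : realType) (U : normedModType R) (iota : nat -> U) (idx : U -> nat -> nat).
Hypothesis idxP : forall h n, `|iota (idx h n) - h| < n.+1%:R^-1.
Hypothesis iota_lin : forall (q : rat) i j, exists k, iota k = ratr q *: iota i + iota j.
Variables (s : nat -> R) (K : R).
Hypothesis K0 : 0 <= K.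
Hypothesis s_lin : forall (q : rat) i j k,
  iota k = ratr q *: iota i + iota j -> s k = ratr q * s i + s j.
Hypothesis s_norm : forall i, `|s i| <= K * `|iota i|.

Definition rational_extension (h : U) : R := limn (fun n => s (idx h n)).

Let s_lip i j : `|s i - s j| <= K * `|iota i - iota j|.
Proof.
have [k kE] := iota_lin (-1) j i.
have := s_lin kE; rewrite rmorphN1 mulN1r addrC => <-.
by have := s_norm k; rewrite kE rmorphN1 scaleN1r addrC.
Qed.

Lemma cvg_iota_idx h : (fun n => iota (idx h n)) @ \oo --> h.
Proof.
apply/cvgrPdist_lt => e e0; have /cvgrPdist_lt/(_ _ e0) := @cvg_harmonic R.
apply: filterS => n; rewrite sub0r normrN gtr0_norm ?invr_gt0 // => ne.
by rewrite distrC (lt_trans (idxP h n)).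
Qed.

(** Independence of the approximating sequence. Linearity rests on it: combinations of the
    approximants of [u] and [v] converge to [a *: u + v] but are not the approximants chosen by
    [idx]. *)
Lemma cvg_rational_extension (k : nat -> nat) h : (fun n => iota (k n)) @ \oo --> h ->
  (fun n => s (k n)) @ \oo --> rational_extension h.
Proof.
have cauchy (a b : nat -> nat) : (fun n => iota (a n)) @ \oo --> h ->
    (fun n => iota (b n)) @ \oo --> h -> (fun n => s (a n) - s (b n)) @ \oo --> 0.
  move=> ca cb; apply/cvgrPdist_le => e e0.
  have k0 : 0 < K + 1 by rewrite ltr_wpDl.
  have : (fun n => iota (a n) - iota (b n)) @ \oo --> h - h by exact: cvgB.
  rewrite subrr => /cvgrPdist_lt/(_ (e / (K + 1)) (divr_gt0 e0 k0)).
  apply: filterS => n; rewrite !sub0r !normrN ltr_pdivlMr // => ab.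
  rewrite (le_trans (s_lip _ _)) // (le_trans _ (ltW ab)) //.
  by rewrite mulrC ler_wpM2l // lerDl.
have cv : cvgn (fun n => s (idx h n)).
  apply: cauchy_cvg; apply: cauchy_exP => e e0.
  have k0 : 0 < 2 * K + 1 by rewrite ltr_wpDl // mulr_ge0.
  have /cvgrPdist_lt/(_ (e / (2 * K + 1)) (divr_gt0 e0 k0))[N _ HN] := @cvg_harmonic R.
  exists (s (idx h N)); exists N => // n /= Nn; rewrite -ball_normE /=.
  rewrite (le_lt_trans (s_lip _ _)) //.
  have dN : `|iota (idx h N) - h| < e / (2 * K + 1).
    rewrite (lt_trans (idxP h N)) //; have := HN N (leqnn N).
    by rewrite sub0r normrN gtr0_norm ?invr_gt0.
  have dn : `|iota (idx h n) - h| < e / (2 * K + 1).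
    rewrite (lt_trans (idxP h n)) //; have := HN n Nn.
    by rewrite sub0r normrN gtr0_norm ?invr_gt0.
  have tri : `|iota (idx h N) - iota (idx h n)| <= 2 * (e / (2 * K + 1)).
    rewrite -(subrKA h) (le_trans (ler_normD _ _)) // mulr2n mulrDl mul1r lerD //; first exact: ltW.
    by rewrite distrC ltW.
  rewrite (le_lt_trans (ler_wpM2l K0 tri)) //.
  rewrite (_ : K * _ = (2 * K) * e / (2 * K + 1)); last by ring.
  rewrite ltr_pdivrMr //.
  by rewrite mulrC ltr_pM2l // ltrDl.
move=> ck; have -> : (fun n => s (k n)) = (fun n => (s (k n) - s (idx h n)) + s (idx h n)).
  by apply/funext => n; rewrite subrK.
by rewrite -[rational_extension h]add0r; apply: cvgD => //; exact: (cauchy _ _ ck (@cvg_iota_idx h)).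
Qed.

Lemma rational_extension_linear (a : R) u v :
  rational_extension (a *: u + v) = a * rational_extension u + rational_extension v.
Proof.
have qP (n : nat) : {q : rat | `|ratr q - a| < n.+1%:R^-1}.
  have h : a - n.+1%:R^-1 < a + n.+1%:R^-1 :> R by rewrite ltrD2l gtrN.
  apply: cid; have [q] := rat_in_itvoo h; rewrite in_itv /= => /andP[q1 q2].
  by exists q; rewrite ltr_distl q1 q2.
pose q n : rat := sval (qP n).
have cq : (fun n => ratr (q n) : R) @ \oo --> a.
  apply/cvgrPdist_lt => e e0; have /cvgrPdist_lt/(_ _ e0) := @cvg_harmonic R.
  apply: filterS => n; rewrite sub0r normrN gtr0_norm ?invr_gt0 // => ne.
  by rewrite distrC (lt_trans (svalP (qP n))).
have kP n := cid (iota_lin (q n) (idx u n) (idx v n)).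
pose k n := sval (kP n).
have ck : (fun n => iota (k n)) @ \oo --> a *: u + v.
  have -> : (fun n => iota (k n)) = (fun n => ratr (q n) *: iota (idx u n) + iota (idx v n)).
    by apply/funext => n; exact: (svalP (kP n)).
  by apply: cvgD; [apply: cvgZ => //; exact: cvg_iota_idx|exact: cvg_iota_idx].
have c1 := cvg_rational_extension ck.
have c2 : (fun n => ratr (q n) * s (idx u n) + s (idx v n)) @ \oo -->
    a * rational_extension u + rational_extension v.
  apply: cvgD; first apply: cvgM => //; apply: cvg_rational_extension; exact: cvg_iota_idx.
have e : (fun n => s (k n)) = (fun n => ratr (q n) * s (idx u n) + s (idx v n)).
  by apply/funext => n; apply: s_lin; exact: (svalP (kP n)).
by rewrite e in c1; exact: (cvg_unique _ c1 c2).
Qed.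

Lemma rational_extension_le (p : U -> R) h :
  (forall u v, `|p u - p v| <= K * `|u - v|) ->
  (forall i, s i <= p (iota i)) -> rational_extension h <= p h.
Proof.
move=> pK sp; have c1 := cvg_rational_extension (@cvg_iota_idx h).
have c2 : (fun n => p (iota (idx h n))) @ \oo --> p h.
  apply/cvgrPdist_le => e e0; have k0 : 0 < K + 1 by rewrite ltr_wpDl.
  have /cvgrPdist_lt/(_ (e / (K + 1)) (divr_gt0 e0 k0)) := @cvg_iota_idx h.
  apply: filterS => n; rewrite ltr_pdivlMr // => ab.
  rewrite (le_trans (pK _ _)) // (le_trans _ (ltW ab)) //.
  by rewrite mulrC ler_wpM2l // lerDl.
by apply: (ler_cvg_to c1 c2); apply: nearW => n.
Qed.

Lemma rational_extension_norm h : `|rational_extension h| <= K * `|h|.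
Proof.
have c1 := cvg_rational_extension (@cvg_iota_idx h).
have c2 : (fun n => `|s (idx h n)|) @ \oo --> `|rational_extension h| by exact: cvg_norm.
have c3 : (fun n => K * `|iota (idx h n)|) @ \oo --> K * `|h|.
  by apply: cvgM; [exact: cvg_cst|apply: cvg_norm; exact: cvg_iota_idx].
by apply: (ler_cvg_to c2 c3); apply: nearW => n; exact: s_norm.
Qed.

End RationalExtension.

(** * Disintegration of dominated functionals *)

Section Strassen.
Context d (T : measurableType d) (R : realType) (mu : probability T R).
Context (U : normedModType R) (p : T -> U -> R) (K : R) (x : U -> R).
Hypothesis K0 : 0 <= K.
Hypothesis p_norm : forall v h, `|p v h| <= K * `|h|.
Hypothesis p_subadd : forall v h1 h2, p v (h1 + h2) <= p v h1 + p v h2.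
Hypothesis p_scale : forall v (t : R) h, 0 < t -> p v (t *: h) <= t * p v h.
Hypothesis p_bounded : forall h, bounded_mfun (p^~ h).
Hypothesis x_lin : forall (a : R) u v, x (a *: u + v) = a * x u + x v.
Hypothesis x_le : forall h, x h <= \int[mu]_v p v h.

Lemma p_lipschitz v h1 h2 : `|p v h1 - p v h2| <= K * `|h1 - h2|.
Proof.
have half a b : p v a - p v b <= K * `|a - b|.
  have := p_subadd v b (a - b); rewrite addrC subrK => h.
  by have := le_trans (ler_norm _) (p_norm v (a - b)); lra.
by rewrite ler_norml lerNl opprB {1}[`|h1 - h2|]distrC !half.
Qed.

Let p0 v : p v 0 <= 0.
Proof. by have := le_trans (ler_norm _) (p_norm v 0); rewrite normr0 mulr0. Qed.

Let x0 : x 0 = 0.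
Proof. by have := x_lin 1 0 0; rewrite scaler0 addr0 mul1r; lra. Qed.

Let xD u v : x (u + v) = x u + x v.
Proof. by have := x_lin 1 u v; rewrite scale1r mul1r. Qed.

Let xZ a u : x (a *: u) = a * x u.
Proof. by have := x_lin a u 0; rewrite x0 !addr0. Qed.

Let xN u : x (- u) = - x u.
Proof. by rewrite -scaleN1r xZ mulN1r. Qed.

Let x_norm h : `|x h| <= K * `|h|.
Proof.
have half a : x a <= K * `|a|.
  rewrite (le_trans (x_le a)) // (le_trans (ler_norm _)) //.
  by apply: le_norm_expect => // v; exact: p_norm.
by rewrite ler_norml lerNl -xN half -normrN half.
Qed.

(** Fields may be nonmeasurable, so the integral of [p] along a field is replaced by an infimum over
    bounded measurable majorants. *)
Definition bounded_field : set (T -> U) := [set psi | exists C : R, forall v, `|psi v| <= C].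

Let B0 : bounded_field 0.
Proof. by exists 0 => v; rewrite normr0. Qed.

Let B_lin (a : R) psi1 psi2 : bounded_field psi1 -> bounded_field psi2 ->
  bounded_field (a *: psi1 + psi2).
Proof.
move=> [C1 H1] [C2 H2]; exists (`|a| * C1 + C2) => v.
rewrite (le_trans (ler_normD _ _)) // lerD //.
by rewrite [(a *: psi1) v]/(a *: psi1 v) normrZ ler_wpM2l.
Qed.

(* Upper integral of [p] along a bounded field, penalised so that it is already below [x] on constant fields. *)
Definition upper_values (psi : T -> U) : set R := [set z | exists (c : U) (k : T -> R),
  [/\ bounded_mfun k, forall v, p v (psi v + c) <= k v & z = \int[mu]_v k v - x c]].

Definition upper_integral psi := inf (upper_values psi).

(** The infimum is finite because [x] lies below the integral of [p]: from
    [p v c <= p v (psi v + c) + p v (- psi v)], each value is at least [- (K * C)]. *)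
Let upper_inf psi : bounded_field psi -> has_inf (upper_values psi).
Proof.
move=> [C HC]; split.
  exists (\int[mu]_v (K * C) - x 0), 0, (fun=> K * C); split => //.
    exact: bounded_mfun_cst.
  move=> v; rewrite addr0 (le_trans (ler_norm _)) // (le_trans (p_norm v _)) //.
  by rewrite ler_wpM2l.
exists (- (K * C)) => _ [c [k [bk pk ->]]].
have : \int[mu]_v (p v c - K * C) <= \int[mu]_v k v.
  apply: le_expect => //; first by apply: bounded_mfunB => //; exact: bounded_mfun_cst.
  move=> v; rewrite (le_trans _ (pk v)) //.
  have := p_subadd v (psi v + c) (- psi v); rewrite addrAC subrr add0r.
  have : p v (- psi v) <= K * C.
    rewrite (le_trans (ler_norm _)) // (le_trans (p_norm v _)) // normrN.
    by rewrite ler_wpM2l.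
  lra.
rewrite expectB //; last exact: bounded_mfun_cst.
by rewrite expect_cst; have := x_le c; lra.
Qed.

Let upper_sublinear : sublinear_on bounded_field upper_integral.
Proof.
have BD psi1 psi2 : bounded_field psi1 -> bounded_field psi2 -> bounded_field (psi1 + psi2).
  by move=> b1 b2; rewrite -[psi1]scale1r; exact: B_lin.
have BZ (a : R) psi : bounded_field psi -> bounded_field (a *: psi).
  by move=> b1; rewrite -[_ *: _]addr0; exact: B_lin.
split.
  move=> psi1 psi2 b1 b2.
  apply: inf_le_add; [exact: (upper_inf (BD _ _ b1 b2)).2|exact: upper_inf|exact: upper_inf|].
  move=> _ _ [c1 [k1 [bk1 pk1 ->]]] [c2 [k2 [bk2 pk2 ->]]].
  exists (\int[mu]_v (k1 v + k2 v) - x (c1 + c2)).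
    exists (c1 + c2), (fun v => k1 v + k2 v); split => //; first exact: bounded_mfunD.
    move=> v; rewrite [(psi1 + psi2) v]/(psi1 v + psi2 v) addrACA.
    by rewrite (le_trans (p_subadd _ _ _)) // lerD.
  by rewrite expectD // xD; lra.
move=> t psi t0 b; apply: inf_le_scale => //; [exact: (upper_inf (BZ t _ b)).2|exact: upper_inf|].
move=> _ [c [k [bk pk ->]]].
exists (\int[mu]_v (t * k v) - x (t *: c)).
  exists (t *: c), (fun v => t * k v); split => //; first exact: bounded_mfunZ.
  move=> v; rewrite [(t *: psi) v]/(t *: psi v) -scalerDr.
  by rewrite (le_trans (p_scale _ _ t0)) // ler_pM2l.
by rewrite expectZ // xZ mulrBr.
Qed.

Definition step_field (A : set T) (h : U) : T -> U := fun v => (\1_A v : R) *: h.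

Let step_bounded A h : bounded_field (step_field A h).
Proof.
exists `|h| => v; rewrite /step_field normrZ indicE.
by case: (_ \in _); rewrite ?normr1 ?normr0 ?mul1r ?mul0r.
Qed.

Definition vector_charge_spec (lam : U -> set T -> R) :=
  [/\ forall (a : R) u w A, lam (a *: u + w) A = a * lam u A + lam w A,
      forall u A C, [disjoint A & C] -> lam u (A `|` C) = lam u A + lam u C,
      forall u A, measurable A -> lam u A <= \int[mu]_v (\1_A v * p v u)
    & forall u, lam u setT = x u].

Lemma exists_vector_charge : exists lam, vector_charge_spec lam.
Proof.
have [Lam [Lam_lin Lam_le]] := hahn_banach B0 B_lin upper_sublinear.
have upper_le psi c k : bounded_field psi -> bounded_mfun k ->
    (forall v, p v (psi v + c) <= k v) -> Lam psi <= \int[mu]_v k v - x c.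
  move=> b bk pk; rewrite (le_trans (Lam_le psi b)) //.
  by apply: ge_inf; [exact: (upper_inf b).2|exists c, k].
exists (fun u A => Lam (step_field A u)); split.
- move=> a u w A; rewrite -Lam_lin //; congr Lam; apply/funext => v.
  transitivity (a *: ((\1_A v : R) *: u) + (\1_A v : R) *: w); last by [].
  by rewrite /step_field scalerDr !scalerA mulrC.
- move=> u A C AC; have := Lam_lin 1 _ _ (step_bounded A u) (step_bounded C u).
  rewrite mul1r => <-; congr Lam; apply/funext => v.
  transitivity (1 *: ((\1_A v : R) *: u) + (\1_C v : R) *: u); last by [].
  rewrite scale1r -scalerDl /step_field; congr (_ *: _); rewrite !indicE in_setU; move/disj_setPS: AC => AC.
  have [vA|] := boolP (v \in A); have [vC|] := boolP (v \in C); rewrite ?addr0 ?add0r //.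
  by exfalso; apply: (AC v); split; [rewrite inE in vA|rewrite inE in vC].
- move=> u A mA; have := upper_le (step_field A u) 0 (fun v => \1_A v * p v u).
  rewrite x0 subr0; apply => //.
    by apply: bounded_mfunM => //; exact: bounded_mfun_indic.
  move=> v; rewrite addr0 /step_field indicE; case: (_ \in _).
    by rewrite scale1r mul1r.
  by rewrite scale0r mul0r.
- move=> u; have le w : Lam (step_field setT w) <= x w.
    (* The shift [- w] turns the constant field into 0, for which 0 is a majorant; this gives one
       inequality, and [- u] the other. *)
    have := upper_le (step_field setT w) (- w) (fun=> 0) (step_bounded _ _) (bounded_mfun_cst _ 0).
    rewrite expect_cst xN opprK add0r; apply => v.
    by rewrite /step_field indicE in_setT scale1r subrr.
  apply/eqP; rewrite eq_le le /=.
  have := Lam_lin (-1) _ _ (step_bounded setT u) B0.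
  have L0 : Lam 0 = 0.
    by have := Lam_lin 1 0 0 B0 B0; rewrite scaler0 addr0 mul1r; lra.
  rewrite L0 !addr0 mulN1r => e; have := le (- u); rewrite xN.
  have -> : step_field setT (- u) = -1 *: step_field setT u.
    apply/funext => v; transitivity ((-1 : R) *: ((\1_setT v : R) *: u)); last by [].
    by rewrite scaleN1r /step_field scalerN.
  by rewrite e lerN2.
Qed.

End Strassen.

(** * Densities of dominated set functions *)

Section DensityTools.
Context d (T : measurableType d) (R : realType) (mu : probability T R).

Lemma ae_le_of_integral (f g : T -> R) : mu.-integrable setT (EFin \o f) ->
  mu.-integrable setT (EFin \o g) ->
  (forall A, measurable A -> \int[mu]_(v in A) f v <= \int[mu]_(v in A) g v) ->
  {ae mu, forall v, f v <= g v}.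
Proof.
move=> fi gi fg.
have mf : measurable_fun setT f by apply/measurable_EFinP; exact: measurable_int fi.
have mg : measurable_fun setT g by apply/measurable_EFinP; exact: measurable_int gi.
pose E := [set v | g v < f v]; have mE : measurable E by exact: measurable_set_lt.
have fiE : mu.-integrable E (EFin \o f) by apply: integrableS fi.
have giE : mu.-integrable E (EFin \o g) by apply: integrableS gi.
have hi : mu.-integrable E (EFin \o (fun v => f v - g v)) by exact: real_integrableB.
have int0 : (\int[mu]_(v in E) `|(f v - g v)%:E| = 0)%E.
  rewrite (eq_integral (fun v => (f v - g v)%:E)); last first.
    move=> v; rewrite inE /E /= => vE; rewrite ger0_norm // subr_ge0; exact: ltW.
  apply/eqP; rewrite eq_le; apply/andP; split; last first.
    by apply: integral_ge0 => v vE; rewrite lee_fin subr_ge0; exact: ltW.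
  rewrite -[leLHS]fineK; last exact: integrable_fin_num.
  rewrite lee_fin -/(Rintegral mu E (fun v => f v - g v)) RintegralB // subr_le0.
  exact: fg.
have := (ae_eq_integral_abs mu mE (measurable_int mu hi)).1 int0.
apply: filterS => v /= H; rewrite leNgt; apply/negP => gf.
by have [] := H gf => /eqP; rewrite subr_eq0 gt_eqF.
Qed.

Section Charge.
Variables (lam : set T -> R) (C : R).
Hypothesis lam_add : forall A B, [disjoint A & B] -> lam (A `|` B) = lam A + lam B.
Hypothesis lam_le : forall A, measurable A -> `|lam A| <= C * fine (mu A).

Let nu (A : set T) : \bar R := (lam A)%:E.

Let lam0 : lam set0 = 0.
Proof.
have := @lam_add set0 set0; rewrite setU0 => /(_ _) h.
have : lam set0 = lam set0 + lam set0 by apply: h; rewrite disj_set2E set0I.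
lra.
Qed.

Let nu0 : nu set0 = 0%E. Proof. by rewrite /nu lam0. Qed.

Let nu_fin A : measurable A -> nu A \is a fin_num. Proof. by []. Qed.

(** Finite additivity leaves the value on the tail of the union. The tails decrease to the empty
    set, so their [mu]-measure, which dominates [lam], tends to 0. *)
Let nu_additive : semi_sigma_additive nu.
Proof.
move=> F mF tF mUF; pose rest n := \bigcup_(i in [set i | (n <= i)%N]) F i.
have mrest n : measurable (rest n) by apply: bigcup_measurable.
have restS n : rest n = F n `|` rest n.+1.
  apply/seteqP; split => v.
    move=> [i /= ni Fi]; move: ni; rewrite leq_eqVlt => /predU1P[->|ni]; first by left.
    by right; exists i.
  move=> [Fn|[i /= ni Fi]]; first by exists n => /=.
  by exists i => //=; exact: ltnW.
have djn n : [disjoint F n & rest n.+1].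
  apply/disj_setPS => v [Fn [i /= ni Fi]].
  have e : n = i by apply: (tF n i I I); exists v.
  by rewrite -e ltnn in ni.
have sum_rest n : lam (\bigcup_i F i) = \sum_(0 <= i < n) lam (F i) + lam (rest n).
  elim: n => [|n ih].
    rewrite big_geq // add0r; congr lam; rewrite /rest.
    by apply/seteqP; split => v [i _ Fi]; exists i.
  by rewrite big_nat_recr //= -addrA -lam_add // -restS.
have cap0 : \bigcap_n rest n = set0.
  apply/seteqP; split => // v H; have [i _ Fi] := H 0%N I.
  have [j /= ij Fj] := H i.+1 I; have e : i = j by apply: (tF i j I I); exists v.
  by rewrite -e ltnn in ij.
have mu_rest : (fun n => fine (mu (rest n))) @ \oo --> (0 : R).
  have := @nonincreasing_cvg_mu _ _ _ mu rest; rewrite cap0 measure0.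
  have -> : (0 : \bar R)%E = (0 : R)%:E by [].
  move=> H; apply: fine_cvg; apply: H => //.
  - by rewrite (le_lt_trans (probability_le1 _ _)) ?ltry.
  - move=> a b ab; apply/subsetPset => v [i /= bi Fi]; exists i => //=.
    exact: leq_trans bi.
rewrite /nu (_ : (fun n => _) = (fun n => (\sum_(0 <= i < n) lam (F i))%:E)); last first.
  by apply/funext => n; rewrite sumEFin.
apply: cvg_EFin; first exact: nearW.
apply/cvgrPdist_le => e e0; have c0 : 0 < `|C| + 1 by rewrite ltr_wpDl.
have /cvgrPdist_le/(_ (e / (`|C| + 1)) (divr_gt0 e0 c0)) := mu_rest.
apply: filterS => n; rewrite sub0r normrN /= (sum_rest n) addrAC subrr add0r => h.
rewrite (le_trans (lam_le (mrest n))) //.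
rewrite ger0_norm ?fine_ge0 // ler_pdivlMr // mulrC in h.
rewrite (le_trans _ h) // ler_wpM2r ?fine_ge0 //.
by rewrite (le_trans (ler_norm C)) // lerDl.
Qed.

HB.instance Definition _ := isCharge.Build _ _ _ nu nu0 nu_fin nu_additive.

Lemma bounded_charge_density : exists f : T -> R,
  [/\ measurable_fun setT f, mu.-integrable setT (EFin \o f)
    & forall A, measurable A -> \int[mu]_(v in A) f v = lam A].
Proof.
have dom : nu `<< mu.
  apply/null_content_dominatesP => A mA A0.
  have := lam_le mA; rewrite A0 /= mulr0 normr_le0 => /eqP h.
  by rewrite /nu h.
pose nuc : {charge set T -> \bar R} := nu.
have [f [ffin fi fE]] : exists f : T -> \bar R, [/\ (forall v, f v \is a fin_num),
    mu.-integrable setT f & forall A, measurable A -> nu A = (\int[mu]_(v in A) f v)%E].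
  exists (Radon_Nikodym nuc mu); split.
  - by move=> v; exact: Radon_Nikodym_fin_num.
  - exact: Radon_Nikodym_integrable.
  - by move=> A mA; exact: (@Radon_Nikodym_integral _ _ _ nuc).
have eE : EFin \o (fine \o f) = f by apply/funext => v /=; rewrite fineK.
exists (fine \o f); rewrite eE; split => //.
  by apply/measurable_EFinP; rewrite eE; exact: measurable_int fi.
move=> A mA; rewrite /Rintegral (eq_integral f) -?fE // => v _ /=; by rewrite fineK.
Qed.

End Charge.
End DensityTools.

(** Finite rational combinations of a countable dense set, coded as lists of pairs of a coefficient
    and a point number; concatenating codes adds vectors. Invalid codes stand for the empty sum. *)
Lemma rational_dense_enumeration (R : realType) (U : normedModType R) :
  separable_space U -> exists (iota : nat -> U) (idx : U -> nat -> nat),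
    (forall h n, `|iota (idx h n) - h| < n.+1%:R^-1) /\
    (forall (q : rat) i j, exists k, iota k = ratr q *: iota i + iota j).
Proof.
move=> [D [/countable_injP[f finj] dD]].
pose pt n : U := xget 0 [set u | D u /\ f u = n].
have ptf u : D u -> pt (f u) = u.
  move=> Du; rewrite /pt; case: xgetP => [y _ [Dy fy]|/(_ u)]; last by case.
  by apply: finj => //; rewrite inE.
pose comb (l : seq (rat * nat)) : U := \sum_(z <- l) ratr z.1 *: pt z.2.
pose code i : seq (rat * nat) := odflt [::] (unpickle i).
have codeK l : code (pickle l) = l by rewrite /code pickleK.
have idxP h n : {i : nat | `|comb (code i) - h| < n.+1%:R^-1}.
  apply: cid.
  have n0 : 0 < n.+1%:R^-1 :> R by rewrite invr_gt0.
  have [|u [bu Du]] := dD (ball h n.+1%:R^-1) _ (ball_open h _).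
    by exists h; exact: ballxx.
  exists (pickle [:: (1 : rat, f u)]); rewrite codeK /comb big_seq1 /= rmorph1 scale1r ptf //.
  by move: bu; rewrite -ball_normE /= distrC.
exists (comb \o code), (fun h n => sval (idxP h n)); split.
  by move=> h n; exact: (svalP (idxP h n)).
move=> q i j; exists (pickle ([seq (q * z.1, z.2) | z <- code i] ++ code j)).
rewrite /= codeK /comb big_cat big_map /= scaler_sumr; congr (_ + _).
by apply: eq_bigr => z _; rewrite scalerA rmorphM.
Qed.

(** * Measurable selection below a sublinear field *)

Section Selection.
Context d (T : measurableType d) (R : realType) (mu : probability T R).
Context (U : normedModType R) (p : T -> U -> R) (K : R) (x : U -> R).
Hypothesis U_sep : separable_space U.
Hypothesis K0 : 0 <= K.
Hypothesis p_norm : forall v h, `|p v h| <= K * `|h|.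
Hypothesis p_subadd : forall v h1 h2, p v (h1 + h2) <= p v h1 + p v h2.
Hypothesis p_scale : forall v (t : R) h, 0 < t -> p v (t *: h) <= t * p v h.
Hypothesis p_bounded : forall h, bounded_mfun (p^~ h).
Hypothesis x_lin : forall (a : R) u v, x (a *: u + v) = a * x u + x v.
Hypothesis x_le : forall h, x h <= \int[mu]_v p v h.

Let p_lip v h1 h2 : `|p v h1 - p v h2| <= K * `|h1 - h2|.
Proof. exact: p_lipschitz. Qed.

Lemma integral_indic_mul (A : set T) (f : T -> R) :
  \int[mu]_(v in A) f v = \int[mu]_v (\1_A v * f v).
Proof.
rewrite Rintegral_mkcond; apply: eq_Rintegral => v _; rewrite patchE indicE.
by case: (v \in A); rewrite ?mul1r ?mul0r.
Qed.

Lemma vector_charge_density (lam : U -> set T -> R) : vector_charge_spec mu p x lam ->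
  exists s : U -> T -> R, forall u, [/\ measurable_fun setT (s u),
    mu.-integrable setT (EFin \o s u)
    & forall A, measurable A -> \int[mu]_(v in A) s u v = lam u A].
Proof.
move=> [lam_lin lam_add lam_le _].
have lam0 A : lam 0 A = 0.
  by have := lam_lin 1 0 0 A; rewrite scaler0 addr0 mul1r; lra.
have lamN u A : lam (- u) A = - lam u A.
  by have := lam_lin (-1) u 0 A; rewrite scaleN1r lam0 !addr0 mulN1r.
have half u A : measurable A -> lam u A <= K * `|u| * fine (mu A).
  move=> mA; rewrite (le_trans (lam_le u A mA)) // -expect_indic //.
  have b1 : bounded_mfun (\1_A : T -> R) by exact: bounded_mfun_indic.
  rewrite -expectZ //; apply: le_expect.
  - exact: bounded_mfunM.
  - exact: bounded_mfunZ.
  - move=> v; rewrite [leLHS]mulrC; apply: ler_wpM2r; first by rewrite indicE.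
    exact: le_trans (ler_norm _) (p_norm v u).
have dens u : {f : T -> R | [/\ measurable_fun setT f, mu.-integrable setT (EFin \o f)
    & forall A, measurable A -> \int[mu]_(v in A) f v = lam u A]}.
  apply: cid; apply: (@bounded_charge_density _ _ _ mu _ (K * `|u|)) => [A C|A mA]; first exact: lam_add.
  by rewrite ler_norml lerNl -lamN half // -normrN half.
exists (fun u => sval (dens u)) => u; exact: (svalP (dens u)).
Qed.

(** Each density is determined only up to a null set depending on the vector. Linearity and
    domination are therefore imposed on countably many vectors, outside one null set, and passed on
    by continuity. *)
Lemma measurable_selection : exists s : T -> U -> R,
  [/\ forall h, measurable_fun setT (s^~ h),
      {ae mu, forall v, is_dual (s v) /\ forall h, s v h <= p v h}
    & forall h, mu.-integrable setT (EFin \o s^~ h) /\ x h = \int[mu]_v s v h].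
Proof.
have [iota [idx [idxP iota_lin]]] := rational_dense_enumeration U_sep.
have [lam lamP] := exists_vector_charge K0 p_norm p_subadd p_scale p_bounded x_lin x_le.
have [s0 s0P] := vector_charge_density lamP.
have [lam_lin lam_add lam_le lamT] := lamP.
have s0_lin (q : rat) i j k : iota k = ratr q *: iota i + iota j ->
    {ae mu, forall v, s0 (iota k) v = ratr q * s0 (iota i) v + s0 (iota j) v}.
  move=> kE; have [mk ik Ik] := s0P (iota k).
  have [mi ii Ii] := s0P (iota i); have [mj ij Ij] := s0P (iota j).
  have iZ := real_integrableZ measurableT (ratr q) ii.
  have iR := real_integrableD measurableT iZ ij.
  have IE A : measurable A -> \int[mu]_(v in A) s0 (iota k) v =
      \int[mu]_(v in A) (ratr q * s0 (iota i) v + s0 (iota j) v).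
    move=> mA; have iiA := integrableS measurableT mA (@subsetT _ A) ii.
    have ijA := integrableS measurableT mA (@subsetT _ A) ij.
    have iZA := integrableS measurableT mA (@subsetT _ A) iZ.
    by rewrite RintegralD // RintegralZl // Ii // Ij // Ik // kE lam_lin.
  have l1 : {ae mu, forall v, s0 (iota k) v <= ratr q * s0 (iota i) v + s0 (iota j) v}.
    by apply: ae_le_of_integral => // A mA; rewrite IE.
  have l2 : {ae mu, forall v, ratr q * s0 (iota i) v + s0 (iota j) v <= s0 (iota k) v}.
    by apply: ae_le_of_integral => // A mA; rewrite IE.
  by apply: filterS2 l1 l2 => v h1 h2; apply/eqP; rewrite eq_le h1 h2.
have s0_le i : {ae mu, forall v, s0 (iota i) v <= p v (iota i)}.
  have [mi ii Ii] := s0P (iota i).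
  apply: ae_le_of_integral => //; first exact: bounded_mfun_integrable.
  by move=> A mA; rewrite Ii // integral_indic_mul lam_le.
have : {ae mu, forall v, (forall i, s0 (iota i) v <= p v (iota i)) /\
    forall (q : rat) i j k, iota k = ratr q *: iota i + iota j ->
      s0 (iota k) v = ratr q * s0 (iota i) v + s0 (iota j) v}.
  have h1 := ae_foralln s0_le.
  (* All linear relations between enumerated vectors form a countable family, indexed here by
     natural numbers. *)
  pose Q (z : rat * nat * (nat * nat)) v := let: (q, i, (j, k)) := z in
    iota k = ratr q *: iota i + iota j ->
      s0 (iota k) v = ratr q * s0 (iota i) v + s0 (iota j) v.
  have h2 : {ae mu, forall v, forall n, if unpickle n is Some z then Q z v else True}.
    apply: ae_foralln => n; case: unpickle => [[[q i] [j k]]|]; last exact: nearW.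
    have [kE|kE] := pselect (iota k = ratr q *: iota i + iota j).
      by apply: filterS (s0_lin _ _ _ _ kE) => v hv.
    by apply: nearW => v /= kE'.
  apply: filterS2 h1 h2 => v hv1 hv2; split => // q i j k.
  by have := hv2 (pickle (q, i, (j, k))); rewrite pickleK.
move=> [N [mN N0 goodN]].
(* Setting the densities to 0 on [N] makes the relations and the bound hold for every [v], so the
   extension converges everywhere and is measurable. *)
pose s1 i v := \1_(~` N) v * s0 (iota i) v.
have s1N i v : N v -> s1 i v = 0.
  by move=> Nv; rewrite /s1 indicE memNset ?mul0r //=; apply.
have s1C i v : ~ N v -> s1 i v = s0 (iota i) v.
  by move=> Nv; rewrite /s1 indicE mem_set ?mul1r.
have good v : ~ N v -> (forall i, s0 (iota i) v <= p v (iota i)) /\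
    forall (q : rat) i j k, iota k = ratr q *: iota i + iota j ->
      s0 (iota k) v = ratr q * s0 (iota i) v + s0 (iota j) v.
  by move=> Nv; apply: contrapT => bad; apply: Nv; apply: goodN.
have s1_lin v (q : rat) i j k : iota k = ratr q *: iota i + iota j ->
    s1 k v = ratr q * s1 i v + s1 j v.
  move=> kE; have [Nv|Nv] := pselect (N v); first by rewrite !s1N // mulr0 addr0.
  by rewrite !s1C //; exact: (good v Nv).2.
have s1_le v i : `|s1 i v| <= K * `|iota i|.
  have [Nv|Nv] := pselect (N v); first by rewrite s1N // normr0 mulr_ge0.
  have [le lin] := good v Nv; rewrite s1C //.
  have up k : s0 (iota k) v <= K * `|iota k|.
    by rewrite (le_trans (le k)) // (le_trans (ler_norm _)).
  (* [z] enumerates the zero vector and then [k] the vector [- iota i]: the upper bound at [k] is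
     the lower bound at [i]. *)
  have [z zE] := iota_lin (-1) i i; rewrite rmorphN1 scaleN1r addNr in zE.
  have [k kE] := iota_lin (-1) i z; have z0 : s0 (iota z) v = 0.
    have e : iota z = ratr (-1 : rat) *: iota i + iota i by rewrite rmorphN1 scaleN1r addNr.
    by have := lin _ _ _ _ e; rewrite rmorphN1 mulN1r addNr.
  have := lin _ _ _ _ kE; rewrite z0 addr0 rmorphN1 mulN1r => kv.
  rewrite rmorphN1 scaleN1r zE addr0 in kE.
  by rewrite ler_norml up // andbT lerNl -kv -normrN -kE up.
pose s v h := rational_extension idx (s1^~ v) h.
have ms1 i : measurable_fun setT (s1 i).
  apply: measurable_funM; last by have [] := s0P (iota i).
  by apply: measurable_indic; exact: measurableC.
have cs v h : (fun n => s1 (idx h n) v) @ \oo --> s v h.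
  exact: (@cvg_rational_extension _ _ _ _ idxP iota_lin (s1^~ v) K K0 (s1_lin v) (s1_le v) (idx h) h (cvg_iota_idx idxP (h := h))).
have bound h n : `|iota (idx h n)| <= `|h| + 1.
  rewrite -(subrK h (iota _)) (le_trans (ler_normD _ _)) // addrC lerD2l.
  by rewrite (le_trans (ltW (idxP h n))) // invf_le1 // ler1n.
have s1K h n v : `|s1 (idx h n) v| <= K * (`|h| + 1).
  by rewrite (le_trans (s1_le _ _)) // ler_wpM2l.
have ecv h := expect_cvg mu (fun n => ms1 (idx h n)) (s1K h) (cs^~ h).
have Is1 i : \int[mu]_v s1 i v = x (iota i).
  have [_ ii Ii] := s0P (iota i).
  rewrite -integral_indic_mul Ii ?lamT; last exact: measurableC.
  have lamN : lam (iota i) N = 0.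
    rewrite -Ii // /Rintegral null_set_integral //.
    by apply: (measurable_funS measurableT) => //; exact: measurable_int ii.
  rewrite -lamT -(setUv N) setUC lam_add ?lamN ?addr0 //.
  by apply/disj_setPS => v [].
exists s; split.
- by move=> h; have [[]] := ecv h.
- exists N; split => // v bad; apply: contrapT => Nv; apply: bad => /=.
  have [le _] := good v Nv; split.
    split; first by move=> a u w; exact: (rational_extension_linear idxP iota_lin K0 (s1_lin v) (s1_le v)).
    by exists K => u; exact: (rational_extension_norm idxP iota_lin K0 (s1_lin v) (s1_le v)).
  move=> h; apply: (rational_extension_le idxP iota_lin K0 (s1_lin v) (s1_le v)); first exact: p_lip.
  by move=> i; rewrite s1C.
move=> h; have [bs cs'] := ecv h; split; first exact: bounded_mfun_integrable.
have x0 : x 0 = 0 by have := x_lin 1 0 0; rewrite scaler0 addr0 mul1r; lra.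
have xB u w : x (u - w) = x u - x w.
  by have := x_lin (-1) w u; rewrite scaleN1r mulN1r addrC => ->; rewrite addrC.
have x_norm u : `|x u| <= K * `|u|.
  have half a : x a <= K * `|a|.
    rewrite (le_trans (x_le a)) // (le_trans (ler_norm _)) //.
    by apply: le_norm_expect => // v.
  by rewrite ler_norml lerNl -[- x u]add0r -x0 -xB sub0r half -normrN half.
suff cx : (fun n => x (iota (idx h n))) @ \oo --> x h.
  have e : (fun n => \int[mu]_v s1 (idx h n) v) = (fun n => x (iota (idx h n))).
    by apply/funext => n; rewrite Is1.
  by rewrite e in cs'; exact: (cvg_unique _ cx cs').
apply/cvgrPdist_le => e e0; have k0 : 0 < K + 1 by rewrite ltr_wpDl.
have /cvgrPdist_lt/(_ (e / (K + 1)) (divr_gt0 e0 k0)) := cvg_iota_idx idxP (h := h).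
apply: filterS => n; rewrite ltr_pdivlMr // => ab.
rewrite -xB (le_trans (x_norm _)) // (le_trans _ (ltW ab)) //.
by rewrite mulrC ler_wpM2l // lerDl.
Qed.

End Selection.

(** * The subdifferential of the probability function *)

Lemma le_Rintegral_ae d (T : measurableType d) (R : realType) (mu : {measure set T -> \bar R})
    (f h : T -> R) : mu.-integrable setT (EFin \o f) -> mu.-integrable setT (EFin \o h) ->
  {ae mu, forall v, f v <= h v} -> \int[mu]_v f v <= \int[mu]_v h v.
Proof.
move=> fi hi fh; rewrite -subr_ge0 -RintegralB //.
have bi := real_integrableB measurableT hi fi.
have ni := real_integrable_norm bi.
have -> : \int[mu]_v (h v - f v) = \int[mu]_v `|h v - f v|; last exact: Rintegral_ge0.
congr fine; apply: ae_eq_integral => //.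
- exact: measurable_int bi.
- exact: measurable_int ni.
- by apply: filterS fh => v fhv _ /=; rewrite ger0_norm // subr_ge0.
Qed.

Lemma prob_fun_regular (R : realType) (U : normedModType R) (m : nat) (d : measure_display)
    (Omega : measurableType d) (P : probability Omega R) (Sigma L : 'M[R]_m)
    (xi : Omega -> Rm R m) (g : U -> 'cV[R]_m -> R) (mu : probability (Rm R m) R) (ubar : U) :
  gaussian P xi Sigma -> L *m L^T = Sigma -> locally_lipschitz g -> jointly_convex g ->
  g ubar 0 < 0 -> uniform_sphere mu ->
  let p v h := clarke_val (fun u => radial_prob L g u v) ubar h in
  [/\ exists2 K, 0 <= K & forall (v : Rm R m) h, `|p v h| <= K * `|h|,
      forall (v : Rm R m) h1 h2, p v (h1 + h2) <= p v h1 + p v h2,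
      forall (v : Rm R m) (t : R) h, 0 < t -> p v (t *: h) <= t * p v h,
      forall h, bounded_mfun (fun v : Rm R m => p v h)
    & (forall (v : Rm R m) h, clarke_dd (fun u => radial_prob L g u v) ubar h = (p v h)%:E) /\
      forall h, clarke_dd (prob_fun P xi g) ubar h = (\int[mu]_v p v h)%:E].
Proof.
move=> xi_gaussian LL g_lip g_convex g_neg mu_uniform p.
have [r [K [r0 K0 H]]] := radial_prob_regular g_lip g_convex g_neg L.
have e_lip v := (H v).1; have e_reg v := (H v).2.
have e_bnd := bounded_radial_prob L mu g_lip.
split.
- by exists K => // v h; exact: clarke_val_norm r0 (e_lip v) h.
- by move=> v h1 h2; exact: clarke_val_subadd r0 (e_lip v) h1 h2.
- by move=> v t h t0; exact: (clarke_val_le_scale r0 (e_lip v) h t0).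
- by move=> h; exact: (expect_backward mu r0 e_bnd e_lip e_reg h).1.
split; first by move=> v h; exact: clarke_valE r0 (e_lip v) h.
have -> : prob_fun P xi g = fun u => \int[mu]_v radial_prob L g u v.
  by apply/funext => u; exact: (prob_fun_spherical xi_gaussian LL mu_uniform g_lip).
move=> h; rewrite (clarke_valE r0 (expect_lipschitz mu e_bnd e_lip)).
by rewrite (clarke_val_expect mu r0 e_bnd e_lip e_reg).
Qed.

Theorem theorem2p3 (R : realType) (U : completeNormedModType R) (m : nat)
  (d : measure_display) (Omega : measurableType d) (P : probability Omega R)
  (Sigma L : 'M[R]_m) (xi : Omega -> Rm R m) (g : U -> 'cV[R]_m -> R)
  (mu_zeta : probability (Rm R m) R) (ubar : U) :
  separable_space U -> reflexive_space U ->
  gaussian P xi Sigma ->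
  L *m L^T = Sigma ->
  locally_lipschitz g -> jointly_convex g ->
  g ubar 0 < 0 ->
  (exists B : R, forall z : 'cV[R]_m, g ubar z <= 0 -> `|z| <= B) ->
  uniform_sphere mu_zeta ->
  clarke_subdiff (prob_fun P xi g) ubar =
  aumann_integral mu_zeta
    (fun v => clarke_subdiff (fun u => radial_prob L g u v) ubar).
Proof.
move=> U_sep _ xi_gaussian LL g_lip g_convex g_neg _ mu_uniform.
have [[K K0 p_norm] p_subadd p_scale p_bounded [eE phiE]] :=
  prob_fun_regular xi_gaussian LL g_lip g_convex g_neg mu_uniform.
set p := fun v h => clarke_val (fun u => radial_prob L g u v) ubar h in eE phiE p_norm p_subadd p_scale p_bounded.
apply/seteqP; split => x [x_dual x_le]; split => //.
  (* A subgradient is a functional dominated by the integral of [p], and disintegration produces the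
     selection. *)
  have x_le' h : x h <= \int[mu_zeta]_v p v h by rewrite -lee_fin -phiE.
  have [s [ms sp sx]] := measurable_selection U_sep K0 p_norm p_subadd p_scale p_bounded
    x_dual.1 x_le'.
  exists s; split => //; split.
    by apply: filterS sp => v [sv_dual svp]; split => // h; rewrite eE lee_fin.
  move=> h; have [si xE] := sx h; split => //.
  by rewrite xE /Rintegral fineK //; exact: integrable_fin_num.
(* Conversely, a selection lies below [p v] almost everywhere, and integrating this gives the bound
   on [x]. *)
have [s [_ [sp sx]]] := x_le => h; have [si xE] := sx h.
rewrite phiE xE -[leLHS]fineK ?lee_fin; last exact: integrable_fin_num.
apply: le_Rintegral_ae => //; first exact: bounded_mfun_integrable.
by apply: filterS sp => v [_ /(_ h)]; rewrite eE lee_fin.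
Qed.
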